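(* Consider the drifted Brownian motion inventory model on $\mathcal I=\mathcal E=(-\infty,\infty)$ with $dX_0=-\mu\,dt+\sigma\,dW$, $\mu,\sigma>0$, holding/back-order cost $c_0(x)=-c_bx$ for $x<0$ and $c_0(x)=c_hx$ for $x\ge0$, and ordering cost $c_1(y,z)=k_1+k_2(z-y)$, where $c_b,c_h,k_1,k_2>0$. Then $F_0$ attains its infimum at some $(y_0^*,z_0^* )$ with $y_0^*<z_0^*$, and the $(y_0^*,z_0^* )$ ordering policy is optimal in $\mathcal A_0$, with optimal cost $F_0^*=F_0(y_0^*,z_0^* )$.
   Context: Here $W$ is a standard Brownian motion, $x_0\in\mathbb R$ the initial level, $\{\mathcal F_t\}$ the augmented filtration of $X_0$. The scale and speed measures are $S[y,z]=\frac{\sigma^2}{2\mu}(e^{2\mu z/\sigma^2}-e^{2\mu y/\sigma^2})$ and $M[y,z]=\frac1{2\mu}(e^{-2\mu y/\sigma^2}-e^{-2\mu z/\sigma^2})$. Define $g_0(x)=\int_{x_0}^x\int_u^\infty2c_0(v)\,dM(v)\,dS(u)$, $\zeta(x)=\int_{x_0}^x2M[u,\infty)\,dS(u)$, and $F_0(y,z)=\frac{c_1(y,z)+g_0(z)-g_0(y)}{\zeta(z)-\zeta(y)}$ for $y<z$, $F_0(y,y)=\infty$, $F_0^*=\inf_{y\le z}F_0(y,z)$. An ordering policy $(\tau,Y)=\{(\tau_k,Y_k)\}$ gives $X(t)=x_0-\mu t+\sigma W(t)+\sum_kI_{\{\tau_k\le t\}}Y_k$; it is admissible ($\in\mathcal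 A_0$) if $\{\tau_k\}$ is an increasing sequence of $\{\mathcal F_t\}$-stopping times and each $Y_k\ge0$ is $\mathcal F_{\tau_k}$-measurable. Its cost is $J_0(\tau,Y)=\limsup_{t\to\infty}t^{-1}\mathbb E[\int_0^tc_0(X(s))ds+\sum_kI_{\{\tau_k\le t\}}c_1(X(\tau_k-),X(\tau_k))]$. The $(y,z)$ ordering policy is $\tau_0=0$, $\tau_k=\inf\{t>\tau_{k-1}:X(t-)\le y\}$, $Y_k=z-X(\tau_k-)$. *)

(* Defs.v *)
From HB Require Import structures.
From mathcomp Require Import all_boot all_order all_algebra.
From mathcomp Require Import all_classical all_reals all_analysis.
Set Implicit Arguments. Unset Strict Implicit. Unset Printing Implicit Defensive.
Import Order.TTheory GRing.Theory Num.Theory.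
Import numFieldNormedType.Exports.
Local Open Scope classical_set_scope.
Local Open Scope ring_scope.

Section InventoryModel.
Context {R : realType} {d : measure_display} {T : measurableType d}.

Definition indep_increments (P : probability T R) (W : R -> T -> R) : Prop :=
  forall (n : nat) (t : nat -> R) (B : nat -> set R),
    0 <= t 0%N -> (forall i, t i <= t i.+1) -> (forall i, measurable (B i)) ->
    fine (P (\bigcap_(i in [set i : nat | (i < n)%N])
               ((fun w => W (t i.+1) w - W (t i) w) @^-1` B i)))
    = \prod_(i < n) fine (P ((fun w => W (t i.+1) w - W (t i) w) @^-1` B i)).

Definition is_BM (P : probability T R) (W : R -> T -> R) : Prop :=
  [/\ forall w, W 0 w = 0,
      forall w, {within [set t : R | 0 <= t], continuous (fun t => W t w)},
      forall t, measurable_fun setT (W t),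
      forall s t, 0 <= s -> s < t -> forall B : set R, measurable B ->
        P ((fun w => W t w - W s w) @^-1` B) = normal_prob 0 (Num.sqrt (t - s)) B
    & indep_increments P W].

Definition X0 (x0 mu sigma : R) (W : R -> T -> R) (t : R) (w : T) : R :=
  x0 - mu * t + sigma * W t w.

Definition natgen (x0 mu sigma : R) (W : R -> T -> R) (t : R) : set (set T) :=
  [set A | exists s (B : set R), [/\ 0 <= s <= t, measurable B &
                                     A = X0 x0 mu sigma W s @^-1` B]].

Definition filt (P : probability T R) (x0 mu sigma : R) (W : R -> T -> R) (t : R)
  : set (set T) :=
  [set A | measurable A /\
     exists B, <<s natgen x0 mu sigma W t >> B /\ P ((A `\` B) `|` (B `\` A)) = 0%E].

Definition filt_inf (P : probability T R) (x0 mu sigma : R) (W : R -> T -> R)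
  : set (set T) :=
  <<s \bigcup_(t in [set t : R | 0 <= t]) filt P x0 mu sigma W t >>.

Definition stopping_time (P : probability T R) (x0 mu sigma : R) (W : R -> T -> R)
  (tau : T -> \bar R) : Prop :=
  (forall w, (0 <= tau w)%E) /\
  forall t, 0 <= t -> filt P x0 mu sigma W t [set w | (tau w <= t%:E)%E].

Definition Ftau_measurable (P : probability T R) (x0 mu sigma : R) (W : R -> T -> R)
  (tau : T -> \bar R) (Y : T -> R) : Prop :=
  forall B : set R, measurable B ->
    filt_inf P x0 mu sigma W (Y @^-1` B) /\
    forall t, 0 <= t ->
      filt P x0 mu sigma W t (Y @^-1` B `&` [set w | (tau w <= t%:E)%E]).

(* An ordering policy is a pair (tau, Y) of sequences; index k : nat is the
   (k+1)-st order. *)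
Definition admissible (P : probability T R) (x0 mu sigma : R) (W : R -> T -> R)
  (tau : nat -> T -> \bar R) (Y : nat -> T -> R) : Prop :=
  [/\ forall k w, (tau k w <= tau k.+1 w)%E,
      forall k, stopping_time P x0 mu sigma W (tau k),
      forall k w, 0 <= Y k w
    & forall k, Ftau_measurable P x0 mu sigma W (tau k) (Y k)].

Definition c0 (cb ch : R) (x : R) : R := if x < 0 then - cb * x else ch * x.

(* extension to \bar R (X(t) = +oo only if infinitely many orders by time t) *)
Definition c0e (cb ch : R) (x : \bar R) : \bar R :=
  match x with EFin r => (c0 cb ch r)%:E | _ => +oo%E end.

Definition c1 (k1 k2 : R) (y z : R) : R := k1 + k2 * (z - y).

Definition ordered (tau : nat -> T -> \bar R) (Y : nat -> T -> R) (t : R) (w : T)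
  : \bar R :=
  (\sum_(k <oo) (if (tau k w <= t%:E)%E then (Y k w)%:E else 0%E))%E.

Definition Xc (x0 mu sigma : R) (W : R -> T -> R)
  (tau : nat -> T -> \bar R) (Y : nat -> T -> R) (t : R) (w : T) : \bar R :=
  ((X0 x0 mu sigma W t w)%:E + ordered tau Y t w)%E.

(* X(tau_k) - X(tau_k -) : total amount ordered at the instant tau_k *)
Definition jump (tau : nat -> T -> \bar R) (Y : nat -> T -> R) (k : nat) (w : T)
  : \bar R :=
  (\sum_(j <oo) (if tau j w == tau k w then (Y j w)%:E else 0%E))%E.

(* int_0^t c0(X(s)) ds + sum_k 1{tau_k <= t} c1(X(tau_k-), X(tau_k)),
   with c1(X(tau_k-),X(tau_k)) = k1 + k2 (X(tau_k) - X(tau_k-)) *)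
Definition pathcost (x0 mu sigma cb ch k1 k2 : R) (W : R -> T -> R)
  (tau : nat -> T -> \bar R) (Y : nat -> T -> R) (t : R) (w : T) : \bar R :=
  ((\int[lebesgue_measure]_(s in [set s : R | (0 <= s <= t)%R])
      c0e cb ch (Xc x0 mu sigma W tau Y s w))
   + \sum_(k <oo) (if (tau k w <= t%:E)%E
                   then k1%:E + k2%:E * jump tau Y k w else 0))%E.

Definition J0 (P : probability T R) (x0 mu sigma cb ch k1 k2 : R) (W : R -> T -> R)
  (tau : nat -> T -> \bar R) (Y : nat -> T -> R) : \bar R :=
  ereal_inf [set ereal_sup
     [set ((t^-1)%R%:E * \int[P]_w pathcost x0 mu sigma cb ch k1 k2 W tau Y t w)%E
     | t in [set t : R | M <= t /\ 0 < t]] | M in [set: R]].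

(* state after the (k+1)-st order: (tau, Y, cumulative amount ordered) *)
Fixpoint yz_state (x0 mu sigma : R) (W : R -> T -> R) (y z : R) (k : nat) (w : T)
  : \bar R * R * R :=
  let '(tprev, c) :=
    match k with
    | 0%N => (0%E, 0)
    | k'.+1 => let '(t', _, c') := yz_state x0 mu sigma W y z k' w in (t', c')
    end in
  let tk := ereal_inf [set t%:E | t in
              [set t : R | (tprev < t%:E)%E /\ X0 x0 mu sigma W t w + c <= y]] in
  let Yk := if tk is EFin r then z - (X0 x0 mu sigma W r w + c) else 0 in
  (tk, Yk, c + Yk).

Definition yz_tau x0 mu sigma W y z (k : nat) (w : T) : \bar R :=
  (yz_state x0 mu sigma W y z k w).1.1.
Definition yz_Y x0 mu sigma W y z (k : nat) (w : T) : R :=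
  (yz_state x0 mu sigma W y z k w).1.2.

End InventoryModel.

Section Fzero.
Context {R : realType}.

Definition Sm (mu sigma y z : R) : R :=
  sigma ^+ 2 / (2 * mu) * (expR (2 * mu * z / sigma ^+ 2) - expR (2 * mu * y / sigma ^+ 2)).
Definition Mm (mu sigma y z : R) : R :=
  (2 * mu)^-1 * (expR (- (2 * mu * y) / sigma ^+ 2) - expR (- (2 * mu * z) / sigma ^+ 2)).

(* their densities w.r.t. Lebesgue measure: dS(u) = s(u) du, dM(v) = m(v) dv *)
Definition sdens (mu sigma u : R) : R := expR (2 * mu * u / sigma ^+ 2).
Definition mdens (mu sigma v : R) : R := expR (- (2 * mu * v) / sigma ^+ 2) / sigma ^+ 2.

Definition oint (f : R -> R) (a b : R) : R :=
  if a <= b then fine (\int[lebesgue_measure]_(u in [set u : R | (a <= u <= b)%R]) (f u)%:E)%E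
  else - fine (\int[lebesgue_measure]_(u in [set u : R | (b <= u <= a)%R]) (f u)%:E)%E.

Definition Mtail (mu sigma : R) (f : R -> R) (u : R) : R :=
  fine (\int[lebesgue_measure]_(v in [set v : R | (u <= v)%R]) (f v * mdens mu sigma v)%:E)%E.

Definition g0 (x0 mu sigma cb ch : R) (x : R) : R :=
  oint (fun u => Mtail mu sigma (fun v => 2 * c0 cb ch v) u * sdens mu sigma u) x0 x.

Definition zeta (x0 mu sigma : R) (x : R) : R :=
  oint (fun u => 2 * Mtail mu sigma (fun _ => 1) u * sdens mu sigma u) x0 x.

Definition F0 (x0 mu sigma cb ch k1 k2 : R) (y z : R) : \bar R :=
  if y < z then
    ((c1 k1 k2 y z + g0 x0 mu sigma cb ch z - g0 x0 mu sigma cb ch y)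
       / (zeta x0 mu sigma z - zeta x0 mu sigma y))%:E
  else +oo%E.

Definition F0star (x0 mu sigma cb ch k1 k2 : R) : \bar R :=
  ereal_inf [set F0 x0 mu sigma cb ch k1 k2 p.1 p.2 | p in [set p : R * R | p.1 <= p.2]].

End Fzero.

(* Main.v *)
(* Writing g_0 and zeta through an antiderivative H of a solution h of the ODE
   sigma^2/2 h' - mu h + c_0 = 0 gives F_0(y,z) = mu ((k_1 + H z - H y)/(z - y) + k_2),
   which is minimized by compactness, h growing linearly on both sides.

   Lower bound: let F be the minimum.  Then V x = H x - (F/mu) x satisfies
   sigma^2/2 V'' - mu V' + c_0 = F and V y - V z <= k_1 + k_2 (z - y).  Bending V to the
   right of some point makes it bounded above, with a loss eps in the first relation.
   Applied to any controlled process, V loses at most the ordering cost at each jump, so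
   E V(X_t) <= C yields E cost_t >= (F - eps) t - C.  No Ito calculus is needed: between
   two points of a time grid a third-order Taylor expansion and Gaussian moments
   give the drift of V up to O(dt^(3/2)), and the errors vanish with the mesh.  Doob's
   inequality, in its pathwise form, dominates the Riemann sums of the holding cost.

   Upper bound: under the (y, z) policy all inequalities above are equalities for the
   unbent V, and X_t >= y keeps V(X_t) bounded below, so E cost_t <= F t + C.

   The k-th order of that policy occurs at the first passage of X_0 through the level
   min(x_0, y) - k (z - y), which makes it a stopping time; the only delicate case is
   k = 0, x_0 = y, where tau_0 = 0 almost surely but not surely. *)
Require Import Defs.
From HB Require Import structures.
From mathcomp Require Import all_boot all_order all_algebra.
From mathcomp Require Import all_classical all_reals all_analysis.
From mathcomp Require Import measurable_realfun.
From mathcomp Require Import ring lra.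
Import Order.TTheory GRing.Theory Num.Theory.
Import numFieldNormedType.Exports.
Local Open Scope classical_set_scope.
Local Open Scope ring_scope.

(** * Second-order Taylor bounds *)

(** The cost [c0] has a kink at 0, so h' is merely Lipschitz and V has no third derivative:
    regularity is carried by second-order bounds that survive gluing at 0 and at the bending point.
    The unbent V cannot serve the lower bound: H grows quadratically to the right and a policy may
    push the inventory arbitrarily high, leaving E V(X_t) without an upper bound. Beyond a point x1,
    V' + k_2 is therefore replaced by a curve with the same value and slope there, which stays
    nonnegative, so that a jump loses at most k_2 per unit, and decays to 0, so that V eventually
    decreases; the deviation from the line, made small by a slow decay, is what costs eps. To the
    left V is bounded above as it stands. On a grid, all orders of one cell act as a single jump at
    its end; merging can only lower the ordering cost, the right direction for the lower bound.
    Under the (y, z) policy the contribution of each order is followed separately and converges to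
    its exact value. The moments of Gaussian increments come from comparing normal densities with
    one another, not from computing integrals. *)

Section QuadApprox.
Context {R : realType}.
Implicit Types (f g : R -> R) (L : R).

(** Two-point encoding of a Lipschitz derivative. It implies differentiability and, unlike a
    condition on a second derivative, tolerates a kink in f'. *)
Definition qapprox L f f' := forall x y, `|f y - f x - f' x * (y - x)| <= L * (y - x) ^+ 2.

Lemma qapprox_ge0 L f f' : qapprox L f f' -> 0 <= L.
Proof. by move=> /(_ 0 1); rewrite subr0 expr1n !mulr1; apply: le_trans. Qed.

Lemma qapprox_is_derive L f f' (x : R) : qapprox L f f' -> is_derive (x:R) (1:R) f (f' x).
Proof.
move=> fq; have L0 := qapprox_ge0 _ _ _ fq.
have cv : (fun h => h^-1 *: ((f \o shift x) (h *: 1) - f x)) @ 0^' --> f' x.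
  apply/cvgrPdist_le => e e0.
  have eL : 0 < e / (L + 1) by rewrite divr_gt0 // ltr_wpDl.
  near=> h.
  have h0 : h != 0 by near: h; exact: nbhs_dnbhs_neq.
  rewrite /= /GRing.scale /= mulr1.
  have -> : f' x - h^-1 * (f (h + x) - f x)
     = - (h^-1 * (f (h + x) - f x - f' x * (h + x - x))) by field.
  rewrite normrN normrM.
  have /(ler_wpM2l (normr_ge0 h^-1)) := fq x (h + x).
  move=> /le_trans; apply; rewrite addrK normfV -(real_normK (num_real h)).
  have -> : `|h|^-1 * (L * `|h| ^+ 2) = L * `|h| by field; rewrite normr_eq0.
  rewrite (@le_trans _ _ ((L+1) * `|h|)) //.
    by rewrite ler_wpM2r // lerDl.
  rewrite mulrC -ler_pdivlMr ?ltr_wpDl //.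
  by near: h; exact: dnbhs0_le.
apply: DeriveDef; last by apply: cvg_lim.
by apply/cvg_ex; exists (f' x).
Unshelve. all: by end_near. Qed.

(** Adding the bound at x and the bound at y cancels the increments of f and leaves
    [(f' y - f' x) * (y - x)]. The domain D is there for the two half-lines of [qapprox_glue]. *)
Lemma qapprox_lip_on (D : set R) L f f' :
  (forall x y, D x -> D y -> `|f y - f x - f' x * (y - x)| <= L * (y - x) ^+ 2) ->
  forall x y, D x -> D y -> `|f' y - f' x| <= 2 * L * `|y - x|.
Proof.
move=> fq x y Dx Dy; have [->|xy] := eqVneq x y.
  by rewrite !subrr normr0 mulr0.
have h1 := fq x y Dx Dy; have h2 := fq y x Dy Dx.
have xy0 : 0 < `|y - x| by rewrite normr_gt0 subr_eq0 eq_sym.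
rewrite -(ler_pM2r xy0) -[leLHS]normrM.
have -> : 2 * L * `|y - x| * `|y - x| = 2 * L * (y - x) ^+ 2.
  by rewrite -[(y - x) ^+ 2]real_normK ?num_real // expr2 mulrA.
have := ler_normD (f y - f x - f' x * (y - x)) (f x - f y - f' y * (x - y)).
rewrite (_ : _ + _ = (f' y - f' x) * (y - x)); last by ring.
move=> /le_trans; apply; apply: (le_trans (lerD h1 h2)).
by rewrite le_eqVlt; apply/orP; left; apply/eqP; ring.
Qed.

Lemma qapprox_lip L f f' : qapprox L f f' ->
  forall x y, `|f' y - f' x| <= 2 * L * `|y - x|.
Proof. by move=> fq x y; apply: (@qapprox_lip_on setT L f f'). Qed.

Lemma lip_continuous L f : (forall x y, `|f y - f x| <= L * `|y - x|) -> continuous f.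
Proof.
move=> fL x; have L0 : 0 <= L.
  by have := fL 0 1; rewrite subr0 normr1 mulr1; apply: le_trans.
apply/cvgrPdist_le => e e0.
have eL : 0 < e / (L + 1) by rewrite divr_gt0 // ltr_wpDl.
near=> y; rewrite (le_trans (fL y x)) // (@le_trans _ _ ((L+1) * `|x - y|)) //.
  by rewrite ler_wpM2r // lerDl.
rewrite mulrC -ler_pdivlMr ?ltr_wpDl //.
Unshelve. all: by end_near. Qed.

(** For points on opposite sides of c, expand up to c and then from c. With p and q the distances to
    c, the errors are L p^2, L q^2 and, from the change of slope, 2 L p q: their sum L (p + q)^2
    keeps the same constant. *)
Lemma qapprox_glue c L f f' g g' :
  (forall x y, x <= c -> y <= c -> `|f y - f x - f' x * (y - x)| <= L * (y - x) ^+ 2) ->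
  (forall x y, c <= x -> c <= y -> `|g y - g x - g' x * (y - x)| <= L * (y - x) ^+ 2) ->
  f c = g c -> f' c = g' c ->
  qapprox L (fun x => if x <= c then f x else g x) (fun x => if x <= c then f' x else g' x).
Proof.
move=> fq gq fgc fgc' x y.
have fl := @qapprox_lip_on [set x | x <= c] L f f' fq.
have gl := @qapprox_lip_on [set x | c <= x] L g g' gq.
case: (leP x c) => xc; case: (leP y c) => yc.
- exact: fq.
- have := fl x c xc (lexx c).
  rewrite (@ger0_norm _ (c - x)) ?subr_ge0 // => A.
  have B := fq x c xc (lexx c); have C := gq c y (lexx c) (ltW yc).
  have D : (f' c - f' x) * (y - c) <= (2 * L * (c - x)) * (y - c) /\
     - ((2 * L * (c - x)) * (y - c)) <= (f' c - f' x) * (y - c).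
    move: A; rewrite ler_norml => /andP[A1 A2]; split.
      by rewrite ler_wpM2r // subr_ge0 ltW.
    by rewrite -mulNr ler_wpM2r // subr_ge0 ltW.
  move: B C D; rewrite -fgc -fgc' !ler_norml => /andP[B1 B2] /andP[C1 C2] [D1 D2].
  apply/andP; split; nra.
- have := gl x c (ltW xc) (lexx c).
  have xc0 : 0 <= x - c by rewrite subr_ge0 ltW.
  rewrite (distrC c) (ger0_norm xc0) => A.
  have B := fq c y (lexx c) yc; have C := gq x c (ltW xc) (lexx c).
  have D : (g' c - g' x) * (c - y) <= (2 * L * (x - c)) * (c - y) /\
     - ((2 * L * (x - c)) * (c - y)) <= (g' c - g' x) * (c - y).
    move: A; rewrite ler_norml => /andP[A1 A2]; split.
      by rewrite ler_wpM2r // subr_ge0.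
    by rewrite -mulNr ler_wpM2r // subr_ge0.
  move: B C D; rewrite fgc fgc' !ler_norml => /andP[B1 B2] /andP[C1 C2] [D1 D2].
  apply/andP; split; nra.
- by apply: gq; exact: ltW.
Qed.

Lemma derive_lip K f f' : (forall x, is_derive (x:R) (1:R) f (f' x)) -> (forall x, `|f' x| <= K) ->
  forall x y, `|f y - f x| <= K * `|y - x|.
Proof.
move=> df fK; have cf : continuous f.
  by move=> x; apply/differentiable_continuous/derivable1_diffP; case: (df x).
move=> x y; wlog xy : x y / x <= y.
  move=> H; have [|/ltW yx] := leP x y; first exact: H.
  by rewrite distrC (distrC y); exact: H.
have [c _ ->] := @MVT_segment R f f' x y xy (fun z _ => df z) (continuous_subspaceT cf).
by rewrite normrM ler_wpM2r.
Qed.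

Lemma derive_qapprox K f f' : (forall x, is_derive (x:R) (1:R) f (f' x)) ->
  (forall x y, `|f' y - f' x| <= K * `|y - x|) -> qapprox K f f'.
Proof.
move=> df fK x y; have K0 : 0 <= K.
  by have := fK 0 1; rewrite subr0 normr1 mulr1; apply: le_trans.
have cf : continuous f.
  by move=> z; apply/differentiable_continuous/derivable1_diffP; case: (df z).
have main u v z : u <= v -> (z = u \/ z = v) ->
    `|f v - f u - f' z * (v - u)| <= K * (v - u) ^+ 2.
  move=> uv zuv.
  have [c cuv ->] := @MVT_segment R f f' u v uv (fun z _ => df z) (continuous_subspaceT cf).
  rewrite -mulrBl normrM expr2 mulrA (@ger0_norm _ (v - u)) ?subr_ge0 //.
  apply: ler_wpM2r; first by rewrite subr_ge0.
  apply: (le_trans (fK z c)); apply: ler_wpM2l => //.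
  move: cuv; rewrite in_itv /= => /andP[uc cv].
  by case: zuv => ->; rewrite ler_norml; apply/andP; split; lra.
have [xy|/ltW yx] := leP x y; first by apply: main => //; left.
have -> : f y - f x - f' x * (y - x) = - (f x - f y - f' x * (x - y)) by ring.
rewrite normrN (_ : (y - x) ^+ 2 = (x - y) ^+ 2); last by ring.
by apply: main => //; right.
Qed.

(** Mean value theorem for the remainder as a function of the increment s: its derivative
    [v (x + s) - v x - q x * s] is at most L s^2, so a cubic error arises without a third
    derivative. *)
Lemma qapprox_taylor L V v q : (forall x, is_derive (x:R) (1:R) V (v x)) -> qapprox L v q ->
  forall x r, `|V (x + r) - V x - v x * r - q x * (r ^+ 2 / 2)| <= L * `|r| ^+ 3.
Proof.
move=> dV vq x r; have L0 := qapprox_ge0 _ _ _ vq.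
pose phi s := V (x + s) - v x * s - q x * (s ^+ 2 / 2).
pose phi' s := v (x + s) - v x - q x * s.
have dphi s : is_derive s (1:R) phi (phi' s).
  have dVs := dV (x + s).
  have : is_derive s (1 : R) (fun s => V (x + s)) (v (x + s)).
    have -> : (fun s => V (x + s)) = V \o shift x.
      by apply/funext => u /=; rewrite addrC.
    rewrite -[v (x + s)]mulr1; apply: is_derive1_comp; last exact: is_derive_shift.
    by rewrite /= addrC.
  move=> dVxs.
  apply: is_derive_eq; rewrite /phi' /= /GRing.scale /=; by field.
have cphi : continuous phi.
  by move=> z; apply/differentiable_continuous/derivable1_diffP; case: (dphi z).
have phib s : `|s| <= `|r| -> `|phi' s| <= L * `|r| ^+ 2.
  move=> sr; have := vq x (x + s).
  have -> : x + s - x = s by ring.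
  move=> /le_trans; apply.
  by rewrite ler_wpM2l // -[leLHS]ger0_norm ?sqr_ge0 // normrX lerXn2r ?nnegrE.
have -> : V (x + r) - V x - v x * r - q x * (r ^+ 2 / 2) = phi r - phi 0.
  by rewrite /phi addr0; ring.
rewrite exprSr mulrA; have [r0|/ltW r0] := leP 0 r.
  have [c] := @MVT_segment R phi phi' 0 r r0 (fun z _ => dphi z) (continuous_subspaceT cphi).
  rewrite in_itv /= => /andP[c0 cr] ->; rewrite subr0 normrM ler_wpM2r //.
  by apply: phib; rewrite !ger0_norm.
have [c] := @MVT_segment R phi phi' r 0 r0 (fun z _ => dphi z) (continuous_subspaceT cphi).
rewrite in_itv /= => /andP[c0 cr] E; rewrite distrC E sub0r normrM normrN ler_wpM2r //.
by apply: phib; rewrite !ler0_norm ?lerN2.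
Qed.

End QuadApprox.

(** * The cost potential *)

Section CostPotential.
Context {R : realType}.
Variables (mu sigma cb ch : R).
Hypotheses (mu0 : 0 < mu) (sigma0 : 0 < sigma) (cb0 : 0 < cb) (ch0 : 0 < ch).

(** Exponent of the scale density, and growth rate of the homogeneous solutions of the ODE for h. *)
Definition rate : R := 2 * mu / sigma ^+ 2.
Local Notation a := rate.

Definition pospart (u : R) : R := if u <= 0 then 0 else u.
Definition expneg1 (u : R) : R := if u <= 0 then expR (a * u) else 1.
Definition expneg0 (u : R) : R := if u <= 0 then expR (a * u) / a else a^-1 + u.

Definition hpot1 (u : R) : R := (- cb + (cb + ch) * expneg1 u) / mu.
(** The solution of the ODE with no exponential part on the positive side, where it is affine. On
    the negative side the coefficient of the exponential makes value and slope match at 0. *)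
Definition hpot (u : R) : R := (- cb / a - cb * u + (cb + ch) * expneg0 u) / mu.
(** Antiderivative of [hpot]: since [expneg0 = expneg1 / a + pospart] and [expneg1] is the
    derivative of [expneg0], an antiderivative of [expneg0] is [expneg0 / a + pospart ^+ 2 / 2]. *)
Definition Hpot (u : R) : R :=
  (- cb / a * u - cb * (u ^+ 2 / 2) + (cb + ch) * (expneg0 u / a + pospart u ^+ 2 / 2)) / mu.

Lemma rate_gt0 : 0 < a.
Proof. by rewrite /rate divr_gt0 ?exprn_gt0 // mulr_gt0. Qed.
Let a0 := rate_gt0.

(** By convexity the error lies between 0 and (e^y - e^x)(y - x), and the exponential is 1-Lipschitz
    on the negative half-line. Both facts follow from 1 + r <= e^r. *)
Lemma expR_qapprox_neg (x y : R) : x <= 0 -> y <= 0 ->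
  `|expR y - expR x - expR x * (y - x)| <= (y - x) ^+ 2.
Proof.
move=> x0 y0.
have ey : expR y = expR x * expR (y - x) by rewrite -expRD addrC subrK.
have e1 := expR_ge1Dx (y - x); have e2 := expR_ge1Dx (x - y).
have ex0 := expR_gt0 x; have ey0 := expR_gt0 y.
have ex1 : expR x <= 1 by rewrite -expR0 ler_expR.
have ey1 : expR y <= 1 by rewrite -expR0 ler_expR.
have e3 : expR x = expR y * expR (x - y) by rewrite -expRD addrC subrK.
have lo : 0 <= expR y - expR x - expR x * (y - x).
  by rewrite ey; nra.
rewrite ger0_norm //.
have up : expR y - expR x <= expR y * (y - x) by rewrite [in X in _ - X]e3; nra.
have lo' : expR x * (y - x) <= expR y - expR x by lra.
have : (expR y - expR x) * (y - x) <= (y - x) ^+ 2.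
  have [yx|xy] := leP 0 (y - x).
    by rewrite expr2 ler_wpM2r // (le_trans up) // ler_piMl.
  have q : y - x <= expR y - expR x by apply: le_trans lo'; nra.
  by rewrite expr2; apply: ler_wnM2r => //; exact: ltW.
nra.
Qed.

Lemma expneg_qapprox : qapprox a expneg0 expneg1.
Proof.
apply: (@qapprox_glue R 0 a (fun u => expR (a * u) / a) (fun u => expR (a * u))
   (fun u => a^-1 + u) (fun=> 1)).
- move=> x y x0 y0.
  have := @expR_qapprox_neg (a * x) (a * y).
  rewrite !pmulr_rle0 // => /(_ x0 y0) E.
  have -> : expR (a * y) / a - expR (a * x) / a - expR (a * x) * (y - x) =
    (expR (a * y) - expR (a * x) - expR (a * x) * (a * y - a * x)) / a.
    by field; rewrite gt_eqF.
  rewrite normrM (@gtr0_norm _ a^-1) ?invr_gt0 // ler_pdivrMr //.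
  by apply: (le_trans E); rewrite le_eqVlt; apply/orP; left; apply/eqP; ring.
- move=> x y _ _.
  have -> : a^-1 + y - (a^-1 + x) - 1 * (y - x) = 0 by ring.
  by rewrite normr0 mulr_ge0 ?sqr_ge0 // ltW.
- by rewrite mulr0 expR0 mul1r addr0.
- by rewrite mulr0 expR0.
Qed.

Lemma pospart_qapprox : qapprox 1 (fun u => pospart u ^+ 2 / 2) pospart.
Proof.
move=> x y; rewrite /pospart ler_norml.
have s1 := sqr_ge0 (y - x); have s2 := sqr_ge0 x; have s3 := sqr_ge0 y.
case: (leP x 0) => x0; case: (leP y 0) => y0; apply/andP; split; nra.
Qed.

Lemma expneg1_ge0 u : 0 <= expneg1 u.
Proof. by rewrite /expneg1; case: ifP => // _; exact: expR_ge0. Qed.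

Lemma expneg1_le1 u : expneg1 u <= 1.
Proof.
rewrite /expneg1; case: ifP => // u0; rewrite -expR0 ler_expR.
by rewrite pmulr_rle0.
Qed.

Lemma hpot_qapprox : qapprox ((cb + ch) * a / mu) hpot hpot1.
Proof.
move=> x y; have := expneg_qapprox x y.
have -> : hpot y - hpot x - hpot1 x * (y - x) =
   ((cb + ch) / mu) * (expneg0 y - expneg0 x - expneg1 x * (y - x)).
  by rewrite /hpot /hpot1; field; rewrite !gt_eqF.
have c0 : 0 < (cb + ch) / mu by rewrite divr_gt0 // addr_gt0.
move=> E; rewrite normrM (gtr0_norm c0).
have -> : (cb + ch) * a / mu * (y - x) ^+ 2 = ((cb + ch) / mu) * (a * (y - x) ^+ 2).
  by ring.
by rewrite ler_pM2l.
Qed.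

Lemma Hpot_is_derive (x : R) : is_derive x (1 : R) Hpot (hpot x).
Proof.
have d1 := qapprox_is_derive _ _ _ x expneg_qapprox.
have d2 := qapprox_is_derive _ _ _ x pospart_qapprox.
rewrite /Hpot; apply: is_derive_eq.
rewrite /= /GRing.scale /= /hpot.
have -> : expneg0 x = expneg1 x / a + pospart x.
  rewrite /expneg0 /expneg1 /pospart; case: ifP => _; first by rewrite addr0.
  by rewrite mul1r.
by field; rewrite !gt_eqF.
Qed.

Lemma hpot1_bound u : `|hpot1 u| <= (cb + ch) / mu.
Proof.
have := expneg1_ge0 u; have := expneg1_le1 u => e1 e0.
rewrite /hpot1 normrM (@gtr0_norm _ mu^-1) ?invr_gt0 // ler_pM2r ?invr_gt0 //.
have cc : 0 <= cb + ch by rewrite addr_ge0 // ltW.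
have p0 := mulr_ge0 cc e0; have p1 := ler_wpM2l cc e1.
have cbp := cb0; have chp := ch0.
have A : - (cb + ch) <= - cb + (cb + ch) * expneg1 u by lra.
have B : - cb + (cb + ch) * expneg1 u <= cb + ch by lra.
by rewrite ler_norml A.
Qed.

Lemma c0E u : c0 cb ch u = - cb * u + (cb + ch) * pospart u.
Proof.
rewrite /c0 /pospart; case: (ltgtP u 0) => [_|_|->]; ring.
Qed.

Lemma c0_ge0 u : 0 <= c0 cb ch u.
Proof. by have cbp := cb0; have chp := ch0; rewrite /c0; case: ltP => u0; nra. Qed.

Lemma c0_lip x y : `|c0 cb ch y - c0 cb ch x| <= (cb + ch) * `|y - x|.
Proof.
wlog xy : x y / x <= y.
  move=> H; have [|/ltW yx] := leP x y; first exact: H.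
  by rewrite distrC (distrC y); exact: H.
have cbp := cb0; have chp := ch0.
rewrite (@ger0_norm _ (y - x)) ?subr_ge0 // ler_norml /c0.
by case: ltP => x0; case: ltP => y0; apply/andP; split; nra.
Qed.

Lemma expneg_eq u : expneg0 u = expneg1 u / a + pospart u.
Proof.
rewrite /expneg0 /expneg1 /pospart; case: ifP => _; first by rewrite addr0.
by rewrite mul1r.
Qed.

Lemma hpot_ode u : sigma ^+ 2 / 2 * hpot1 u - mu * hpot u + c0 cb ch u = 0.
Proof.
rewrite c0E /hpot expneg_eq /hpot1 /rate; field.
by rewrite !gt_eqF.
Qed.

(** Form suited to the integrating factor e^(-a u): the derivative of - h e^(-a u) is the integrand
    2 c0 e^(-a u) / sigma^2. *)
Lemma hpot_ode' u : hpot1 u = a * hpot u - 2 / sigma ^+ 2 * c0 cb ch u.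
Proof.
have := hpot_ode u; rewrite /rate => E.
have s0 : sigma ^+ 2 != 0 by rewrite gt_eqF // exprn_gt0.
apply: (mulfI (_ : sigma ^+ 2 / 2 != 0)).
  by rewrite mulf_neq0 // invr_neq0.
rewrite -[LHS]addr0 -[X in _ + X]oppr0 -E; field.
by rewrite gt_eqF.
Qed.

End CostPotential.

Lemma is_derive_continuous {R : realType} (f f' : R -> R) :
  (forall x : R, is_derive x (1 : R) f (f' x)) -> continuous f.
Proof. by move=> df x; apply/differentiable_continuous/derivable1_diffP; case: (df x). Qed.

Lemma oint_antiderivative {R : realType} (f F : R -> R) a b : continuous f ->
  (forall x : R, is_derive x (1 : R) F (f x)) -> oint f a b = F b - F a.
Proof.
move=> cf dF; have cF := is_derive_continuous _ _ dF.
have main u v : u < v ->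
    fine (\int[lebesgue_measure]_(x in [set x : R | (u <= x <= v)%R]) (f x)%:E)%E = F v - F u.
  move=> uv.
  have -> : [set x : R | (u <= x <= v)%R] = `[u, v]%classic by rewrite set_itvcc.
  rewrite (@continuous_FTC2 _ f F u v uv) //.
  - by apply: continuous_subspaceT.
  - by split=> [x _||]; [case: (dF x)|exact: cvg_at_right_filter (cF u)
       |exact: cvg_at_left_filter (cF v)].
  - by move=> x _; rewrite derive1E; have [_ ->] := dF x.
rewrite /oint; case: (ltgtP a b) => [ab|ba|->].
- exact: main.
- by rewrite main // opprB.
- have -> : [set u : R | (b <= u <= b)%R] = [set b].
    by apply/seteqP; split=> x /=; [rewrite -eq_le => /eqP|move=> ->; rewrite lexx].
  by rewrite integral_set1 /= subrr.
Qed.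

Lemma tail_integral {R : realType} (f F : R -> R) u : (forall x, 0 <= f x) -> continuous f ->
  (forall x : R, is_derive x (1 : R) F (f x)) -> F x @[x --> +oo%R] --> (0 : R) ->
  (\int[lebesgue_measure]_(v in [set v : R | (u <= v)%R]) (f v)%:E = (- F u)%:E)%E.
Proof.
move=> f0 cf dF F0; have cF := is_derive_continuous _ _ dF.
have -> : [set v : R | (u <= v)%R] = `[u, +oo[%classic.
  by apply/seteqP; split=> x /=; rewrite in_itv /= andbT.
rewrite (@ge0_continuous_FTC2y R f F u 0) //.
- by rewrite sub0e -EFinN.
- by apply: continuous_subspaceT.
- exact: cvg_at_right_filter (cF u).
- by move=> x _; rewrite derive1E; have [_ ->] := dF x.
Qed.

Section CostPotentialIntegrals.
Context {R : realType}.
Variables (mu sigma cb ch : R).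
Hypotheses (mu0 : 0 < mu) (sigma0 : 0 < sigma) (cb0 : 0 < cb) (ch0 : 0 < ch).
Local Notation a := (rate mu sigma).
Let a0 : 0 < a. Proof. exact: rate_gt0. Qed.
Let sn0 : sigma != 0. Proof. by rewrite gt_eqF. Qed.
Let mn0 : mu != 0. Proof. by rewrite gt_eqF. Qed.
Lemma mdensE v : mdens mu sigma v = expR (- (a * v)) / sigma ^+ 2.
Proof. by rewrite /mdens; congr (expR _ / _); rewrite /rate; field; rewrite ?sn0 ?mn0. Qed.

Lemma sdensE v : sdens mu sigma v = expR (a * v).
Proof. by rewrite /sdens; congr (expR _); rewrite /rate; field; rewrite ?sn0 ?mn0. Qed.

Lemma expRN_rate_is_derive (x : R) :
  is_derive x (1 : R) (fun v => expR (- (a * v))) (- a * expR (- (a * x))).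
Proof. by apply: is_derive_eq; rewrite /= /GRing.scale /=; ring. Qed.

Lemma cvg_expRN_rate : expR (- (a * x)) @[x --> +oo%R] --> (0 : R).
Proof.
have c1 : a * x @[x --> +oo%R] --> +oo%R by apply: gt0_cvgMry => //; exact: cvg_id.
exact: (cvg_comp _ _ c1 (@cvgr_expR R)).
Qed.

Lemma Mtail_one u : Mtail mu sigma (fun=> 1) u = expR (- (a * u)) / (2 * mu).
Proof.
rewrite /Mtail; suff -> : (\int[lebesgue_measure]_(v in [set v : R | (u <= v)%R])
    (1 * mdens mu sigma v)%:E)%E = (- - (expR (- (a * u)) / (2 * mu)))%:E by rewrite /= opprK.
apply: (@tail_integral R _ (fun v => - (expR (- (a * v)) / (2 * mu)))).
- by move=> x; rewrite mdensE mul1r divr_ge0 ?expR_ge0 ?sqr_ge0.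
- have d x := expRN_rate_is_derive x.
  have -> : (fun v => 1 * mdens mu sigma v) = (fun v => expR (- (a * v)) / sigma ^+ 2).
    by apply/funext => v; rewrite mul1r mdensE.
  by move=> x; apply: cvgMl; exact: (is_derive_continuous _ _ d).
- move=> x; have d := expRN_rate_is_derive x.
  apply: is_derive_eq; rewrite /= /GRing.scale /= mdensE /rate; field.
  by rewrite sn0 mn0.
- rewrite -[X in _ --> X]oppr0; apply: cvgN; rewrite -[X in _ --> X](mul0r (2 * mu)^-1).
  by apply: cvgMl; exact: cvg_expRN_rate.
Qed.

Lemma hpot_continuous : continuous (hpot mu sigma cb ch).
Proof.
have q := hpot_qapprox mu sigma cb ch mu0 sigma0 cb0 ch0.
exact: (@is_derive_continuous R _ (hpot1 mu sigma cb ch) (fun x => qapprox_is_derive _ _ _ x q)).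
Qed.

Lemma c0_continuous : continuous (c0 cb ch).
Proof. by apply: lip_continuous; exact: c0_lip. Qed.

Lemma hpot_ge0_lin v : 0 <= v -> hpot mu sigma cb ch v = ch / mu * (a^-1 + v).
Proof.
rewrite /hpot /expneg0 => v0; case: (leP v 0) => v0'.
  have -> : v = 0 by apply/le_anti; rewrite v0 v0'.
  by rewrite !mulr0 expR0; field; rewrite !gt_eqF.
by field; rewrite !gt_eqF.
Qed.

(** On the positive side h is affine. Half of the exponent absorbs it through 1 + r <= e^r; the
    other half tends to 0. *)
Lemma cvg_hpot_exp : hpot mu sigma cb ch x * expR (- (a * x)) @[x --> +oo%R] --> (0 : R).
Proof.
have ub : (2 * ch / (mu * a)) * expR (- ((a / 2) * x)) @[x --> +oo%R] --> (0 : R).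
  rewrite -[X in _ --> X](mulr0 (2 * ch / (mu * a))); apply: cvgMr.
  have c1 : (a / 2) * x @[x --> +oo%R] --> +oo%R.
    by apply: gt0_cvgMry; [rewrite divr_gt0|exact: cvg_id].
  exact: (cvg_comp _ _ c1 (@cvgr_expR R)).
apply: (squeeze_cvgr _ (cvg_cst 0) ub).
near=> x.
have x0 : 0 <= x by near: x; exact: nbhs_pinfty_ge.
rewrite hpot_ge0_lin //.
have -> : expR (- (a * x)) = expR (- (a / 2 * x)) * expR (- (a / 2 * x)).
  by rewrite -expRD; congr expR; field.
apply/andP; split.
  by rewrite !mulr_ge0 ?expR_ge0 ?invr_ge0 ?addr_ge0 ?invr_ge0 // ltW.
rewrite mulrA; apply: ler_wpM2r; first exact: expR_ge0.
rewrite expRN ler_pdivrMr ?expR_gt0 //.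
have -> : ch / mu * (a^-1 + x) = (2 * ch / (mu * a)) * (2^-1 + a / 2 * x).
  by field; rewrite !gt_eqF.
have cp : 0 < 2 * ch / (mu * a) by apply: divr_gt0; apply: mulr_gt0.
rewrite ler_pM2l //.
by apply: (le_trans _ (expR_ge1Dx _)); lra.
Unshelve. all: by end_near. Qed.

(** The ODE makes - h e^(-a v) an antiderivative of the integrand, and the boundary term at infinity
    vanishes. This decay is what selects [hpot] among the solutions of the ODE. *)
Lemma Mtail_c0 u : Mtail mu sigma (fun v => 2 * c0 cb ch v) u =
  hpot mu sigma cb ch u * expR (- (a * u)).
Proof.
have mE v : 2 * c0 cb ch v * mdens mu sigma v =
    2 / sigma ^+ 2 * (c0 cb ch v * expR (- (a * v))).
  by rewrite mdensE; field.
rewrite /Mtail; suff -> : (\int[lebesgue_measure]_(v in [set v : R | (u <= v)%R])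
    (2 * c0 cb ch v * mdens mu sigma v)%:E)%E =
    (- - (hpot mu sigma cb ch u * expR (- (a * u))))%:E by rewrite /= opprK.
apply: (@tail_integral R (fun v => 2 * c0 cb ch v * mdens mu sigma v)
  (fun v => - (hpot mu sigma cb ch v * expR (- (a * v))))).
- by move=> x; rewrite mE mulr_ge0 ?divr_ge0 ?sqr_ge0 // mulr_ge0 ?expR_ge0 // c0_ge0.
- have d x := expRN_rate_is_derive x.
  under eq_fun do rewrite mE.
  move=> x; apply: cvgMr; apply: cvgM; first exact: c0_continuous.
  exact: (is_derive_continuous _ _ d).
- move=> x; have d := expRN_rate_is_derive x.
  have q := hpot_qapprox mu sigma cb ch mu0 sigma0 cb0 ch0.
  have dq := qapprox_is_derive _ _ _ x q.
  apply: is_derive_eq; rewrite /= /GRing.scale /= mE hpot_ode' //; ring.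
- by rewrite -[X in _ --> X]oppr0; apply: cvgN; exact: cvg_hpot_exp.
Qed.

Lemma g0_diff x0 y z : g0 x0 mu sigma cb ch z - g0 x0 mu sigma cb ch y =
  Hpot mu sigma cb ch z - Hpot mu sigma cb ch y.
Proof.
have E : (fun u => Mtail mu sigma (fun v => 2 * c0 cb ch v) u * sdens mu sigma u) =
    hpot mu sigma cb ch.
  apply/funext => u; rewrite Mtail_c0 sdensE -mulrA -expRD addNr expR0 mulr1 //.
have gE x : g0 x0 mu sigma cb ch x = Hpot mu sigma cb ch x - Hpot mu sigma cb ch x0.
  rewrite /g0 E; apply: oint_antiderivative; first exact: hpot_continuous.
  by move=> v; exact: Hpot_is_derive.
by rewrite !gE; ring.
Qed.

(** The scale density cancels the exponential of the speed tail, leaving the integrand 1 / mu. The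
    value is the mean time the drift takes from z down to y, the length of an order cycle. *)
Lemma zeta_diff x0 y z : zeta x0 mu sigma z - zeta x0 mu sigma y = (z - y) / mu.
Proof.
have E : (fun u => 2 * Mtail mu sigma (fun=> 1) u * sdens mu sigma u) = fun=> mu^-1.
  apply/funext => u; rewrite Mtail_one sdensE.
  have -> : 2 * (expR (- (a * u)) / (2 * mu)) * expR (a * u) =
    (expR (- (a * u)) * expR (a * u)) / mu by field; rewrite gt_eqF.
  by rewrite -expRD addNr expR0 mul1r.
have gE x : zeta x0 mu sigma x = x / mu - x0 / mu.
  rewrite /zeta E; apply: (@oint_antiderivative R (fun=> mu^-1) (fun v => v / mu)); first by move=> ?; exact: cvg_cst.
  by move=> v; apply: is_derive_eq; rewrite /= /GRing.scale /=; ring.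
by rewrite !gE; ring.
Qed.

Lemma F0E x0 k1 k2 y z : y < z -> F0 x0 mu sigma cb ch k1 k2 y z =
  (mu * ((k1 + Hpot mu sigma cb ch z - Hpot mu sigma cb ch y) / (z - y) + k2))%:E.
Proof.
move=> yz; rewrite /F0 yz /c1 -addrA g0_diff zeta_diff; congr (_%:E); field.
by rewrite !gt_eqF // subr_gt0.
Qed.

End CostPotentialIntegrals.

(** * Minimizing the average cost *)

Section Minimizer.
Context {R : realType}.

Let sq (u : R) := u * `|u| / 2.

(** [sq] is an antiderivative of the absolute value, whose mean over [y, z] is at least a fixed
    fraction of its value at either endpoint. The fraction 1/4 is not sharp. *)
Lemma sq_avg_lb (y z : R) : y < z ->
  (z - y) * (`|y| / 4) <= sq z - sq y /\ (z - y) * (`|z| / 4) <= sq z - sq y.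
Proof.
move=> yz; rewrite /sq.
have s1 := sqr_ge0 (z - y); have s2 := sqr_ge0 (z + y).
case: (leP 0 y) => y0; case: (leP 0 z) => z0;
  rewrite ?(ger0_norm y0) ?(ltr0_norm y0) ?(ger0_norm z0) ?(ltr0_norm z0); split; nra.
Qed.

Variables (mu sigma cb ch k1 : R).
Hypotheses (mu0 : 0 < mu) (sigma0 : 0 < sigma) (cb0 : 0 < cb) (ch0 : 0 < ch) (k10 : 0 < k1).
Local Notation a := (rate mu sigma).
Local Notation H := (Hpot mu sigma cb ch).
Local Notation h := (hpot mu sigma cb ch).

Lemma expneg0_homo (y z : R) : y <= z -> expneg0 mu sigma y <= expneg0 mu sigma z.
Proof.
move=> yz; have a0 : 0 < a := rate_gt0 mu sigma mu0 sigma0.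
have d := qapprox_is_derive _ _ _ _ (expneg_qapprox mu sigma mu0 sigma0).
have [c _ E] := @MVT_segment R _ _ y z yz (fun x _ => d x)
  (continuous_subspaceT (is_derive_continuous _ _ d)).
by rewrite -subr_ge0 E mulr_ge0 ?expneg1_ge0 // subr_ge0.
Qed.

(** Integrated form of mu h >= c0 - cb / a, obtained by dropping the nonnegative exponential term,
    combined with c0(u) >= min(cb, ch) |u|. *)
Lemma Hpot_lower (y z : R) : y < z ->
  Num.min cb ch * (sq z - sq y) - cb / a * (z - y) <= mu * (H z - H y).
Proof.
move=> yz; have a0 : 0 < a := rate_gt0 mu sigma mu0 sigma0.
have cbp := cb0; have chp := ch0.
have m1 : Num.min cb ch <= cb by rewrite ge_min lexx.
have m2 : Num.min cb ch <= ch by rewrite ge_min lexx orbT.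
have m0 : 0 < Num.min cb ch by rewrite lt_min cb0.
set m := Num.min cb ch in m1 m2 m0 *.
have -> : mu * (H z - H y) = - (cb / a) * (z - y)
  + (- cb * (z ^+ 2 / 2) + (cb + ch) * (pospart z ^+ 2 / 2)
     - (- cb * (y ^+ 2 / 2) + (cb + ch) * (pospart y ^+ 2 / 2)))
  + (cb + ch) / a * (expneg0 mu sigma z - expneg0 mu sigma y).
  by rewrite /Hpot; field; rewrite !gt_eqF.
have e0 : 0 <= (cb + ch) / a * (expneg0 mu sigma z - expneg0 mu sigma y).
  by rewrite mulr_ge0 ?subr_ge0 ?expneg0_homo ?(ltW yz) // divr_ge0 ?addr_ge0 // ltW.
suff : m * (sq z - sq y) <=
    (- cb * (z ^+ 2 / 2) + (cb + ch) * (pospart z ^+ 2 / 2)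
     - (- cb * (y ^+ 2 / 2) + (cb + ch) * (pospart y ^+ 2 / 2))) by lra.
rewrite /sq /pospart; case: (leP z 0) => z0; case: (leP y 0) => y0.
- rewrite !ler0_norm //.
  have : 0 <= (cb - m) * ((z - y) * (- z - y)).
    by rewrite !mulr_ge0 ?subr_ge0 // ?(ltW yz) //; lra.
  by nra.
- by lra.
- rewrite (gtr0_norm z0) (ler0_norm y0).
  have : 0 <= (cb - m) * y ^+ 2 by rewrite mulr_ge0 ?sqr_ge0 // subr_ge0.
  have : 0 <= (ch - m) * z ^+ 2 by rewrite mulr_ge0 ?sqr_ge0 // subr_ge0.
  by nra.
- rewrite !gtr0_norm //.
  have : 0 <= (ch - m) * ((z - y) * (z + y)).
    by rewrite !mulr_ge0 ?subr_ge0 // ?(ltW yz) //; lra.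
  by nra.
Qed.

Definition avgcost (y z : R) := (k1 + H z - H y) / (z - y).

(** Every pair that beats (0, 1) lies in a compact box: the fixed cost keeps the endpoints apart,
    and the linear growth of h keeps them bounded. *)
Lemma avgcost_minimizer : exists y z, y < z /\
  forall y' z', y' < z' -> avgcost y z <= avgcost y' z'.
Proof.
have a0 : 0 < a := rate_gt0 mu sigma mu0 sigma0.
have cbp := cb0; have chp := ch0; have k1p := k10; have mup := mu0.
pose m := Num.min cb ch.
have m0 : 0 < m by rewrite lt_min cb0.
pose K := avgcost 0 1.
pose g := cb / a.
have g0 : 0 < g by rewrite divr_gt0.
(* If [avgcost y' z' < K], then [Hpot_lower] yields [mu * k1 + m * (sq z' - sq y') < Q * (z' - y')].
   The second term on the left bounds both endpoints by 4 Q / m, the first bounds the length below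
   by [mu * k1 / Q]. *)
pose Q := mu * (`|K| + 1) + g.
have Q0 : 0 < Q by rewrite addr_gt0 // mulr_gt0 // ltr_wpDl.
pose M := 4 * Q / m + 1.
have M1 : 1 < M by rewrite ltrDr divr_gt0 // mulr_gt0.
pose eta := Num.min 1 (mu * k1 / Q).
have eta0 : 0 < eta by rewrite lt_min ltr01 divr_gt0 // mulr_gt0.
(* Coordinates are the left endpoint and the length, so that y < z becomes a bound on one factor.
   The minimum with 1 in [eta] keeps the reference pair inside. *)
pose A : set (R * R) := `[- M, M]%classic `*` `[eta, 2 * M]%classic.
have cA : compact A by apply: compact_setX; exact: segment_compact.
pose f (p : R * R) := avgcost p.1 (p.1 + p.2).
have cf : {within A, continuous f}.
  apply: continuous_in_subspaceT => -[y s] /set_mem [/= _].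
  rewrite in_itv /= => /andP[es _].
  have s0 : s != 0 by rewrite gt_eqF // (lt_le_trans eta0).
  have cH : continuous H by apply: (is_derive_continuous _ _ (fun x => Hpot_is_derive mu sigma cb ch mu0 sigma0 x)).
  rewrite /f /avgcost.
  have -> : (fun p : R * R => (k1 + H (p.1 + p.2) - H p.1) / (p.1 + p.2 - p.1)) =
            (fun p : R * R => (k1 + H (p.1 + p.2) - H p.1) / p.2).
    by apply/funext => p; rewrite [p.1 + p.2]addrC addrK.
  have c1 : {for (y, s), continuous (fun p : R * R => H p.1)}.
    by apply: (@continuous_comp _ _ _ fst H); [exact: cvg_fst|exact: cH].
  have c2 : {for (y, s), continuous (fun p : R * R => p.2)} by exact: cvg_snd.
  have c3 : {for (y, s), continuous (fun p : R * R => H (p.1 + p.2))}.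
    apply: (@continuous_comp _ _ _ (fun p : R * R => p.1 + p.2) H); last exact: cH.
    exact: add_continuous.
  have c4 : {for (y, s), continuous (fun p : R * R => p.2^-1)} by apply: cvgV.
  by apply: cvgM => //; apply: cvgB => //; apply: cvgD => //; exact: cvg_cst.
have A01 : A (0, 1).
  split; rewrite /= in_itv /=; apply/andP; split; [lra|lra| |lra].
  by rewrite ge_min lexx.
have [|[y s] /set_mem [/=]] := @compact_EVT_min _ R f A _ cA cf; first by exists (0, 1).
rewrite !in_itv /= => /andP[yM My] /andP[es sM] fmin.
have s0 : 0 < s := lt_le_trans eta0 es.
exists y, (y + s); split; first by rewrite ltrDl.
move=> y' z' yz.
have fK : f (y, s) <= K.
  by have := fmin _ (mem_set A01); rewrite {2}/f /= add0r.
have [in_A|nA] := pselect (A (y', z' - y')).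
  have := fmin _ (mem_set in_A); rewrite /f /=.
  by have -> : y' + (z' - y') = z' by ring.
apply: (le_trans fK); rewrite leNgt; apply/negP => lt; apply: nA.
have zy0 : 0 < z' - y' by rewrite subr_gt0.
move: lt; rewrite /avgcost ltr_pdivrMr // => lt.
have lt' : mu * (k1 + H z' - H y') < mu * (`|K| * (z' - y')).
  rewrite ltr_pM2l //; apply: (lt_le_trans lt); rewrite ler_pM2r //; exact: ler_norm.
have lo := Hpot_lower _ _ yz; rewrite -/m -/g in lo.
have [q1 q2] := sq_avg_lb _ _ yz.
have qle : mu * k1 + m * (sq z' - sq y') < Q * (z' - y').
  rewrite /Q; have : 0 < mu * (z' - y') by rewrite mulr_gt0.
  by nra.
have sq0 : 0 <= sq z' - sq y'.
  by apply: le_trans q1; rewrite mulr_ge0 ?divr_ge0 // ltW.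
have bnd r : (z' - y') * (r / 4) <= sq z' - sq y' -> r <= M - 1.
  move=> rq; rewrite /M addrK ler_pdivlMr //.
  have : m * ((z' - y') * (r / 4)) <= Q * (z' - y').
    apply: (@le_trans _ _ (m * (sq z' - sq y'))); first by rewrite ler_pM2l.
    have : 0 < mu * k1 by rewrite mulr_gt0.
    by lra.
  have -> : m * ((z' - y') * (r / 4)) = (m * r / 4) * (z' - y') by field.
  by rewrite ler_pM2r // => ?; lra.
have by' := bnd _ q1; have bz' := bnd _ q2.
move: by' bz'; rewrite !ler_norml => /andP[y1 y2] /andP[z1 z2].
split; rewrite /= in_itv /=; apply/andP; split; [lra|lra| |lra].
rewrite ge_min; apply/orP; right; rewrite ler_pdivrMr //.
have : 0 <= m * (sq z' - sq y') by rewrite mulr_ge0 // ltW.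
by lra.
Qed.

End Minimizer.

(** * Verification functions *)

Section RationalTail.
Context {R : realType}.
Variables (B K b : R).

(** Bent version of the line B + K s, which is h - l to the right of x1 with s = x - x1: equal value
    and slope at 0, close to the line while b s is small, and tending to 0 at infinity. *)
Definition rtail (s : R) := (B + K * s) / (1 + (b * s) ^+ 2).
Definition rtail1 (s : R) :=
  (K - 2 * B * b ^+ 2 * s - K * (b * s) ^+ 2) / (1 + (b * s) ^+ 2) ^+ 2.
Definition rtail2 (s : R) :=
  ((- 2 * B * b ^+ 2 - 2 * K * b ^+ 2 * s) * (1 + (b * s) ^+ 2)
   - (K - 2 * B * b ^+ 2 * s - K * (b * s) ^+ 2) * (4 * b ^+ 2 * s))
  / (1 + (b * s) ^+ 2) ^+ 3.
Definition Rtail (s : R) :=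
  B / b * atan (b * s) + K / (2 * b ^+ 2) * ln (1 + (b * s) ^+ 2).

Let den0 (s : R) : 0 < 1 + (b * s) ^+ 2.
Proof. by rewrite ltr_wpDr // sqr_ge0. Qed.

Lemma rtail_is_derive (s : R) : is_derive s (1 : R) rtail (rtail1 s).
Proof.
have d : 1 + (b * s) ^+ 2 != 0 by rewrite gt_eqF.
rewrite /rtail; apply: is_derive_eq; rewrite /= /GRing.scale /= /rtail1; by field.
Qed.

Lemma rtail1_is_derive (s : R) : is_derive s (1 : R) rtail1 (rtail2 s).
Proof.
have d : 1 + (b * s) ^+ 2 != 0 by rewrite gt_eqF.
have d2 : (1 + (b * s) ^+ 2) ^+ 2 != 0 by rewrite expf_neq0.
rewrite /rtail1; apply: is_derive_eq; rewrite /= /GRing.scale /= /rtail2; by field.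
Qed.

Lemma Rtail_is_derive (s : R) : b != 0 -> is_derive s (1 : R) Rtail (rtail s).
Proof.
move=> b0; have d := den0 s; have dn : 1 + (b * s) ^+ 2 != 0 by rewrite gt_eqF.
have dln := @is_derive1_ln R _ d.
have dat := is_derive1_atan (b * s).
have d1 : is_derive s (1 : R) (fun s => b * s) b.
  by apply: is_derive_eq; rewrite /= /GRing.scale /= mulr1.
have d2 : is_derive s (1 : R) (fun s => 1 + (b * s) ^+ 2) (2 * b * (b * s)).
  by apply: is_derive_eq; rewrite /= /GRing.scale /=; ring.
have d3 : is_derive s (1 : R) (fun s => atan (b * s)) ((1 + (b * s) ^+ 2)^-1 * b).
  exact: (@is_derive1_comp R atan (fun s => b * s) s _ _ dat d1).
have d4 : is_derive s (1 : R) (fun s => ln (1 + (b * s) ^+ 2))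
   ((1 + (b * s) ^+ 2)^-1 * (2 * b * (b * s))).
  exact: (@is_derive1_comp R (@ln R) (fun s => 1 + (b * s) ^+ 2) s _ _ dln d2).
rewrite /Rtail; apply: is_derive_eq; rewrite /= /GRing.scale /= /rtail.
by field; rewrite b0 dn.
Qed.

Hypotheses (B0 : 0 <= B) (K0 : 0 < K) (b0 : 0 < b).

Let abs_le (s : R) : b * `|s| <= 1 + (b * s) ^+ 2.
Proof.
have := sqr_ge0 (1 - b * `|s|); have -> : (b * s) ^+ 2 = (b * `|s|) ^+ 2.
  by rewrite !exprMn real_normK ?num_real.
have b1 := b0; have n0 := normr_ge0 s.
have : 0 <= b * `|s| by rewrite mulr_ge0 // ltW.
set x := b * `|s|; nra.
Qed.

Lemma rtail1_bound s : `|rtail1 s| <= K + 2 * B * b.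
Proof.
have d := den0 s; have D1 : 1 <= 1 + (b * s) ^+ 2 by rewrite lerDl sqr_ge0.
have A := abs_le s; have Bp := B0; have Kp := K0; have bp := b0.
have q := sqr_ge0 (b * s).
rewrite /rtail1 normrM normfV (@gtr0_norm _ ((1 + (b * s) ^+ 2) ^+ 2)) ?exprn_gt0 //.
rewrite ler_pdivrMr ?exprn_gt0 //.
apply: (@le_trans _ _ (K * (1 + (b * s) ^+ 2) + 2 * B * b * (b * `|s|))).
  apply: (le_trans (ler_normB _ _)); apply: (le_trans (lerD (ler_normB _ _) (lexx _))).
  rewrite (gtr0_norm K0) (normrM _ s) (@ger0_norm _ (2 * B * b ^+ 2)); last first.
    by rewrite !mulr_ge0 // ltW.
  rewrite (@ger0_norm _ (K * (b * s) ^+ 2)); last by rewrite mulr_ge0 ?sqr_ge0 // ltW.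
  by rewrite le_eqVlt; apply/orP; left; apply/eqP; ring.
have Bb : 0 <= 2 * B * b by rewrite !mulr_ge0 // ltW.
set D := 1 + (b * s) ^+ 2 in D1 A *.
apply: (@le_trans _ _ (K * D + 2 * B * b * D)); first by rewrite lerD2l ler_wpM2l.
rewrite -mulrDl; apply: ler_wpM2l; first by rewrite addr_ge0 // ltW.
by rewrite expr2 ler_peMr // (le_trans _ D1).
Qed.

(** Only finiteness matters: the bound serves as a Lipschitz constant of V'' on the bent part. Each
    factor s is traded for the denominator through b |s| <= 1 + (b s)^2. *)
Lemma rtail2_bound s : `|rtail2 s| <= 2 * B * b ^+ 2 + 2 * K * b + (K + 2 * B * b) * (4 * b).
Proof.
have d := den0 s; have D1 : 1 <= 1 + (b * s) ^+ 2 by rewrite lerDl sqr_ge0.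
have A := abs_le s; have Bp := B0; have Kp := K0; have bp := b0.
set D := 1 + (b * s) ^+ 2 in d D1 A *.
have D0 : 0 <= D by exact: ltW.
have N : `|K - 2 * B * b ^+ 2 * s - K * (b * s) ^+ 2| <= (K + 2 * B * b) * D.
  apply: (@le_trans _ _ (K * D + 2 * B * b * (b * `|s|))).
    apply: (le_trans (ler_normB _ _)); apply: (le_trans (lerD (ler_normB _ _) (lexx _))).
    rewrite (gtr0_norm K0) (normrM _ s) (@ger0_norm _ (2 * B * b ^+ 2)); last first.
      by rewrite !mulr_ge0 // ltW.
    rewrite (@ger0_norm _ (K * (b * s) ^+ 2)); last by rewrite mulr_ge0 ?sqr_ge0 // ltW.
    by rewrite le_eqVlt; apply/orP; left; apply/eqP; rewrite /D; ring.
  by rewrite (mulrDl K) lerD2l ler_wpM2l // !mulr_ge0 // ltW.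
have N' : `|- 2 * B * b ^+ 2 - 2 * K * b ^+ 2 * s| <= (2 * B * b ^+ 2 + 2 * K * b) * D.
  apply: (@le_trans _ _ (2 * B * b ^+ 2 + 2 * K * b * (b * `|s|))).
    apply: (le_trans (ler_normB _ _)).
    have -> : - 2 * B * b ^+ 2 = - (2 * B * b ^+ 2) by ring.
    rewrite normrN (normrM _ s) (@ger0_norm _ (2 * B * b ^+ 2)); last first.
      by rewrite !mulr_ge0 // ltW.
    rewrite (@ger0_norm _ (2 * K * b ^+ 2)); last by rewrite !mulr_ge0 // ltW.
    by rewrite le_eqVlt; apply/orP; left; apply/eqP; ring.
  have p1 : 0 <= 2 * B * b ^+ 2 by rewrite !mulr_ge0 ?exprn_ge0 // ltW.
  have p2 : 0 <= 2 * K * b by rewrite !mulr_ge0 // ltW.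
  by rewrite (mulrDl _ _ D) lerD ?ler_peMr // ler_wpM2l.
have S : `|4 * b ^+ 2 * s| <= 4 * b * D.
  rewrite normrM (@ger0_norm _ (4 * b ^+ 2)); last by rewrite !mulr_ge0 // ltW.
  have -> : 4 * b ^+ 2 * `|s| = 4 * b * (b * `|s|) by ring.
  by rewrite ler_wpM2l // mulr_ge0 // ltW.
rewrite /rtail2 -/D normrM normfV (@ger0_norm _ (D ^+ 3)) ?exprn_ge0 //.
rewrite ler_pdivrMr ?exprn_gt0 //.
apply: (@le_trans _ _ ((2 * B * b ^+ 2 + 2 * K * b + (K + 2 * B * b) * (4 * b)) * D ^+ 2)).
  apply: (le_trans (ler_normB _ _)); rewrite (mulrDl _ _ (D ^+ 2)); apply: lerD.
    rewrite normrM (ger0_norm D0); apply: (le_trans (ler_wpM2r D0 N')).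
    by rewrite le_eqVlt; apply/orP; left; apply/eqP; ring.
  rewrite normrM; apply: (le_trans (ler_pM _ _ N S)) => //.
  by rewrite le_eqVlt; apply/orP; left; apply/eqP; ring.
apply: ler_wpM2l.
  by rewrite !addr_ge0 // !mulr_ge0 ?exprn_ge0 ?addr_ge0 // ?mulr_ge0 // ltW.
have -> : D ^+ 3 = D ^+ 2 * D by ring.
by rewrite ler_peMr ?exprn_ge0.
Qed.

Lemma rtail_ge0 s : 0 <= s -> 0 <= rtail s.
Proof.
by move=> s0; rewrite /rtail divr_ge0 ?(ltW (den0 s)) // addr_ge0 // mulr_ge0 // ltW.
Qed.

Lemma rtail_ub s : `|rtail s| <= B + K / b.
Proof.
have d := den0 s; have D1 : 1 <= 1 + (b * s) ^+ 2 by rewrite lerDl sqr_ge0.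
have A := abs_le s; have Bp := B0; have Kp := K0; have bp := b0.
rewrite /rtail normrM normfV (gtr0_norm d) ler_pdivrMr //.
apply: (le_trans (ler_normD _ _)); rewrite (ger0_norm B0) normrM (gtr0_norm K0) mulrDl.
apply: lerD; first by rewrite ler_peMr.
have -> : K * `|s| = K / b * (b * `|s|) by field; rewrite gt_eqF.
by rewrite ler_wpM2l // divr_ge0 // ltW.
Qed.

(** For s >= 1 the numerator is at most (B + K) s, while the denominator exceeds (b s)^2. With k =
    k2 this makes the bent function decrease far to the right. *)
Lemma rtail_eventually_le k s : 0 < k -> 1 + (B + K) / (k * b ^+ 2) <= s -> rtail s <= k.
Proof.
move=> k0 sS; have d := den0 s; have Bp := B0; have Kp := K0; have bp := b0.
have kb : 0 < k * b ^+ 2 by rewrite mulr_gt0 ?exprn_gt0.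
have BK : 0 < B + K by rewrite ltr_wpDl.
have s1 : 1 <= s by apply: le_trans sS; rewrite lerDl divr_ge0 // ltW.
have s2 : B + K <= k * b ^+ 2 * s.
  rewrite mulrC -ler_pdivrMr //; apply: le_trans sS; lra.
rewrite /rtail ler_pdivrMr //.
have : (B + K) * s <= k * b ^+ 2 * s * s by rewrite ler_wpM2r //; lra.
have : B * 1 <= B * s by rewrite ler_wpM2l.
have -> : (b * s) ^+ 2 = b ^+ 2 * s * s by ring.
move=> h1 h2.
have -> : k * (1 + b ^+ 2 * s * s) = k + k * b ^+ 2 * s * s by ring.
by lra.
Qed.

(* After clearing denominators, with [t = b^2], the inequality is a polynomial
   one that reduces to [s^2 - 2cs >= -c^2] and [s^3 - 3cs^2 >= -4c^3]. *)
Lemma rtail_supersolution (c e s : R) : 0 < c -> 0 <= e -> 0 <= s ->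
  b ^+ 2 * (B * c ^+ 2 + 4 * K * c ^+ 3) <= e ->
  0 <= c * rtail1 s - rtail s + K * s + B - K * c + e.
Proof.
move=> c0 e0 s0 be; have Bp := B0; have Kp := K0.
have d := den0 s; have dn : 1 + (b * s) ^+ 2 != 0 by rewrite gt_eqF.
set t := b ^+ 2 in be.
have t0 : 0 <= t by exact: sqr_ge0.
have E : c * rtail1 s - rtail s + K * s + B - K * c + e =
  (B * t * (s ^+ 2 - 2 * c * s) + K * t * (s ^+ 3 - 3 * c * s ^+ 2)
   + B * t ^+ 2 * s ^+ 4 + K * t ^+ 2 * (s ^+ 2 * (s ^+ 3 - c * s ^+ 2))
   + e * (1 + 2 * t * s ^+ 2 + t ^+ 2 * s ^+ 4)) / (1 + (b * s) ^+ 2) ^+ 2.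
  by rewrite /rtail1 /rtail /t; field.
rewrite E; apply: divr_ge0; last by rewrite exprn_ge0 // ltW.
have p1 : - c ^+ 2 <= s ^+ 2 - 2 * c * s by have := sqr_ge0 (s - c); nra.
have p2 : - (4 * c ^+ 3) <= s ^+ 3 - 3 * c * s ^+ 2.
  have -> : s ^+ 3 - 3 * c * s ^+ 2 = (s - 2 * c) ^+ 2 * (s + c) - 4 * c ^+ 3 by ring.
  by have : 0 <= (s - 2 * c) ^+ 2 * (s + c); [rewrite mulr_ge0 ?sqr_ge0 //|]; lra.
have p3 : - c ^+ 3 <= s ^+ 3 - c * s ^+ 2.
  have : 0 <= s ^+ 3 by rewrite exprn_ge0.
  have [sc|cs] := leP s c.
    have : c * s ^+ 2 <= c * c ^+ 2 by rewrite ler_pM2l // lerXn2r ?nnegrE // ltW.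
    by rewrite -exprS; lra.
  have : c * s ^+ 2 <= s * s ^+ 2 by rewrite ler_wpM2r ?sqr_ge0 // ltW.
  rewrite -exprS; have : 0 < c ^+ 3 by rewrite exprn_gt0.
  by lra.
have q1 : B * t * - c ^+ 2 <= B * t * (s ^+ 2 - 2 * c * s).
  by rewrite ler_wpM2l // mulr_ge0.
have q2 : K * t * - (4 * c ^+ 3) <= K * t * (s ^+ 3 - 3 * c * s ^+ 2).
  by rewrite ler_wpM2l // mulr_ge0 // ltW.
have q3 : K * t ^+ 2 * (s ^+ 2 * - c ^+ 3) <= K * t ^+ 2 * (s ^+ 2 * (s ^+ 3 - c * s ^+ 2)).
  by rewrite !ler_wpM2l ?mulr_ge0 ?sqr_ge0 // ltW.
have q4 : 0 <= B * t ^+ 2 * s ^+ 4.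
  by apply: mulr_ge0; [apply: mulr_ge0 => //; exact: sqr_ge0|exact: exprn_ge0].
have q5 : 0 <= e * (t ^+ 2 * s ^+ 4).
  by apply: mulr_ge0 => //; apply: mulr_ge0; exact: exprn_ge0.
have u1 : 0 <= t * s ^+ 2 by rewrite mulr_ge0 ?sqr_ge0.
(* The remaining loss K t^2 s^2 c^3 is paid by one of the two copies of [e * (t * s ^+ 2)], because
   t K c^3 <= e. *)
have q6 : t * (K * c ^+ 3) * (t * s ^+ 2) <= e * (t * s ^+ 2).
  apply: ler_wpM2r => //; apply: le_trans be; apply: ler_wpM2l => //.
  have := mulr_ge0 Bp (sqr_ge0 c).
  have : 0 <= K * c ^+ 3 by rewrite mulr_ge0 ?exprn_ge0 // ltW.
  lra.
have q7 : 0 <= e * (t * s ^+ 2) by rewrite mulr_ge0.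
have -> : 2 * t * s ^+ 2 = t * s ^+ 2 + t * s ^+ 2 by ring.
have i1 : K * t ^+ 2 * (s ^+ 2 * - c ^+ 3) = - (t * (K * c ^+ 3) * (t * s ^+ 2)) by ring.
have i2 : B * t * - c ^+ 2 + K * t * - (4 * c ^+ 3) = - (t * (B * c ^+ 2 + 4 * K * c ^+ 3)) by ring.
rewrite i1 in q3.
by rewrite !mulrDr mulr1; lra.
Qed.

End RationalTail.

Definition negpart {R : realType} (x : R) : R := Num.max (- x) 0.

Section Verification.
Context {R : realType}.
Variables (mu sigma cb ch k1 k2 l : R).
Hypotheses (mu0 : 0 < mu) (sigma0 : 0 < sigma) (cb0 : 0 < cb) (ch0 : 0 < ch)
  (k10 : 0 < k1) (k20 : 0 < k2).
Local Notation a := (rate mu sigma).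
Local Notation H := (Hpot mu sigma cb ch).
Local Notation h := (hpot mu sigma cb ch).
Local Notation h1 := (hpot1 mu sigma cb ch).

Let a0 : 0 < a. Proof. exact: rate_gt0. Qed.
Let cb_ch : 0 < cb + ch. Proof. exact: addr_gt0. Qed.
Lemma expneg0_ge0 u : 0 <= expneg0 mu sigma u.
Proof.
rewrite /expneg0; case: (leP u 0) => u0; first by rewrite divr_ge0 ?expR_ge0 // ltW.
by rewrite addr_ge0 ?invr_ge0 // ltW.
Qed.

Lemma hpot_lb u : (- cb / a - cb * u) / mu <= h u.
Proof.
rewrite /hpot ler_pM2r ?invr_gt0 // lerDl mulr_ge0 ?expneg0_ge0 //; exact: ltW.
Qed.

Lemma hpot_lip (x y : R) : `|h y - h x| <= (cb + ch) / mu * `|y - x|.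
Proof.
apply: (derive_lip _ h h1); last exact: hpot1_bound.
move=> u; exact: (qapprox_is_derive _ _ _ u (hpot_qapprox mu sigma cb ch mu0 sigma0 cb0 ch0)).
Qed.

(** The asymmetry is deliberate. Quadratic growth is affordable on the left, where a controlled path
    stays above the square-integrable uncontrolled one; on the right only linear growth is, since
    just the mean of the ordered amount is known to be finite. *)
Lemma linear_growth (K C m : R) (V v : R -> R) :
  (forall x : R, is_derive x (1 : R) V (v x)) ->
  (forall x, `|v x| <= C + K * negpart x) -> 0 <= C -> 0 <= K ->
  forall x, `|V x| <= `|V 0| + C * `|x| + K * negpart x ^+ 2.
Proof.
move=> dV vC C0 K0 x.
have cV := is_derive_continuous _ _ dV.
suff : `|V x - V 0| <= C * `|x| + K * negpart x ^+ 2.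
  move=> A; have := ler_normD (V x - V 0) (V 0); rewrite subrK => /le_trans; apply.
  by lra.
have [x0|x0] := leP 0 x.
  have [c] := @MVT_segment R V v 0 x x0 (fun z _ => dV z) (continuous_subspaceT cV).
  rewrite in_itv /= => /andP[c0 _] ->; rewrite subr0 normrM.
  apply: (@le_trans _ _ (C * `|x|)); last by rewrite lerDl mulr_ge0 // sqr_ge0.
  apply: ler_wpM2r => //; apply: (le_trans (vC c)).
  by rewrite /negpart max_r ?oppr_le0 // mulr0 addr0.
have [c] := @MVT_segment R V v x 0 (ltW x0) (fun z _ => dV z) (continuous_subspaceT cV).
rewrite in_itv /= => /andP[xc c0] E; rewrite distrC E sub0r normrM normrN.
apply: (@le_trans _ _ ((C + K * (- x)) * `|x|)).
  apply: ler_wpM2r => //; apply: (le_trans (vC c)); rewrite lerD2l ler_wpM2l //.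
  by rewrite /negpart max_l ?oppr_ge0 // lerN2.
by rewrite (ltr0_norm x0) /negpart max_l ?oppr_ge0 ?(ltW x0) //; lra.
Qed.

(** The unbent V: with [l] the minimal value of [avgcost], the minimal cost is F =
    [mu * (l + k2)]. *)
Definition Vupper (x : R) := H x - (l + k2) * x.
Definition vupper (x : R) := h x - (l + k2).

Lemma Vupper_is_derive (x : R) : is_derive x (1 : R) Vupper (vupper x).
Proof.
have d := Hpot_is_derive mu sigma cb ch mu0 sigma0 x.
by apply: is_derive_eq; rewrite /= /GRing.scale /= mulr1.
Qed.

Lemma vupper_qapprox : qapprox ((cb + ch) * a / mu) vupper h1.
Proof.
move=> x y; have := hpot_qapprox mu sigma cb ch mu0 sigma0 cb0 ch0 x y.
by rewrite /vupper (_ : h y - (l + k2) - (h x - (l + k2)) = h y - h x); last by ring.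
Qed.

Lemma Vupper_generator x :
  sigma ^+ 2 / 2 * h1 x - mu * vupper x + c0 cb ch x = mu * (l + k2).
Proof. by have := hpot_ode mu sigma cb ch mu0 sigma0 x; rewrite /vupper; lra. Qed.

Lemma vupper_growth x : `|vupper x| <= `|vupper 0| + (cb + ch) / mu * `|x|.
Proof.
have := hpot_lip 0 x; rewrite subr0.
have := ler_normD (vupper x - vupper 0) (vupper 0); rewrite subrK.
rewrite (_ : vupper x - vupper 0 = h x - h 0); last by rewrite /vupper; ring.
by lra.
Qed.

(** Compactness up to M, monotonicity beyond. Applied to - V(x) and - V(-x), it also yields upper
    bounds. *)
Lemma eventually_pos_derive_lb (V v : R -> R) m M :
  (forall x : R, is_derive x (1 : R) V (v x)) -> m <= M ->
  (forall x, M <= x -> 0 <= v x) -> exists C, forall x, m <= x -> C <= V x.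
Proof.
move=> dV mM vM; have cV := is_derive_continuous _ _ dV.
have [c cmM Vc] := EVT_min mM (@continuous_subspaceT _ _ `[m, M]%classic _ cV).
exists (V c) => x mx; have [xM|/ltW Mx] := leP x M.
  by apply: Vc; rewrite in_itv /= mx.
apply: (@le_trans _ _ (V M)); first by apply: Vc; rewrite in_itv /= mM lexx.
have [d] := @MVT_segment R V v M x Mx (fun z _ => dV z) (continuous_subspaceT cV).
rewrite in_itv /= => /andP[Md _]; rewrite -subr_ge0 => ->.
by rewrite mulr_ge0 ?vM // subr_ge0.
Qed.

Lemma Vupper_bounded_below y : exists C, forall x, y <= x -> C <= Vupper x.
Proof.
(* Beyond M the affine branch of h already exceeds [l + k2]. *)
pose M := `|y| + (`|l + k2| * mu / ch).
have M0 : 0 <= M by rewrite addr_ge0 // divr_ge0 ?mulr_ge0 // ltW.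
apply: (@eventually_pos_derive_lb Vupper vupper y M).
- exact: Vupper_is_derive.
- by rewrite (le_trans (ler_norm y)) // lerDl divr_ge0 ?mulr_ge0 // ltW.
move=> x Mx; rewrite /vupper subr_ge0 hpot_ge0_lin //; last exact: le_trans Mx.
have : `|l + k2| * mu / ch <= x by apply: le_trans Mx; rewrite lerDr.
rewrite ler_pdivrMr // => A.
apply: (le_trans (ler_norm _)); rewrite mulrAC ler_pdivlMr //.
by rewrite (le_trans A) // mulrC ler_pM2l // lerDr invr_ge0 ltW.
Qed.

Hypothesis k1_bound : forall y z, y < z -> - k1 <= H z - H y - l * (z - y).

(** [Vupper] up to x1, continued with derivative [rtail (x - x1) - k2]; value, first and second
    derivative agree at x1. The hypothesis [k1_bound], minimality of l, gives the jump inequality on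
    the left of x1. *)
Lemma lower_function eps : 0 < eps -> exists V v q : R -> R, exists L Q C : R,
  [/\ (forall x : R, is_derive x (1 : R) V (v x)) /\ qapprox L v q,
      (forall x, `|q x| <= Q),
      (forall x, mu * (l + k2) - eps <= sigma ^+ 2 / 2 * q x - mu * v x + c0 cb ch x),
      (forall y z, y <= z -> V y - V z <= k1 + k2 * (z - y))
    & [/\ forall x, V x <= C, forall x, `|v x| <= C + Q * negpart x
        & forall x, `|V x| <= C + C * `|x| + Q * negpart x ^+ 2]].
Proof.
move=> eps0.
have cbp := cb0; have chp := ch0; have k1p := k10; have k2p := k20; have mup := mu0.
(* c = sigma^2 / (2 mu): divided by mu, the generator reads c q - v, the form of
   [rtail_supersolution]. *)
pose c := a^-1.
have cc : 0 < c by rewrite invr_gt0.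
pose K := ch / mu.
have K0 : 0 < K by rewrite divr_gt0.
(* [K * x1] is the absolute value of l, hence h x1 >= l and B >= 0, so that V' >= - k2 at the bend.
   Also x1 >= 0 puts the bend where c0 and h are affine. *)
pose x1 := `|l| / K.
have x10 : 0 <= x1 by rewrite divr_ge0 // ltW.
pose B := h x1 - l.
have hx1 : h x1 = K * (c + x1) by rewrite hpot_ge0_lin.
have B0 : 0 <= B.
  rewrite /B hx1 subr_ge0 mulrDr.
  have -> : K * x1 = `|l| by rewrite /x1; field; rewrite gt_eqF.
  by have := ler_norm l; have : 0 < K * c by [rewrite mulr_gt0|]; lra.
pose D := B * c ^+ 2 + 4 * K * c ^+ 3 + 1.
have D1 : 1 <= D.
  have : 0 <= B * c ^+ 2 by apply: mulr_ge0 => //; exact: sqr_ge0.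
  have : 0 <= 4 * K * c ^+ 3.
    by apply: mulr_ge0; [rewrite mulr_ge0 // ltW|rewrite exprn_ge0 // ltW].
  by rewrite /D; lra.
(* Gives b^2 (B c^2 + 4 K c^3) <= eps / mu; the [+ 1] in D keeps the divisor positive. *)
pose b := Num.sqrt (eps / mu / D).
have D0 : 0 < D by lra.
have b0 : 0 < b by rewrite sqrtr_gt0 !divr_gt0.
have b2 : b ^+ 2 = eps / mu / D by rewrite sqr_sqrtr // !divr_ge0 // ltW.
pose r := rtail B K b; pose r1 := rtail1 B K b.
pose V1 s := Rtail B K b s.
pose Vr x := Vupper x1 + (V1 (x - x1) - V1 0) - k2 * (x - x1).
pose vr x := r (x - x1) - k2.
have hL := hpot_lip.
have shiftd (f f' : R -> R) (k x : R) : (forall x : R, is_derive x (1 : R) f (f' x)) ->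
    is_derive x (1 : R) (fun x => f (x - k)) (f' (x - k)).
  move=> df; rewrite -[f' _]mulr1.
  have -> : (fun x => f (x - k)) = f \o shift (- k) by [].
  by apply: is_derive1_comp => /=; exact: is_derive_shift.
have dr x : is_derive (x : R) (1 : R) vr (r1 (x - x1)).
  have d := shiftd r r1 x1 x (rtail_is_derive B K b).
  by apply: is_derive_eq; rewrite subr0.
have dVr x : is_derive (x : R) (1 : R) Vr (vr x).
  have d := shiftd V1 r x1 x (fun s => Rtail_is_derive B K b s (lt0r_neq0 b0)).
  by apply: is_derive_eq; rewrite /= /GRing.scale /= /vr; ring.
pose L0 := 2 * B * b ^+ 2 + 2 * K * b + (K + 2 * B * b) * (4 * b).
have r1L x y : `|r1 y - r1 x| <= L0 * `|y - x|.
  apply: (derive_lip _ r1 (rtail2 B K b)); first exact: rtail1_is_derive.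
  exact: rtail2_bound.
have r1Q := rtail1_bound B K b B0 K0 b0.
have L00 : 0 <= L0 by have := r1L 0 1; rewrite subr0 normr1 mulr1; exact: le_trans.
have Q00 : 0 <= K + 2 * B * b by apply: le_trans (r1Q 0).
have rq : qapprox L0 vr (fun x => r1 (x - x1)).
  apply: (@derive_qapprox R L0 vr (fun x => r1 (x - x1)) dr).
  by move=> x y; have := r1L (x - x1) (y - x1); rewrite (_ : y - x1 - (x - x1) = y - x); last ring.
pose Lh := (cb + ch) * a / mu.
have Lh0 : 0 <= Lh by apply/ltW/divr_gt0 => //; exact: mulr_gt0.
pose L := L0 + Lh.
pose Qh := (cb + ch) / mu.
have Qh0 : 0 <= Qh by rewrite divr_ge0 // ltW.
pose Q := Qh + (K + 2 * B * b).
have Q0 : 0 <= Q by rewrite addr_ge0.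
pose V x := if x <= x1 then Vupper x else Vr x.
pose v x := if x <= x1 then vupper x else vr x.
pose q x := if x <= x1 then h1 x else r1 (x - x1).
have rt0 : r 0 = B by rewrite /r /rtail !mulr0 expr0n /= !addr0 divr1.
have r10 : r1 0 = K by rewrite /r1 /rtail1 !mulr0 expr0n /= mulr0 !addr0 !subr0 expr1n divr1.
have vq : qapprox L v q.
  apply: qapprox_glue.
  - move=> x y _ _; apply: (le_trans (vupper_qapprox x y)).
    by rewrite ler_wpM2r ?sqr_ge0 // lerDr.
  - move=> x y _ _; apply: (le_trans (rq x y)).
    by rewrite ler_wpM2r ?sqr_ge0 // lerDl.
  - by rewrite /vupper /vr subrr rt0 /B; ring.
  - rewrite subrr r10 /hpot1 /expneg1; case: (leP x1 0) => x10'.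
      have -> : x1 = 0 by apply/le_anti; rewrite x10 x10'.
      by rewrite mulr0 expR0 /K; ring.
    by rewrite /K; ring.
have qQ x : `|q x| <= Q.
  rewrite /q; case: ifP => _.
    by apply: (le_trans (hpot1_bound mu sigma cb ch mu0 sigma0 cb0 ch0 x)); rewrite lerDl.
  by apply: (le_trans (r1Q _)); rewrite lerDr.
have dq x : is_derive (x : R) (1 : R) v (q x) by exact: qapprox_is_derive vq.
have vlip x y : `|v y - v x| <= Q * `|y - x| by exact: (derive_lip _ v q).
have dV x : is_derive (x : R) (1 : R) V (v x).
  apply: (@qapprox_is_derive R (Qh + Q)).
  apply: qapprox_glue.
  - have := @derive_qapprox R Qh Vupper vupper Vupper_is_derive; move=> A x' y' _ _.
    have {}A : qapprox Qh Vupper vupper.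
      apply: A => x2 y2; rewrite /vupper (_ : _ - _ = h y2 - h x2); last by ring.
      exact: hL.
    by apply: (le_trans (A x' y')); rewrite ler_wpM2r ?sqr_ge0 // lerDl.
  - have A : qapprox (K + 2 * B * b) Vr vr.
      apply: derive_qapprox => // x' y'; exact: (derive_lip _ vr _ dr).
    move=> x' y' _ _; apply: (le_trans (A x' y')).
    by rewrite ler_wpM2r ?sqr_ge0 // /Q; lra.
  - by rewrite /Vr !subrr mulr0 subr0 addr0.
  - by rewrite /vupper /vr subrr rt0 /B; ring.
have cV := is_derive_continuous _ _ dV.
have vr_lb x : x1 <= x -> - k2 <= v x.
  rewrite le_eqVlt => /orP[/eqP <-|x1x].
    by rewrite /v lexx /vupper; move: B0; rewrite /B; lra.
  rewrite /v (leNgt x x1) x1x /= /vr lerBrDr addNr rtail_ge0 // subr_ge0 ltW //.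
have Vmono y z : x1 <= y -> y <= z -> V y - V z <= k2 * (z - y).
  move=> x1y yz.
  have [d] := @MVT_segment R V v y z yz (fun z _ => dV z) (continuous_subspaceT cV).
  rewrite in_itv /= => /andP[yd _] E.
  have : - k2 * (z - y) <= v d * (z - y).
    by rewrite ler_wpM2r ?subr_ge0 // vr_lb // (le_trans x1y).
  by rewrite -E; lra.
have Vleft y z : y <= z -> z <= x1 -> V y - V z <= k1 + k2 * (z - y).
  rewrite le_eqVlt => /orP[/eqP -> _|yz zx1].
    by rewrite !subrr mulr0 addr0 ltW.
  have yx1 := le_trans (ltW yz) zx1.
  rewrite /V zx1 yx1 /Vupper; have := k1_bound y z yz; lra.
(* A jump across x1 is split there: the fixed cost pays for the left portion only, the right one
   loses at most k2 per unit. *)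
have Vjump y z : y <= z -> V y - V z <= k1 + k2 * (z - y).
  move=> yz; have [zx|/ltW xz] := leP z x1; first exact: Vleft.
  have [xy|/ltW yx] := leP x1 y.
    by have := Vmono y z xy yz; lra.
  by have := Vleft y x1 yx (lexx _); have := Vmono x1 z (lexx _) xz; lra.
have Vgen x : mu * (l + k2) - eps <= sigma ^+ 2 / 2 * q x - mu * v x + c0 cb ch x.
  rewrite /q /v; case: (leP x x1) => xx1.
    by rewrite Vupper_generator; lra.
  pose s := x - x1; have s0 : 0 <= s by rewrite subr_ge0 ltW.
  have := @rtail_supersolution R B K b B0 K0 b0 c (eps / mu) s cc.
  rewrite divr_ge0 ?(ltW eps0) ?(ltW mu0) // => /(_ isT s0).
  have be : b ^+ 2 * (B * c ^+ 2 + 4 * K * c ^+ 3) <= eps / mu.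
    rewrite b2 mulrAC ler_pdivrMr // ler_wpM2l ?divr_ge0 ?(ltW eps0) ?(ltW mu0) //.
    by rewrite /D lerDl.
  move=> /(_ be) W; have := mulr_ge0 (ltW mu0) W.
  have E1 : mu * (c * rtail1 B K b s) = sigma ^+ 2 / 2 * r1 s.
    by rewrite /r1 /c /rate; field; rewrite !gt_eqF.
  have E2 : c0 cb ch x = mu * K * x.
    rewrite /c0 ltNge (le_trans x10 (ltW xx1)) /= /K; congr (_ * _).
    by field; rewrite gt_eqF.
  rewrite E2 /vr -/s => W'.
  have E3 : mu * (c * rtail1 B K b s - rtail B K b s + K * s + B - K * c + eps / mu) =
    sigma ^+ 2 / 2 * r1 s - mu * (r s - k2) + mu * K * x - (mu * (l + k2) - eps).
    rewrite -E1 -/(r s); move: (r s) (rtail1 B K b s) => p p1.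
    have -> : B = K * (c + x1) - l by rewrite /B hx1.
    by rewrite /s; field; rewrite gt_eqF.
  by move: W'; rewrite E3; lra.
have [xl xlP] : exists xl, forall x, x <= xl -> 0 <= v x.
  exists (Num.min x1 (- ((mu * `|l + k2| + cb / a) / cb))) => x.
  rewrite le_min => /andP[xx1 xl]; rewrite /v xx1 /vupper subr_ge0.
  apply: le_trans (hpot_lb x); rewrite ler_pdivlMr //.
  have : (mu * `|l + k2| + cb / a) / cb <= - x by rewrite lerNr.
  rewrite ler_pdivrMr // => xl'.
  have : (l + k2) * mu <= `|l + k2| * mu by rewrite ler_pM2r // ler_norm.
  by lra.
have [xr xrP] : exists xr, forall x, xr <= x -> v x <= 0.
  exists (x1 + (1 + (B + K) / (k2 * b ^+ 2))) => x xx.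
  have xx1 : x1 < x.
    apply: lt_le_trans xx; rewrite ltrDl.
    have : 0 <= (B + K) / (k2 * b ^+ 2).
      apply: divr_ge0; first by rewrite addr_ge0 // ltW.
      by apply: mulr_ge0; [exact: ltW|exact: sqr_ge0].
    by lra.
  rewrite /v (leNgt x x1) xx1 /= /vr subr_le0; apply: rtail_eventually_le => //.
  by rewrite lerBrDl.
(* V increases far to the left and decreases far to the right; the two half-lines are treated
   separately, the left one after reflection. *)
have [C1 C1P] : exists C, forall x, V x <= C.
  have dNV x : is_derive (x : R) (1 : R) (fun x => - V x) (- v x).
    by have d := dV x; apply: is_derive_eq.
  have dV' x : is_derive (x : R) (1 : R) (fun x => - V (- x)) (v (- x)).
    have d := dV (- x).
    have d2 : is_derive x (1 : R) (fun x : R => - x) (- 1) by apply: is_derive_eq.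
    have d3 := @is_derive1_comp R V (fun x => - x) x _ _ d d2.
    have d4 : is_derive x (1 : R) (fun x => V (- x)) (v (- x) * -1) by exact: d3.
    by apply: is_derive_eq; ring.
  have [||A AP] := @eventually_pos_derive_lb (fun x => - V x) (fun x => - v x) 0 (Num.max 0 xr) dNV.
  - by rewrite le_max lexx.
  - by move=> x; rewrite ge_max => /andP[_ xx]; rewrite oppr_ge0 xrP.
  have [||A' A'P] := @eventually_pos_derive_lb (fun x => - V (- x)) (fun x => v (- x)) 0 (Num.max 0 (- xl)) dV'.
  - by rewrite le_max lexx.
  - by move=> x; rewrite ge_max => /andP[_ xx]; apply: xlP; rewrite lerNl.
  exists (Num.max (- A) (- A')) => x; rewrite le_max; have [x0|/ltW x0] := leP 0 x.
    by apply/orP; left; rewrite lerNr AP.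
  apply/orP; right; have := A'P (- x); rewrite opprK oppr_ge0 => /(_ x0); by rewrite lerNr.
have vgrow x : `|v x| <= (`|v 0| + Q * x1 + B + K / b + k2) + Q * negpart x.
  have Qx1 : 0 <= Q * x1 by rewrite mulr_ge0.
  have Kb : 0 <= K / b by rewrite divr_ge0 // ltW.
  have n0 : 0 <= negpart x by rewrite /negpart le_max lexx orbT.
  have Qn : 0 <= Q * negpart x by rewrite mulr_ge0.
  have v00 := normr_ge0 (v 0).
  have [xx1|xx1] := leP x x1; last first.
    rewrite {1}/v (leNgt x x1) xx1 /= /vr.
    apply: (le_trans (ler_normB _ _)); rewrite (gtr0_norm k20).
    by have := rtail_ub B K b B0 K0 b0 (x - x1); rewrite /r; lra.
  have := vlip 0 x; rewrite subr0 => A.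
  have := ler_normD (v x - v 0) (v 0); rewrite subrK => /le_trans; apply.
  have : Q * `|x| <= Q * x1 + Q * negpart x.
    rewrite -mulrDr ler_wpM2l //; rewrite /negpart; have [x0|x0] := leP 0 x.
      by rewrite max_r ?oppr_le0 // ger0_norm // addr0.
    by rewrite max_l ?oppr_ge0 ?(ltW x0) // ltr0_norm // lerDr.
  by lra.
set C2 := (`|v 0| + _ + _ + _ + _) in vgrow.
have C20 : 0 <= C2.
  have Qx1 : 0 <= Q * x1 by rewrite mulr_ge0.
  have Kb : 0 <= K / b by rewrite divr_ge0 // ltW.
  by have v00 := normr_ge0 (v 0); rewrite /C2; lra.
have Vgrow := linear_growth Q C2 0 V v dV vgrow C20 Q0.
pose C := `|C1| + C2 + `|V 0|.
have v00 := normr_ge0 (V 0); have c10 := normr_ge0 C1.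
exists V, v, q, L, Q, C; split => //; split.
- move=> x; apply: (le_trans (C1P x)); apply: (le_trans (ler_norm _)); rewrite /C; lra.
- by move=> x; apply: (le_trans (vgrow x)); rewrite lerD2r /C; lra.
- move=> x; apply: (le_trans (Vgrow x)); rewrite lerD2r.
  have : C2 * `|x| <= C * `|x| by rewrite ler_wpM2r // /C; lra.
  by rewrite {2}/C; lra.
Qed.

End Verification.

(** * Gaussian moments and independence *)

Section Expectation.
Context {R : realType} {d : measure_display} {T : measurableType d}.
Variable P : probability T R.
Implicit Types f g : T -> R.

Definition Intg f := P.-integrable setT (EFin \o f).
Definition Ex f : R := \int[P]_w f w.

Lemma Intg_measurable f : Intg f -> measurable_fun setT f.
Proof. by move=> /measurable_int/measurable_EFinP. Qed.

Lemma Intg_le f g : measurable_fun setT f -> Intg g -> (forall w, `|f w| <= g w) -> Intg f.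
Proof.
move=> mf ig fg; apply: le_integrable ig => //; first exact/measurable_EFinP.
by move=> w _ /=; rewrite lee_fin (le_trans (fg w)) // ler_norm.
Qed.

Lemma Intg_cst (c : R) : Intg (fun=> c).
Proof. exact: finite_measure_integrable_cst. Qed.

Lemma IntgD f g : Intg f -> Intg g -> Intg (fun w => f w + g w).
Proof. by move=> If Ig; have := integrableD measurableT If Ig; apply: eq_integrable. Qed.

Lemma IntgB f g : Intg f -> Intg g -> Intg (fun w => f w - g w).
Proof. by move=> If Ig; have := integrableB measurableT If Ig; apply: eq_integrable. Qed.

Lemma IntgZ (k : R) f : Intg f -> Intg (fun w => k * f w).
Proof. by move=> If; have := integrableZl measurableT k If; apply: eq_integrable. Qed.

Lemma Intg_abs f : Intg f -> Intg (fun w => `|f w|).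
Proof. by move=> If; exact: integrable_norm. Qed.

Lemma Intg_sum n (f : nat -> T -> R) : (forall i, (i < n)%N -> Intg (f i)) ->
  Intg (fun w => \sum_(i < n) f i w).
Proof.
elim: n => [|n IH] H.
  by under eq_fun do rewrite big_ord0; exact: Intg_cst.
under eq_fun do rewrite big_ord_recr /=.
by apply: IntgD; [apply: IH => i ?; apply: H; exact: ltnW|exact: H].
Qed.

Lemma Ex_cst (c : R) : Ex (fun=> c) = c.
Proof. by rewrite /Ex /Rintegral integral_cst //= probability_setT mule1. Qed.

Lemma ExD f g : Intg f -> Intg g -> Ex (fun w => f w + g w) = Ex f + Ex g.
Proof. by move=> If Ig; rewrite /Ex RintegralD. Qed.

Lemma ExB f g : Intg f -> Intg g -> Ex (fun w => f w - g w) = Ex f - Ex g.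
Proof. by move=> If Ig; rewrite /Ex RintegralB. Qed.

Lemma ExZ (k : R) f : Intg f -> Ex (fun w => k * f w) = k * Ex f.
Proof. by move=> If; rewrite /Ex RintegralZl. Qed.

Lemma Ex_sum n (f : nat -> T -> R) : (forall i, (i < n)%N -> Intg (f i)) ->
  Ex (fun w => \sum_(i < n) f i w) = \sum_(i < n) Ex (f i).
Proof.
elim: n => [|n IH] H.
  by under eq_fun do rewrite big_ord0; rewrite big_ord0 Ex_cst.
under eq_fun do rewrite big_ord_recr /=.
rewrite big_ord_recr /= ExD ?IH //.
- by move=> i ?; apply: H; exact: ltnW.
- by apply: Intg_sum => i ?; apply: H; exact: ltnW.
- exact: H.
Qed.

Lemma Ex_le f g : Intg f -> Intg g -> (forall w, f w <= g w) -> Ex f <= Ex g.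
Proof. by move=> If Ig fg; apply: le_Rintegral. Qed.

Lemma Ex_ge0 f : (forall w, 0 <= f w) -> 0 <= Ex f.
Proof. by move=> f0; apply: Rintegral_ge0. Qed.

Lemma Ex_abs f : Intg f -> `|Ex f| <= Ex (fun w => `|f w|).
Proof. by move=> If; apply: le_normr_Rintegral. Qed.

Lemma ExEFin f : Intg f -> (\int[P]_w (f w)%:E)%E = (Ex f)%:E.
Proof. by move=> If; rewrite /Ex /Rintegral fineK //; exact: integrable_fin_num. Qed.

Lemma Intg_ge0_lty f : measurable_fun setT f -> (forall w, 0 <= f w) ->
  (\int[P]_w (f w)%:E < +oo)%E -> Intg f.
Proof.
move=> mf f0 flt; apply/integrableP; split; first exact/measurable_EFinP.
by under eq_integral do rewrite /= ger0_norm //.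
Qed.

Lemma ae_Ex_le f g : Intg f -> Intg g -> {ae P, forall w, f w <= g w} -> Ex f <= Ex g.
Proof.
move=> If Ig [N [mN N0 sub]].
rewrite -lee_fin -!ExEFin // (negligible_integral mN) // [leRHS](negligible_integral mN) //.
have mD := measurableD measurableT mN.
apply: le_integral => //; [exact: integrableS If|exact: integrableS Ig|].
move=> w; rewrite inE => -[_ Nw]; rewrite lee_fin; apply: contrapT => A; apply: Nw.
by apply: sub.
Qed.

End Expectation.

Section DensityIntegral.
Context {R : realType}.
Local Open Scope ereal_scope.

(** The Radon-Nikodym derivative of the law equals the explicit density almost everywhere, because
    both have the same integral over every measurable set. *)
Lemma integral_normal_prob (m s : R) (f : R -> R) :
  measurable_fun setT f -> (forall x, 0 <= f x)%R ->
  \int[normal_prob m s]_x (f x)%:E =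
  \int[lebesgue_measure]_x (f x * normal_pdf m s x)%:E.
Proof.
move=> mf f0.
pose nu : {finite_measure set _ -> \bar R} := normal_prob m s.
have dom : nu `<< @lebesgue_measure R by exact: normal_prob_dominates.
rewrite -(Radon_Nikodym_SigmaFinite.change_of_variables dom) //; last exact/measurable_EFinP.
have ig := Radon_Nikodym_SigmaFinite.f_integrable dom.
have mpdf : measurable_fun setT (fun x => (normal_pdf m s x)%:E).
  by apply/measurable_EFinP; exact: measurable_normal_pdf.
have ae : ae_eq lebesgue_measure setT (Radon_Nikodym_SigmaFinite.f nu lebesgue_measure)
    (fun x => (normal_pdf m s x)%:E).
  apply: integral_ae_eq => // E _ mE.
  by rewrite -Radon_Nikodym_SigmaFinite.f_integral.
under [RHS]eq_integral do rewrite EFinM.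
apply: ae_eq_integral => //.
- by apply: emeasurable_funM; [exact/measurable_EFinP|exact: measurable_int ig].
- by apply: emeasurable_funM => //; exact/measurable_EFinP.
- by case: ae => N [mN N0 sub]; exists N; split => // x /= H; apply: sub => /= H'; apply: H => xT; rewrite H'.
Qed.

End DensityIntegral.

Section GaussianMoments.
Context {R : realType} {d : measure_display} {T : measurableType d}.
Variable P : probability T R.
Variables (X : T -> R) (s : R).
Hypotheses (mX : measurable_fun setT X) (s0 : 0 < s)
  (lawX : forall B : set R, measurable B -> P (X @^-1` B) = normal_prob 0 s B).

Lemma ge0_integral_gauss (f : R -> R) : measurable_fun setT f -> (forall x, 0 <= f x) ->
  (\int[P]_w (f (X w))%:E = \int[lebesgue_measure]_x (f x * normal_pdf 0 s x)%:E)%E.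
Proof.
move=> mf f0; rewrite -integral_normal_prob //.
pose mX' := isMeasurableFun.Build _ _ _ _ (X : T -> measurableTypeR R) mX.
pose X' : {RV P >-> measurableTypeR R} := HB.pack X mX'.
rewrite -(@ge0_integral_distribution _ _ _ _ _ P X' (EFin \o f)) //; last exact/measurable_EFinP.
apply: (@eq_measure_integral _ _ _ setT (normal_prob 0 s) (distribution P X')).
by move=> A mA _; exact: (lawX A mA).
Qed.

(* Every bound below compares the density of [X] with the density of another
   normal law, whose total mass is [1]. *)
Lemma gauss_dominated (f : R -> R) m s' c : measurable_fun setT f -> (forall x, 0 <= f x) ->
  (forall x, f x * normal_pdf 0 s x <= c * normal_pdf m s' x) -> 0 <= c ->
  Intg P (f \o X) /\ Ex P (f \o X) <= c.
Proof.
move=> mf f0 fc c0.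
have le : (\int[P]_w (f (X w))%:E <= c%:E)%E.
  rewrite ge0_integral_gauss //.
  have -> : c%:E = (\int[lebesgue_measure]_x (c * normal_pdf m s' x)%:E)%E.
    under eq_integral do rewrite EFinM.
    rewrite ge0_integralZl //; first by rewrite integral_normal_pdf mule1.
      by apply/measurable_EFinP; exact: measurable_normal_pdf.
    by move=> x _; rewrite lee_fin normal_pdf_ge0.
  apply: ge0_le_integral => //.
  - by move=> x _; rewrite lee_fin mulr_ge0 // normal_pdf_ge0.
  - by apply/measurable_EFinP/measurable_funM => //; exact: measurable_normal_pdf.
  - by apply/measurable_EFinP/measurable_funM => //; exact: measurable_normal_pdf.
  - by move=> x _; rewrite lee_fin.
have I : Intg P (f \o X).
  apply: Intg_ge0_lty; [exact: measurableT_comp|by move=> w; exact: f0|].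
  by apply: (le_lt_trans le); rewrite ltry.
by split => //; rewrite -lee_fin -ExEFin.
Qed.

(** Exponential tilting of a normal density moves its mean. *)
Lemma normal_pdf_shift m x :
  expR (m / s ^+ 2 * x - m ^+ 2 / (2 * s ^+ 2)) * normal_pdf 0 s x = normal_pdf m s x.
Proof.
have sn0 : s != 0 by rewrite gt_eqF.
rewrite !normal_pdfE // /normal_fun mulrCA; congr (_ * _); rewrite -expRD; congr expR.
by rewrite -mulr_natr; field.
Qed.

(** Tilting by a quadratic exponent multiplies the standard deviation by r, at the price of the
    factor r. This covers r < 1 as well as r > 1. *)
Lemma normal_pdf_scale r x : 0 < r ->
  expR ((1 - r ^- 2) / (2 * s ^+ 2) * x ^+ 2) * normal_pdf 0 s x = r * normal_pdf 0 (r * s) x.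
Proof.
move=> r0; have sn0 : s != 0 by rewrite gt_eqF.
have rn0 : r != 0 by rewrite gt_eqF.
have peak : normal_peak s = r * normal_peak (r * s).
  rewrite /normal_peak.
  have -> : (r * s) ^+ 2 * pi *+ 2 = r ^+ 2 * (s ^+ 2 * pi *+ 2) .
    by move: (@pi R) => p; ring.
  rewrite sqrtrM ?sqr_ge0 // sqrtr_sqr (gtr0_norm r0) invfM mulrA divff // mul1r.
  by [].
rewrite !normal_pdfE ?mulf_neq0 // /normal_fun peak mulrCA -expRD [RHS]mulrA.
congr (_ * expR _).
by field; rewrite ?rn0 ?sn0.
Qed.

Let sn0 : s != 0. Proof. by rewrite gt_eqF. Qed.

Lemma gauss_scale r : 0 < r ->
  Intg P ((fun x => expR ((1 - r ^- 2) / (2 * s ^+ 2) * x ^+ 2)) \o X) /\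
  Ex P ((fun x => expR ((1 - r ^- 2) / (2 * s ^+ 2) * x ^+ 2)) \o X) <= r.
Proof.
move=> r0; apply: (@gauss_dominated _ 0 (r * s)) => [|x|x|].
- apply: measurableT_comp => //; apply: measurable_funM => //.
- exact: expR_ge0.
- by rewrite normal_pdf_scale.
- exact: ltW.
Qed.

Lemma gauss_moment4 : Intg P (fun w => X w ^+ 4) /\ Ex P (fun w => X w ^+ 4) <= 30 * s ^+ 4.
Proof.
(* With r = 2 the exponent is y = 3 x^2 / (8 s^2). From y^2 / 2 <= e^y one gets x^4 <= (128/9) s^4
   e^y, whose mean is at most (256/9) s^4, below 30 s^4. *)
have [I E] := gauss_scale 2 (ltr0Sn _ _).
set f := (_ \o X) in I E.
have s4 : 0 < s ^+ 4 by rewrite exprn_gt0.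
have fX w : X w ^+ 4 <= (128 / 9 * s ^+ 4) * f w.
  rewrite /f /=; set y := (_ * X w ^+ 2).
  have y0 : 0 <= y.
    have -> : y = 3 / 4 / (2 * s ^+ 2) * X w ^+ 2 by rewrite /y; field.
    by apply: mulr_ge0; [apply: divr_ge0 => //; apply: mulr_ge0 => //|]; exact: sqr_ge0.
  have := @expR_ge1Dxn R y 1 y0; rewrite (_ : 2`! = 2%N) // => h.
  have -> : X w ^+ 4 = 128 / 9 * s ^+ 4 * (y ^+ 2 / 2).
    by rewrite /y; field.
  by rewrite ler_pM2l ?mulr_gt0 //; lra.
have Ig := IntgZ P (128 / 9 * s ^+ 4) f I.
have I4 : Intg P (fun w => X w ^+ 4).
  apply: Intg_le Ig _ => [|w]; first exact: measurable_funX.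
  by rewrite ger0_norm ?fX // -[4%N]/(2 * 2)%N exprM sqr_ge0.
split=> //; apply: (le_trans (Ex_le _ _ _ I4 Ig fX)); rewrite ExZ //.
apply: (@le_trans _ _ (128 / 9 * s ^+ 4 * 2)); first by rewrite ler_pM2l // mulr_gt0.
lra.
Qed.

(** The bound 1 + theta m <= E e^(theta X^2) <= r, with theta = (1 - r^-2) / (2 s^2), is an equality
    at r = 1. Values of r slightly above and slightly below 1 therefore exclude m > s^2 and m < s^2;
    r = 1 + (m / s^2 - 1) / 4 gives the contradiction in both cases. *)
Lemma gauss_moment2 : Intg P (fun w => X w ^+ 2) /\ Ex P (fun w => X w ^+ 2) = s ^+ 2.
Proof.
have [I4 _] := gauss_moment4.
have I2 : Intg P (fun w => X w ^+ 2).
  apply: (Intg_le _ _ (fun w => 1 + X w ^+ 4)); first exact: measurable_funX.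
    by apply: IntgD => //; exact: Intg_cst.
  move=> w; rewrite ger0_norm ?sqr_ge0 // -[4%N]/(2 * 2)%N exprM.
  have := sqr_ge0 (X w ^+ 2 - 1); have := sqr_ge0 (X w).
  by set y := X w ^+ 2; nra.
split=> //; set m := Ex P _.
have s2 : 0 < s ^+ 2 by rewrite exprn_gt0.
have m0 : 0 <= m by apply: Ex_ge0 => w; exact: sqr_ge0.
have key r : 0 < r -> 1 + (1 - r ^- 2) / (2 * s ^+ 2) * m <= r.
  move=> r0; have [I E] := gauss_scale r r0; apply: le_trans E.
  have I' := IntgZ P ((1 - r ^- 2) / (2 * s ^+ 2)) _ I2.
  rewrite -ExZ // -[X in X + _](Ex_cst P) -ExD //; last exact: Intg_cst.
  apply: Ex_le => //; first by apply: IntgD => //; exact: Intg_cst.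
  by move=> w; exact: expR_ge1Dx.
have key' r : 0 < r -> (r ^+ 2 - 1) * (m / s ^+ 2) <= 2 * (r - 1) * r ^+ 2.
  move=> r0; have rn0 : r != 0 by rewrite gt_eqF.
  have K := key r r0.
  have : ((1 - r ^- 2) / (2 * s ^+ 2) * m) * (2 * r ^+ 2) <= (r - 1) * (2 * r ^+ 2).
    by rewrite ler_pM2r ?mulr_gt0 ?exprn_gt0 //; lra.
  have -> : ((1 - r ^- 2) / (2 * s ^+ 2) * m) * (2 * r ^+ 2) = (r ^+ 2 - 1) * (m / s ^+ 2).
    by field; rewrite ?rn0 ?sn0.
  by have -> : (r - 1) * (2 * r ^+ 2) = 2 * (r - 1) * r ^+ 2 by ring.
have q0 : 0 <= m / s ^+ 2 by rewrite divr_ge0 // ltW.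
suff q1 : m / s ^+ 2 = 1 by rewrite -[m](@divfK _ (s ^+ 2)) ?q1 ?mul1r // gt_eqF.
move: q0 key'; set q := m / s ^+ 2 => q0 key'.
apply/eqP; rewrite eq_le; apply/andP; split; rewrite leNgt; apply/negP => q1.
  have h : 0 < 1 + (q - 1) / 4 by lra.
  have := key' _ h.
  set e := (q - 1) / 4.
  have e0 : 0 < e by rewrite divr_gt0 // subr_gt0.
  have -> : q = 1 + 4 * e by rewrite /e; field.
  have -> : ((1 + e) ^+ 2 - 1) * (1 + 4 * e) = e * ((2 + e) * (1 + 4 * e)) by ring.
  have -> : 2 * (1 + e - 1) * (1 + e) ^+ 2 = e * (2 * (1 + e) ^+ 2) by ring.
  rewrite ler_pM2l //; nra.
have := key' (1 - (1 - q) / 4).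
set e := (1 - q) / 4.
have e0 : 0 < e by rewrite divr_gt0 // subr_gt0.
have e1 : e <= 1 / 4 by rewrite /e; lra.
have -> : q = 1 - 4 * e by rewrite /e; field.
have -> : ((1 - e) ^+ 2 - 1) * (1 - 4 * e) = e * ((e - 2) * (1 - 4 * e)) by ring.
have -> : 2 * (1 - e - 1) * (1 - e) ^+ 2 = e * (- 2 * (1 - e) ^+ 2) by ring.
rewrite ler_pM2l // => H; have : 0 < 1 - e by lra.
by move=> /H; nra.
Qed.

(** Tilting with the unknown mean m itself gives 1 + m^2 / (2 s^2) <= 1. *)
Lemma gauss_moment1 : Intg P X /\ Ex P X = 0.
Proof.
have [I2 _] := gauss_moment2.
have I1 : Intg P X.
  apply: (Intg_le _ _ (fun w => 1 + X w ^+ 2)) => //.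
    by apply: IntgD => //; exact: Intg_cst.
  move=> w; rewrite -[X w ^+ 2]real_normK ?num_real //.
  have := sqr_ge0 (`|X w| - 1); have := normr_ge0 (X w).
  by set y := `|X w|; nra.
split=> //; set m := Ex P X.
have s2 : 0 < s ^+ 2 by rewrite exprn_gt0.
have [I E] : Intg P ((fun x => expR (m / s ^+ 2 * x - m ^+ 2 / (2 * s ^+ 2))) \o X) /\
  Ex P ((fun x => expR (m / s ^+ 2 * x - m ^+ 2 / (2 * s ^+ 2))) \o X) <= 1.
  apply: (@gauss_dominated _ m s) => [|x|x|//].
  - apply: measurableT_comp => //; apply: measurable_funB => //; exact: measurable_funM.
  - exact: expR_ge0.
  - by rewrite normal_pdf_shift mul1r.
have I' := IntgZ P (m / s ^+ 2) _ I1.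
have I'' := IntgB P _ _ I' (Intg_cst P (m ^+ 2 / (2 * s ^+ 2))).
have I3 := IntgD P _ _ (Intg_cst P 1) I''.
have := le_trans (Ex_le P _ _ I3 I (fun w => expR_ge1Dx _)) E.
rewrite ExD ?ExB ?ExZ ?Ex_cst -/m //; try exact: Intg_cst.
have -> : m / s ^+ 2 * m - m ^+ 2 / (2 * s ^+ 2) = m ^+ 2 / (2 * s ^+ 2) by field.
rewrite gerDl => H.
have : m ^+ 2 <= 0.
  by move: H; rewrite pmulr_lle0 // invr_gt0 mulr_gt0.
by rewrite le_eqVlt ltNge sqr_ge0 orbF sqrf_eq0 => /eqP.
Qed.

End GaussianMoments.

Section IndependentProduct.
Context {R : realType} {d : measure_display} {T : measurableType d}.
Variable P : probability T R.

(** The law of the pair is the product of the two laws, since they agree on rectangles. Tonelli for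
    |x y| gives integrability, then Fubini the value. *)
Lemma indep_Ex (Z X : T -> R) : Intg P Z -> Intg P X ->
  (forall A B : set R, measurable A -> measurable B ->
     P (Z @^-1` A `&` X @^-1` B) = (P (Z @^-1` A) * P (X @^-1` B))%E) ->
  Intg P (fun w => Z w * X w) /\ Ex P (fun w => Z w * X w) = Ex P Z * Ex P X.
Proof.
move=> IZ IX ind.
have mZ := Intg_measurable P Z IZ; have mX := Intg_measurable P X IX.
have mZX : measurable_fun setT (fun w => (Z w, X w)) by exact: measurable_fun_pair.
pose Zv : {RV P >-> R} := HB.pack Z (isMeasurableFun.Build _ _ _ _ Z mZ).
pose Xv : {RV P >-> R} := HB.pack X (isMeasurableFun.Build _ _ _ _ X mX).
pose ZXv : {RV P >-> (R * R)%type} :=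
  HB.pack (fun w => (Z w, X w)) (isMeasurableFun.Build _ _ _ _ (fun w => (Z w, X w)) mZX).
pose m1 : probability R R := distribution P Zv.
pose m2 : probability R R := distribution P Xv.
have prodE (S : set (R * R)) : measurable S -> (m1 \x m2)%E S = distribution P ZXv S.
  apply: product_measure_unique => A B mA mB; exact: ind.
have mmul : measurable_fun setT (fun z : R * R => z.1 * z.2).
  by apply: measurable_funM; [exact: measurable_fst|exact: measurable_snd].
have mEmul : measurable_fun setT (fun z : R * R => (z.1 * z.2)%:E) by exact/measurable_EFinP.
have intE (f : R * R -> \bar R) :
    (\int[(m1 \x m2)]_z f z = \int[distribution P ZXv]_z f z)%E.
  by apply: (@eq_measure_integral _ _ _ setT (distribution P ZXv)) => A mA _; exact: prodE.
have absE : (\int[(m1 \x m2)]_z `|(z.1 * z.2)%:E| < +oo)%E.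
  rewrite (@fubini_tonelli1 _ _ _ _ _ m1 m2 (fun z => `|(z.1 * z.2)%:E|)%E) //; last exact: measurableT_comp.
  rewrite /fubini_F /=.
  have E x : (\int[m2]_y (`|x * y|)%:E = (`|x|)%:E * (Ex P (fun w => `|X w|))%:E)%E.
    under eq_integral do rewrite normrM EFinM.
    rewrite ge0_integralZl //; last by apply/measurable_EFinP; exact: normr_measurable.
    congr (_ * _)%E; rewrite -ExEFin; last exact: Intg_abs.
    rewrite (@ge0_integral_distribution _ _ _ _ _ P Xv (fun y => (`|y|)%:E)) //.
    by apply/measurable_EFinP; exact: normr_measurable.
  under eq_integral do rewrite E.
  rewrite ge0_integralZr //; last 2 first.
  - by apply/measurable_EFinP; exact: normr_measurable.
  - by rewrite lee_fin Ex_ge0.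
  rewrite (@ge0_integral_distribution _ _ _ _ _ P Zv (fun y => (`|y|)%:E)) //; last first.
    by apply/measurable_EFinP; exact: normr_measurable.
  rewrite (_ : (\int[P]_x _)%E = (Ex P (fun w => `|Z w|))%:E); last first.
    by rewrite -ExEFin //; exact: Intg_abs.
  by rewrite -EFinM ltry.
have Iprod : (m1 \x m2)%E.-integrable setT (fun z : R * R => (z.1 * z.2)%:E).
  by apply/integrableP.
have IZX : Intg P (fun w => Z w * X w).
  apply/integrableP; split.
    by apply/measurable_EFinP; exact: measurable_funM.
  move: absE; rewrite intE (@ge0_integral_distribution _ _ _ _ _ P ZXv (fun z => `|(z.1 * z.2)%:E|)%E) //.
  exact: measurableT_comp.
split=> //; apply: EFin_inj; rewrite -ExEFin //.
transitivity (\int[(m1 \x m2)]_z (z.1 * z.2)%:E)%E.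
  by rewrite intE (@integral_distribution _ _ _ _ _ P ZXv (fun z => (z.1 * z.2)%:E)).
rewrite -(integral12_prod_meas1 Iprod) /fubini_F /=.
have E x : (\int[m2]_y (x * y)%:E = x%:E * (Ex P X)%:E)%E.
  have I2 : m2.-integrable setT (EFin \o (id : R -> R)).
    by apply: (@integrable_pushforward _ _ _ _ _ Xv); [exact: measurable_funP|exact/measurable_EFinP| |].
  under eq_integral do rewrite EFinM.
  rewrite integralZl //; congr (_ * _)%E; rewrite -ExEFin //.
  by rewrite (@integral_distribution _ _ _ _ _ P Xv (fun y => y%:E)) //; exact/measurable_EFinP.
under eq_integral do rewrite E.
have I1 : m1.-integrable setT (EFin \o (id : R -> R)).
  by apply: (@integrable_pushforward _ _ _ _ _ Zv); [exact: measurable_funP|exact/measurable_EFinP| |].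
rewrite EFinM integralZr //; congr (_ * _)%E; rewrite -ExEFin //.
by rewrite (@integral_distribution _ _ _ _ _ P Zv (fun y => y%:E)) //; exact/measurable_EFinP.
Qed.

End IndependentProduct.

(** * The augmented Brownian filtration *)

Section SigmaIndependence.
Context {R : realType} {d : measure_display} {T : measurableType d}.
Variable P : probability T R.

(** Uniqueness of finite measures on a generating family stable under intersection, for P(A and C)
    and P(A) P(C) as functions of A. *)
Lemma sigma_indep (G : set (set T)) (C : set T) : G `<=` measurable -> setI_closed G ->
  G setT -> measurable C -> (forall A, G A -> P (A `&` C) = (P A * P C)%E) ->
  forall A, <<s G >> A -> P (A `&` C) = (P A * P C)%E.
Proof.
move=> Gm GI GT mC GC.
have PC0 : 0 <= fine (P C) by rewrite fine_ge0.
have PCfin : (fine (P C))%:E = P C by rewrite fineK // fin_num_measure.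
pose m1 := mrestr P mC.
pose m2 := mscale (NngNum PC0) P.
have m2E A : m2 A = (P A * P C)%E by rewrite /m2 /mscale /= PCfin muleC.
move=> A sA; rewrite -m2E.
apply: (@g_sigma_algebra_measure_unique _ _ _ G Gm (fun=> setT) _ _ m1 m2 GI _ _ A sA).
- by [].
- by rewrite bigcup_const //; exists 0%N.
- by move=> B GB; apply: etrans (GC B GB) _; exact: (esym (m2E B)).
- move=> _; apply: (@le_lt_trans _ _ 1%E); last exact: ltry.
  by apply: probability_le1; exact: measurableI.
Qed.

Lemma sigma_algebra_sub (G : set (set T)) : G `<=` measurable -> <<s G >> `<=` measurable.
Proof. by move=> Gm; apply: smallest_sub => //; exact: sigma_algebra_measurable. Qed.

Lemma g_sigma_algebra_funP (G : set (set T)) (f : T -> R) :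
  measurable_fun (T := g_sigma_algebraType G) setT f <->
  (forall B : set R, measurable B -> <<s G >> (f @^-1` B)).
Proof.
split=> [mf B mB|mf _ B mB]; last by rewrite setTI; exact: mf.
by have := mf measurableT B mB; rewrite setTI.
Qed.

End SigmaIndependence.

Section BrownianFiltration.
Context {R : realType} {d : measure_display} {T : measurableType d}.
Variables (P : probability T R) (W : R -> T -> R) (x0 mu sigma : R).
Hypotheses (BM : is_BM P W) (sigma0 : 0 < sigma).
Local Notation X0 := (X0 x0 mu sigma W).
Local Notation natgen := (natgen x0 mu sigma W).
Local Notation filt := (filt P x0 mu sigma W).

Let W0 w : W 0 w = 0. Proof. by case: BM. Qed.

Lemma W_measurable t : measurable_fun setT (W t). Proof. by case: BM. Qed.

Lemma X0_measurable t : measurable_fun setT (X0 t).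
Proof. by apply: measurable_funD => //; apply: measurable_funM => //; exact: W_measurable. Qed.

Lemma incr_measurable s t : measurable_fun setT (fun w => W t w - W s w).
Proof. by apply: measurable_funB; exact: W_measurable. Qed.

Lemma natgen_measurable t : natgen t `<=` measurable.
Proof.
by move=> _ [s [B [_ mB ->]]]; rewrite -[X in measurable X]setTI; exact: X0_measurable.
Qed.

Lemma natgen_sub s t : s <= t -> natgen s `<=` natgen t.
Proof.
move=> st _ [u [B [/andP[u0 us] mB ->]]]; exists u, B; split=> //.
by rewrite u0 (le_trans us).
Qed.

Lemma X0_natgen s t : 0 <= s -> s <= t ->
  measurable_fun (T := g_sigma_algebraType (natgen t)) setT (X0 s).
Proof.
move=> s0 st; apply/g_sigma_algebra_funP => B mB; apply: sub_sigma_algebra.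
by exists s, B; rewrite s0 st.
Qed.

Lemma W_natgen s t : 0 <= s -> s <= t ->
  measurable_fun (T := g_sigma_algebraType (natgen t)) setT (W s).
Proof.
move=> s0 st; have -> : W s = fun w => sigma^-1 * (X0 s w - (x0 - mu * s)).
  by apply/funext => w; rewrite /Defs.X0; field; rewrite gt_eqF.
apply: measurable_funM => //; apply: measurable_funB => //; exact: X0_natgen.
Qed.

Section Grid.
Variables (tt : nat -> R) (N : nat).
Hypotheses (tt0 : tt 0%N = 0) (ttmono : forall i, tt i <= tt i.+1).

Let incr i w := W (tt i.+1) w - W (tt i) w.

Let rect : set (set T) :=
  [set A | exists2 B : nat -> set R, (forall i, measurable (B i)) &
     A = \bigcap_(i in [set i : nat | (i < N)%N]) (incr i @^-1` B i)].

Let rect_measurable : rect `<=` measurable.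
Proof.
move=> _ [B mB ->]; apply: bigcap_measurableType.
by move=> i _; rewrite -[X in measurable X]setTI; apply: incr_measurable.
Qed.

(** The product formula for N + 1 increments, compared with that for N, splits off the last factor;
    [sigma_indep] then extends it from rectangles to the generated sigma-algebra. *)
Lemma grid_indep (B : set R) : measurable B -> forall A, <<s rect >> A ->
  P (A `&` (incr N @^-1` B)) = (P A * P (incr N @^-1` B))%E.
Proof.
move=> mB; apply: sigma_indep => //.
- move=> _ _ [B1 mB1 ->] [B2 mB2 ->]; exists (fun i => B1 i `&` B2 i).
    by move=> i; exact: measurableI.
  by rewrite -bigcapI.
- by exists (fun=> setT) => //; rewrite bigcapT.
- by rewrite -[X in measurable X]setTI; apply: incr_measurable.
move=> A [B' mB' AE].
have mA : measurable A by apply: rect_measurable; exists B'.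
have mC : measurable (incr N @^-1` B).
  by rewrite -[X in measurable X]setTI; apply: incr_measurable.
have [_ _ _ _ ind] := BM.
pose B2 i := if i == N then B else B' i.
have mB2 i : measurable (B2 i) by rewrite /B2; case: ifP.
have t0 : 0 <= tt 0%N by rewrite tt0.
have := ind N.+1 tt B2 t0 ttmono mB2.
have := ind N tt B' t0 ttmono mB'.
rewrite -AE => E1.
have -> : \bigcap_(i in [set i : nat | (i < N.+1)%N])
    ((fun w => W (tt i.+1) w - W (tt i) w) @^-1` B2 i) = A `&` (incr N @^-1` B).
  rewrite AE; apply/seteqP; split=> w /=.
    move=> H; split.
      move=> i /= iN; have := H i (ltnW iN); rewrite /B2.
      by rewrite ltn_eqF.
    by have := H N (ltnSn N); rewrite /B2 /= eqxx.
  move=> [H1 H2] i /=; rewrite ltnS leq_eqVlt => /orP[/eqP ->|iN].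
    by rewrite /B2 eqxx.
  by rewrite /B2 ltn_eqF //; exact: H1.
rewrite big_ord_recr /= {2}/B2 eqxx => E2.
rewrite -[LHS]fineK ?fin_num_measure //; last exact: measurableI.
rewrite E2 EFinM; congr (_ * _)%E; last by rewrite fineK // fin_num_measure.
rewrite -[RHS]fineK ?fin_num_measure // E1; congr (_%:E).
by apply: eq_bigr => i _; rewrite /B2 ltn_eqF.
Qed.

Lemma grid_measurable i : (i <= N)%N ->
  measurable_fun (T := g_sigma_algebraType rect) setT (W (tt i)).
Proof.
elim: i => [_|i IH iN].
  have -> : W (tt 0%N) = fun=> 0 by apply/funext => w; rewrite tt0 W0.
  exact: measurable_cst.
have -> : W (tt i.+1) = fun w => W (tt i) w + incr i w.
  by apply/funext => w; rewrite /incr addrC subrK.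
apply: measurable_funD; first exact: IH (ltnW iN).
apply/g_sigma_algebra_funP => B mB; apply: sub_sigma_algebra.
exists (fun j => if j == i then B else setT); first by move=> j; case: ifP.
apply/seteqP; split=> w /=.
  by move=> Bw j _ /=; case: eqVneq => [->|].
by move=> /(_ i iN); rewrite /= eqxx.
Qed.

End Grid.

(** Cylinder events of X0 up to time s: unlike [natgen s], a family stable under intersection. *)
Let finev (s : R) : set (set T) :=
  [set A | exists n (u : nat -> R) (B : nat -> set R),
    [/\ forall i, 0 <= u i <= s, forall i, measurable (B i) &
        A = \bigcap_(i in [set i : nat | (i < n)%N]) (X0 (u i) @^-1` B i)]].

Let finev_measurable s : finev s `<=` measurable.
Proof.
move=> _ [n [u [B [_ mB ->]]]]; apply: bigcap_measurableType.
by move=> i _; rewrite -[X in measurable X]setTI; exact: X0_measurable.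
Qed.

Let finev_indep s t (B : set R) : 0 <= s -> s <= t -> measurable B -> forall A, finev s A ->
  P (A `&` ((fun w => (W t w - W s w)%R) @^-1` B)) =
  (P A * P ((fun w => (W t w - W s w)%R) @^-1` B))%E.
Proof.
move=> s0 st mB A [n [u [Bs [us mBs AE]]]].
pose L := 0 :: sort <=%R [seq u i | i <- iota 0 n].
have sL : size L = n.+1 by rewrite /= size_sort size_map size_iota.
have Lb x : x \in L -> 0 <= x <= s.
  by rewrite inE mem_sort => /orP[/eqP ->|/mapP[i _ ->]] //; rewrite lexx.
(* The sorted list, with 0 in front, fills the indices 0 to n. At n + 1 the default value of [nth]
   inserts s, and t comes after it, so increment number n + 1 is exactly W t - W s. *)
pose tt i := if (i <= n.+1)%N then nth s L i else t.
have Lsorted : sorted <=%R L.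
  rewrite /L /=; have := sort_sorted (@le_total _ R) [seq u i | i <- iota 0 n].
  rewrite path_sortedE; last exact: le_trans.
  move=> ->; rewrite andbT; apply/allP => x; rewrite mem_sort => /mapP[i _ ->].
  by case/andP: (us i).
have ttmono i : tt i <= tt i.+1.
  rewrite /tt; case: (ltngtP i n.+1) => [iN|iN|->].
  - have [iN'|] := ltnP i.+1 (size L).
      by move/(sortedP s): Lsorted; apply.
    move=> iN'; rewrite [leRHS]nth_default //.
    have iL : (i < size L)%N by rewrite sL.
    by have /andP[] := Lb _ (mem_nth s iL).
  - by [].
  - by rewrite nth_default ?sL.
have tt0 : tt 0%N = 0 by [].
have := grid_indep tt (S n) tt0 ttmono B mB A.
have -> : tt (S n) = s by rewrite /tt leqnn nth_default ?sL.
have -> : tt (S (S n)) = t by rewrite /tt ltnn.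
apply; rewrite AE.
set G := (X in <<s X >>).
apply: (@bigcap_measurableType _ (g_sigma_algebraType G)).
move=> i /= iN.
have /mapP : u i \in [seq u j | j <- iota 0 n] by apply: map_f; rewrite mem_iota.
have uL : u i \in L by rewrite inE mem_sort map_f ?orbT // mem_iota.
move=> _; have iL := uL; rewrite -index_mem sL in iL.
have ttu : tt (index (u i) L) = u i.
  by rewrite /tt (leq_trans (ltnW iL)) // nth_index.
have mW := @grid_measurable tt (S n) tt0 _ (ltnW iL); rewrite ttu in mW.
have mX : measurable_fun (T := g_sigma_algebraType G) setT (X0 (u i)).
  by apply: measurable_funD => //; apply: measurable_funM => //.
by have := mX measurableT _ (mBs i); rewrite setTI.
Qed.

Lemma natgen_indep s t (B : set R) : 0 <= s -> s <= t -> measurable B ->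
  forall A, <<s natgen s >> A ->
  P (A `&` ((fun w => (W t w - W s w)%R) @^-1` B)) =
  (P A * P ((fun w => (W t w - W s w)%R) @^-1` B))%E.
Proof.
move=> s0 st mB A sA.
have sA' : <<s finev s >> A.
  apply: sub_smallest2r sA; first exact: smallest_sigma_algebra.
  move=> _ [u [B' [us mB' ->]]].
  exists 1%N, (fun=> u), (fun=> B'); split=> //.
  by apply/seteqP; split=> w /= H; [move=> i _|exact: (H 0%N)].
apply: (sigma_indep P (finev s) _ (@finev_measurable s) _ _ _ _ _ sA').
- move=> _ _ [n1 [u1 [B1 [us1 mB1 ->]]]] [n2 [u2 [B2 [us2 mB2 ->]]]].
  exists (n1 + n2)%N, (fun i => if (i < n1)%N then u1 i else u2 (i - n1)%N),
     (fun i => if (i < n1)%N then B1 i else B2 (i - n1)%N); split.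
  + by move=> i; case: ifP.
  + by move=> i; case: ifP.
  apply/seteqP; split=> w /=.
    move=> [H1 H2] i /= iN; case: ltnP => in1; first exact: H1.
    by apply: H2 => /=; rewrite ltn_subLR.
  move=> H; split=> i /= iN.
    by have := H i (ltn_addr _ iN); rewrite iN.
  have := H (n1 + i)%N; rewrite /= ltn_add2l => /(_ iN).
  by rewrite ltnNge leq_addr /= addKn.
- exists 0%N, (fun=> 0), (fun=> setT); split=> //; first by rewrite lexx.
  by apply/seteqP; split=> w.
- by rewrite -[X in measurable X]setTI; exact: incr_measurable.
- by move=> A'; exact: finev_indep.
Qed.

Lemma filt_measurable t A : filt t A -> measurable A. Proof. by case. Qed.

Lemma natgen_filt t A : <<s natgen t >> A -> filt t A.
Proof.
move=> sA; split; first exact: sigma_algebra_sub (@natgen_measurable t) _ sA.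
by exists A; split=> //; rewrite !setDv setU0 measure0.
Qed.

Lemma filt_sub s t : s <= t -> filt s `<=` filt t.
Proof.
move=> st A [mA [B [sB PB]]]; split=> //; exists B; split=> //.
apply: sub_smallest2r sB; first exact: smallest_sigma_algebra.
exact: natgen_sub.
Qed.

Lemma filt_null t A : measurable A -> P A = 0%E -> filt t A.
Proof.
move=> mA A0; split=> //; exists set0; split.
  exact: (@measurable0 _ (g_sigma_algebraType (natgen t))).
by rewrite setD0 set0D setU0.
Qed.

(** A complement leaves the symmetric difference unchanged, and for a countable union it is
    contained in the union of the individual null differences. *)
Lemma filt_sigma_algebra t : sigma_algebra setT (filt t).
Proof.
have symm (A B : set T) : (setT `\` A) `\` (setT `\` B) `|` ((setT `\` B) `\` (setT `\` A)) =
    (A `\` B) `|` (B `\` A).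
  by apply/seteqP; split=> w /=; [move=> [[[_ ?] ?]|[[_ ?] ?]]|move=> [[? ?]|[? ?]]];
    try (by right; split; [apply: contrapT; tauto|]);
    try (by left; split; [apply: contrapT; tauto|]);
    [right|left]; split; tauto.
split.
- by apply: filt_null => //; exact: measure0.
- move=> A [mA [B [sB PB]]]; split; first exact: measurableD.
  exists (setT `\` B); split; last by rewrite symm.
  exact: (@measurableD _ (g_sigma_algebraType (natgen t)) setT B).
- move=> A fA; split; first by apply: bigcupT_measurable => i; case: (fA i).
  have /choice[B HB] : forall i, exists B, <<s natgen t >> B /\
      P ((A i `\` B) `|` (B `\` A i)) = 0%E by move=> i; case: (fA i).
  exists (\bigcup_i B i); split.
    apply: (@bigcupT_measurable _ (g_sigma_algebraType (natgen t))) => i.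
    by case: (HB i).
  have mAi i : measurable (A i) by case: (fA i).
  have mBi i : measurable (B i).
    by apply: (sigma_algebra_sub _ (@natgen_measurable t)); case: (HB i).
  have mS i : measurable ((A i `\` B i) `|` (B i `\` A i)).
    by apply: measurableU; exact: measurableD.
  apply: (@subset_measure0 _ _ _ P _ (\bigcup_i ((A i `\` B i) `|` (B i `\` A i)))).
  + by apply: measurableU; apply: measurableD; exact: bigcupT_measurable.
  + exact: bigcupT_measurable.
  + move=> w [[[i _ Ai] nB]|[[i _ Bi] nA]]; exists i => //.
      by left; split=> // Bi; apply: nB; exists i.
    by right; split=> // Ai; apply: nA; exists i.
  + apply/negligibleP; first exact: bigcupT_measurable.
    apply: negligible_bigcup => i; apply/negligibleP; first exact: mS.
    by case: (HB i).
Qed.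

Lemma g_filtE t : <<s filt t >> = filt t.
Proof. exact: sigma_algebra_id (filt_sigma_algebra t). Qed.

(** Replacing A by its version in the natural sigma-algebra changes no probability, so
    [natgen_indep] applies. *)
Lemma filt_indep s t (B : set R) : 0 <= s -> s <= t -> measurable B ->
  forall A, filt s A ->
  P (A `&` ((fun w => (W t w - W s w)%R) @^-1` B)) =
  (P A * P ((fun w => (W t w - W s w)%R) @^-1` B))%E.
Proof.
move=> s0 st mB A [mA [A' [sA' A0]]].
set C := _ @^-1` B.
have mC : measurable C by rewrite -[X in measurable X]setTI; exact: incr_measurable.
have mA' : measurable A' by apply: (sigma_algebra_sub _ (@natgen_measurable s)).
have eqP D1 D2 : measurable D1 -> measurable D2 ->
    (D1 `\` D2) `|` (D2 `\` D1) `<=` (A `\` A') `|` (A' `\` A) -> P D1 = P D2.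
  move=> m1 m2 sub.
  have m12 := measurableD m1 m2; have m21 := measurableD m2 m1.
  have Z : P ((D1 `\` D2) `|` (D2 `\` D1)) = 0%E.
    apply: subset_measure0 A0 => //; first exact: measurableU.
    by apply: measurableU; exact: measurableD.
  have mU : measurable ((D1 `\` D2) `|` (D2 `\` D1)) by exact: measurableU.
  have Z1 : P (D1 `\` D2) = 0%E by apply: (subset_measure0 m12 mU) => // w; left.
  have Z2 : P (D2 `\` D1) = 0%E by apply: (subset_measure0 m21 mU) => // w; right.
  have A1 : P D1 = P (D1 `&` D2).
    rewrite -{1}[D1](setUIDK _ D2) measureU; [by apply: (etrans (congr1 (fun x => _ + x)%E Z1)); exact: adde0|exact: measurableI|exact: m12|].
    by apply/seteqP; split=> w //= [[_ ?] [_ ?]].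
  have A2 : P D2 = P (D2 `&` D1).
    rewrite -{1}[D2](setUIDK _ D1) measureU; [by apply: (etrans (congr1 (fun x => _ + x)%E Z2)); exact: adde0|exact: measurableI|exact: m21|].
    by apply/seteqP; split=> w //= [[_ ?] [_ ?]].
  by rewrite A1 A2 setIC.
have -> : P (A `&` C) = P (A' `&` C).
  apply: eqP; [exact: measurableI|exact: measurableI|].
  by move=> w /=; tauto.
have -> : P A = P A' by exact: eqP.
exact: natgen_indep.
Qed.

End BrownianFiltration.

(** * Drift of a controlled process over one time step *)

Section OneStep.
Context {R : realType} {d : measure_display} {T : measurableType d}.
Variables (P : probability T R) (W : R -> T -> R) (x0 mu sigma : R).
Hypotheses (BM : is_BM P W) (mu0 : 0 < mu) (sigma0 : 0 < sigma).
Local Notation X0 := (X0 x0 mu sigma W).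
Local Notation natgen := (natgen x0 mu sigma W).
Local Notation filt := (filt P x0 mu sigma W).

Definition adapted (s : R) (Z : T -> R) :=
  measurable_fun (T := g_sigma_algebraType (filt s)) setT Z.

Lemma adaptedP s Z : adapted s Z <-> forall B : set R, measurable B -> filt s (Z @^-1` B).
Proof.
rewrite /adapted; split.
  by move=> /g_sigma_algebra_funP H B mB; rewrite -g_filtE //; exact: H.
by move=> H; apply/g_sigma_algebra_funP => B mB; rewrite g_filtE //; exact: H.
Qed.

Lemma adapted_measurable s Z : adapted s Z -> measurable_fun setT Z.
Proof.
by move=> /adaptedP H _ B mB; rewrite setTI; exact: filt_measurable (H B mB).
Qed.

Lemma adapted_le s t Z : s <= t -> adapted s Z -> adapted t Z.
Proof. by move=> st /adaptedP H; apply/adaptedP => B mB; apply: filt_sub st _ (H B mB). Qed.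

Lemma adapted_comp s Z (f : R -> R) : measurable_fun setT f -> adapted s Z -> adapted s (f \o Z).
Proof. by move=> mf aZ; exact: measurableT_comp. Qed.

Lemma adapted_W s u : 0 <= u -> u <= s -> adapted s (W u).
Proof.
move=> u0 us; apply/adaptedP => B mB; apply: natgen_filt => //.
have H : measurable_fun (T := g_sigma_algebraType (natgen s)) setT (W u) by exact: W_natgen.
by move/g_sigma_algebra_funP: H; apply.
Qed.

Lemma adapted_X0 s u : 0 <= u -> u <= s -> adapted s (X0 u).
Proof.
move=> u0 us; apply/adaptedP => B mB; apply: natgen_filt => //.
have H : measurable_fun (T := g_sigma_algebraType (natgen s)) setT (X0 u) by exact: X0_natgen.
by move/g_sigma_algebra_funP: H; apply.
Qed.

Lemma adapted_indep_Ex s t (Z : T -> R) (g : R -> R) : 0 <= s -> s <= t -> adapted s Z ->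
  Intg P Z -> measurable_fun setT g -> Intg P (fun w => g (W t w - W s w)) ->
  Intg P (fun w => Z w * g (W t w - W s w)) /\
  Ex P (fun w => Z w * g (W t w - W s w)) = Ex P Z * Ex P (fun w => g (W t w - W s w)).
Proof.
move=> s0 st aZ IZ mg Ig; apply: indep_Ex => // A B mA mB.
have -> : (fun w => g (W t w - W s w)) @^-1` B =
    (fun w => W t w - W s w) @^-1` (g @^-1` B) by [].
apply: filt_indep => //; first by rewrite -[X in measurable X]setTI; exact: mg.
by move/adaptedP: aZ; apply.
Qed.

Lemma incr_moments s t (r : R) : 0 <= s -> 0 < r -> t - s = r ^+ 2 ->
  [/\ Intg P (fun w => W t w - W s w), Ex P (fun w => W t w - W s w) = 0,
      Intg P (fun w => (W t w - W s w) ^+ 2), Ex P (fun w => (W t w - W s w) ^+ 2) = r ^+ 2 &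
      Intg P (fun w => (W t w - W s w) ^+ 4) /\
      Ex P (fun w => (W t w - W s w) ^+ 4) <= 30 * r ^+ 4].
Proof.
move=> s0 r0 tsr; have st : s < t by rewrite -subr_gt0 tsr exprn_gt0.
have mD : measurable_fun setT (fun w => W t w - W s w) by exact: incr_measurable BM _ _.
have law : forall B : set R, measurable B ->
    P ((fun w => W t w - W s w) @^-1` B) = normal_prob 0 r B.
  move=> B mB; have [_ _ _ H _] := BM; rewrite (H s t s0 st B mB) tsr.
  by rewrite sqrtr_sqr gtr0_norm.
have [I1 E1] := gauss_moment1 P _ r mD r0 law.
have [I2 E2] := gauss_moment2 P _ r mD r0 law.
by split=> //; exact: (gauss_moment4 P _ r mD r0 law).
Qed.

(** The first term is the square of the drift in the second-order term. In the second, 64 rounds up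
    2 (1 + 30), the second and fourth moments in [cube_increment_le]. *)
Definition step_const (L Q : R) := mu ^+ 2 * Q / 2 + L * (4 * mu ^+ 3 + 64 * sigma ^+ 3).

(** (p + q)^3 <= 4 p^3 + 4 q^3, and the odd power |x|^3 is at most (r x^2 + x^4 / r) / 2, so even
    moments suffice. *)
Lemma cube_increment_le (r x : R) : 0 < r -> r <= 1 ->
  `| - mu * r ^+ 2 + sigma * x| ^+ 3 <=
  4 * mu ^+ 3 * r ^+ 3 + 2 * sigma ^+ 3 * (r * x ^+ 2 + x ^+ 4 / r).
Proof.
move=> r0 r1; have mup := mu0; have sp := sigma0.
have x20 : x ^+ 2 = `|x| ^+ 2 by rewrite real_normK ?num_real.
have x40 : x ^+ 4 = `|x| ^+ 4 by rewrite -[4%N]/(2 * 2)%N !exprM x20.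
set y := `|x| in x20 x40; have y0 : 0 <= y by exact: normr_ge0.
have tri : `| - mu * r ^+ 2 + sigma * x| <= mu * r ^+ 2 + sigma * y.
  apply: (le_trans (ler_normD _ _)); rewrite (normrM sigma) (gtr0_norm sigma0) lerD2r.
  rewrite mulNr normrN ger0_norm //; apply: mulr_ge0; [exact: ltW|exact: sqr_ge0].
apply: (@le_trans _ _ ((mu * r ^+ 2 + sigma * y) ^+ 3)).
  by rewrite lerXn2r // nnegrE (le_trans _ tri).
have cub (p q : R) : 0 <= p -> 0 <= q -> (p + q) ^+ 3 <= 4 * p ^+ 3 + 4 * q ^+ 3.
  move=> p0 q0; have -> : (p + q) ^+ 3 = 4 * p ^+ 3 + 4 * q ^+ 3 - 3 * ((p - q) ^+ 2 * (p + q)) by ring.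
  have : 0 <= (p - q) ^+ 2 * (p + q) by rewrite mulr_ge0 ?sqr_ge0 ?addr_ge0.
  by lra.
have p0 : 0 <= mu * r ^+ 2 by rewrite mulr_ge0 ?sqr_ge0 // ltW.
have q0 : 0 <= sigma * y by rewrite mulr_ge0 // ltW.
apply: (le_trans (cub _ _ p0 q0)); rewrite x20 x40.
have t1 : 4 * (mu * r ^+ 2) ^+ 3 <= 4 * mu ^+ 3 * r ^+ 3.
  have -> : 4 * (mu * r ^+ 2) ^+ 3 = 4 * mu ^+ 3 * r ^+ 3 * r ^+ 3 by ring.
  rewrite ler_piMr //; first by apply: mulr_ge0; [apply: mulr_ge0 => //|]; apply: exprn_ge0; exact: ltW.
  by apply: exprn_ile1 => //; exact: ltW.
have t2 : 4 * (sigma * y) ^+ 3 <= 2 * sigma ^+ 3 * (r * y ^+ 2 + y ^+ 4 / r).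
  have -> : 2 * sigma ^+ 3 * (r * y ^+ 2 + y ^+ 4 / r) =
     4 * (sigma * y) ^+ 3 + 2 * sigma ^+ 3 * (y ^+ 2 * (r - y) ^+ 2 / r).
    by field; rewrite gt_eqF.
  rewrite lerDl; apply: mulr_ge0; first by apply: mulr_ge0 => //; apply: exprn_ge0; exact: ltW.
  by apply: divr_ge0; [apply: mulr_ge0; exact: sqr_ge0|exact: ltW].
by lra.
Qed.

(** Here r is the square root of the time step and Z the state at its beginning. In the expansion at
    Z the terms carrying D or D^2 - r^2 have mean zero by independence; what is left besides the
    drift is of order r^4 or cubic, and r <= 1 merges both into r^3. *)
Lemma one_step (L Q : R) (V v q : R -> R) (Z : T -> R) s t r :
  (forall x : R, is_derive x (1 : R) V (v x)) -> qapprox L v q -> (forall x, `|q x| <= Q) ->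
  measurable_fun setT q ->
  0 <= s -> 0 < r -> r <= 1 -> t - s = r ^+ 2 -> adapted s Z ->
  Intg P (V \o Z) -> Intg P (v \o Z) ->
  [/\ Intg P (fun w => V (Z w + (X0 t w - X0 s w))),
      Intg P (fun w => sigma ^+ 2 / 2 * q (Z w) - mu * v (Z w)) &
   `|Ex P (fun w => V (Z w + (X0 t w - X0 s w))) - Ex P (V \o Z)
     - r ^+ 2 * Ex P (fun w => sigma ^+ 2 / 2 * q (Z w) - mu * v (Z w))|
   <= step_const L Q * r ^+ 3].
Proof.
move=> dV vq qQ mq s0 r0 r1 tsr aZ IV Iv.
have st : s <= t by rewrite -subr_ge0 tsr sqr_ge0.
have L0 := qapprox_ge0 _ _ _ vq.
have Q0 : 0 <= Q by apply: le_trans (qQ 0).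
have mZ := adapted_measurable _ _ aZ.
have cV : continuous V by move=> x; apply/differentiable_continuous/derivable1_diffP; case: (dV x).
have cv : continuous v.
  move=> x; apply/differentiable_continuous/derivable1_diffP.
  by case: (qapprox_is_derive _ _ _ x vq).
have mV : measurable_fun setT V by exact: continuous_measurable_fun.
have mv : measurable_fun setT v by exact: continuous_measurable_fun.
have [I1 E1 I2 E2 [I4 E4]] := incr_moments s t r s0 r0 tsr.
set D := fun w => W t w - W s w in I1 E1 I2 E2 I4 E4.
have eta w : X0 t w - X0 s w = - mu * r ^+ 2 + sigma * D w.
  by rewrite -tsr /Defs.X0 /D; ring.
have Iq : Intg P (q \o Z).
  by apply: Intg_le (Intg_cst P Q) _ => [|w]; [exact: measurableT_comp|exact: qQ].
have avZ := adapted_comp _ _ _ mv aZ; have aqZ := adapted_comp _ _ _ mq aZ.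
have [IvD EvD] := adapted_indep_Ex s t (v \o Z) id s0 st avZ Iv (@measurable_id _ _ _) I1.
have [IqD EqD] := adapted_indep_Ex s t (q \o Z) id s0 st aqZ Iq (@measurable_id _ _ _) I1.
have msq : measurable_fun setT (fun x : R => x ^+ 2) by exact: measurable_funX.
have [IqD2 EqD2] := adapted_indep_Ex s t (q \o Z) (fun x => x ^+ 2) s0 st aqZ Iq msq I2.
(* Second-order expansion arranged as value plus drift, then the mean-zero terms and the r^4 term
   coming from the squared drift. *)
pose main w := (V (Z w) + r ^+ 2 * (sigma ^+ 2 / 2 * q (Z w) - mu * v (Z w)))
   + (sigma * (v (Z w) * D w) + (mu ^+ 2 * r ^+ 4 / 2) * q (Z w)
   + (- (mu * sigma * r ^+ 2)) * (q (Z w) * D w)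
   + (sigma ^+ 2 / 2) * (q (Z w) * D w ^+ 2 - r ^+ 2 * q (Z w))).
pose err w := L * (4 * mu ^+ 3 * r ^+ 3 + 2 * sigma ^+ 3 * (r * D w ^+ 2 + r^-1 * D w ^+ 4)).
have taylor w : `|V (Z w + (X0 t w - X0 s w)) - main w| <= err w.
  have := qapprox_taylor L V v q dV vq (Z w) (X0 t w - X0 s w).
  rewrite (_ : _ - _ - _ - _ = V (Z w + (X0 t w - X0 s w)) - main w); last first.
    by rewrite /main eta; field.
  move=> /le_trans; apply; rewrite /err ler_wpM2l // eta (mulrC r^-1).
  exact: cube_increment_le.
have IA : Intg P (fun w => sigma ^+ 2 / 2 * q (Z w) - mu * v (Z w)).
  exact: IntgB (IntgZ P _ _ Iq) (IntgZ P _ _ Iv).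
have Imain1 : Intg P (fun w => V (Z w) + r ^+ 2 * (sigma ^+ 2 / 2 * q (Z w) - mu * v (Z w))).
  exact: IntgD IV (IntgZ P _ _ IA).
have J1 := IntgZ P sigma _ IvD.
have J2 := IntgZ P (mu ^+ 2 * r ^+ 4 / 2) _ Iq.
have J3 := IntgZ P (- (mu * sigma * r ^+ 2)) _ IqD.
have J4' := IntgB P _ _ IqD2 (IntgZ P (r ^+ 2) _ Iq).
have J4 := IntgZ P (sigma ^+ 2 / 2) _ J4'.
have J12 := IntgD P _ _ J1 J2; have J123 := IntgD P _ _ J12 J3.
have J1234 := IntgD P _ _ J123 J4.
have Imain : Intg P main := IntgD P _ _ Imain1 J1234.
have Emain : Ex P main = Ex P (V \o Z)
    + r ^+ 2 * Ex P (fun w => sigma ^+ 2 / 2 * q (Z w) - mu * v (Z w))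
    + mu ^+ 2 * r ^+ 4 / 2 * Ex P (q \o Z).
  rewrite /main (ExD P _ _ Imain1 J1234) (ExD P _ _ IV (IntgZ P _ _ IA)) (ExZ P _ _ IA).
  rewrite (ExD P _ _ J123 J4) (ExD P _ _ J12 J3) (ExD P _ _ J1 J2).
  rewrite (ExZ P _ _ IvD) (ExZ P _ _ Iq) (ExZ P _ _ IqD) (ExZ P _ _ J4').
  rewrite (ExB P _ _ IqD2 (IntgZ P (r ^+ 2) _ Iq)) (ExZ P _ _ Iq).
  have -> : Ex P (fun w => q (Z w) * D w ^+ 2) = Ex P (q \o Z) * r ^+ 2 by rewrite -E2.
  have -> : Ex P (fun w => v (Z w) * D w) = 0 by apply: (etrans EvD); apply/eqP; rewrite mulf_eq0; apply/orP; right; apply/eqP; exact: E1.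
  have -> : Ex P (fun w => q (Z w) * D w) = 0 by apply: (etrans EqD); apply/eqP; rewrite mulf_eq0; apply/orP; right; apply/eqP; exact: E1.
  by rewrite /comp; ring.
have K1 := IntgD P _ _ (IntgZ P r _ I2) (IntgZ P r^-1 _ I4).
have K2 := IntgD P _ _ (Intg_cst P (4 * mu ^+ 3 * r ^+ 3)) (IntgZ P (2 * sigma ^+ 3) _ K1).
have Ierr : Intg P err := IntgZ P L _ K2.
have s30 : 0 <= sigma ^+ 3 by apply: exprn_ge0; exact: ltW.
have Eerr : Ex P err <= L * (4 * mu ^+ 3 + 64 * sigma ^+ 3) * r ^+ 3.
  rewrite /err (ExZ P _ _ K2) (ExD P _ _ (Intg_cst P _) (IntgZ P _ _ K1)) Ex_cst (ExZ P _ _ K1).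
  rewrite (ExD P _ _ (IntgZ P r _ I2) (IntgZ P r^-1 _ I4)) !ExZ // E2 -[leRHS]mulrA ler_wpM2l //.
  have : r^-1 * Ex P (fun w => D w ^+ 4) <= r^-1 * (30 * r ^+ 4).
    by rewrite ler_pM2l ?invr_gt0.
  have -> : r^-1 * (30 * r ^+ 4) = 30 * r ^+ 3 by field; rewrite gt_eqF.
  have -> : r * r ^+ 2 = r ^+ 3 by ring.
  move=> H; have H' := ler_wpM2l s30 H.
  have r3 : 0 <= sigma ^+ 3 * r ^+ 3 by apply: mulr_ge0 => //; apply: exprn_ge0; exact: ltW.
  by rewrite !mulrDl !mulrDr; lra.
have mVx : measurable_fun setT (fun w => V (Z w + (X0 t w - X0 s w))).
  apply: measurableT_comp => //; apply: measurable_funD => //.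
  by apply: measurable_funB; exact: X0_measurable BM _.
have Idiff : Intg P (fun w => V (Z w + (X0 t w - X0 s w)) - main w).
  apply: Intg_le Ierr taylor; apply: measurable_funB => //; exact: Intg_measurable Imain.
have IVx : Intg P (fun w => V (Z w + (X0 t w - X0 s w))).
  have := IntgD P _ _ Idiff Imain.
  by under eq_fun do rewrite subrK.
split=> //.
have Ed : `|Ex P (fun w => V (Z w + (X0 t w - X0 s w))) - Ex P main| <= Ex P err.
  rewrite -(ExB P _ _ IVx Imain); apply: (le_trans (Ex_abs P _ Idiff)).
  by apply: Ex_le => //; exact: Intg_abs.
have Eq : `|Ex P (q \o Z)| <= Q.
  apply: (le_trans (Ex_abs P _ Iq)); rewrite -[leRHS](Ex_cst P).
  by apply: Ex_le; [exact: Intg_abs|exact: Intg_cst|move=> w; exact: qQ].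
set e1 := Ex P (fun w => V _); set e2 := Ex P (V \o Z); set e3 := r ^+ 2 * _.
have -> : e1 - e2 - e3 = (e1 - Ex P main) + mu ^+ 2 * r ^+ 4 / 2 * Ex P (q \o Z).
  by rewrite Emain -/e2 -/e3; ring.
apply: (le_trans (ler_normD _ _)).
have c0 : 0 <= mu ^+ 2 * r ^+ 4 / 2.
  by apply: divr_ge0 => //; apply: mulr_ge0; [exact: sqr_ge0|apply: exprn_ge0; exact: ltW].
rewrite normrM (ger0_norm c0) /step_const mulrDl addrC; apply: lerD; last exact: le_trans Ed Eerr.
apply: (le_trans (ler_wpM2l c0 Eq)).
have -> : mu ^+ 2 * r ^+ 4 / 2 * Q = mu ^+ 2 * Q / 2 * r ^+ 3 * r by ring.
rewrite ler_piMr //; apply: mulr_ge0; last by apply: exprn_ge0; exact: ltW.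
by apply: divr_ge0 => //; apply: mulr_ge0 => //; exact: sqr_ge0.
Qed.

End OneStep.

(** * Continuous paths and Doob's inequality *)

Section PathContinuity.
Context {R : realType}.
Implicit Types f : R -> R.

Definition pcont f := forall u e, 0 <= u -> 0 < e ->
  exists2 eta, 0 < eta & forall v, 0 <= v -> `|v - u| < eta -> `|f v - f u| < e.

Lemma pcontP f : pcont f <-> {within [set t : R | 0 <= t], continuous f}.
Proof.
rewrite subspace_continuousP; split=> [pf x x0|cf u e u0 e0].
  apply/cvgrPdist_lt => e e0; have [eta eta0 H] := pf x e x0 e0.
  have nx : \forall v \near x, `|x - v| < eta.
    by have /cvgrPdist_lt/(_ eta eta0) := @cvg_id _ (nbhs x).
  rewrite near_withinE; apply: filterS nx => v xv v0; rewrite distrC; apply: H => //.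
  by rewrite distrC.
have /cvgrPdist_lt/(_ e e0) := cf u u0; rewrite near_withinE => /nbhs_ballP[eta /= eta0 H].
exists eta => // v v0 vu; rewrite distrC; apply: H => //.
by rewrite /ball /= distrC.
Qed.

Lemma pcont_itv f t : pcont f -> {within `[0, t]%classic, continuous f}.
Proof.
move=> /pcontP; apply: continuous_subspaceW => x /=; by rewrite in_itv /= => /andP[].
Qed.

Lemma pcont_argmin f t : 0 <= t -> pcont f ->
  exists2 u, 0 <= u <= t & forall v, 0 <= v <= t -> f u <= f v.
Proof.
move=> t0 /(pcont_itv _ t) cf; have [u + H] := EVT_min t0 cf.
by rewrite in_itv /= => ut; exists u => // v vt; apply: H; rewrite in_itv.
Qed.

Lemma pcont_lin f a b c : pcont f -> pcont (fun t => a + b * t + c * f t).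
Proof.
move=> pf u e u0 e0.
have e2 : 0 < e / 2 by rewrite divr_gt0.
have db : 0 < e / 2 / (`|b| + 1) by rewrite divr_gt0 // ltr_wpDl.
have dc : 0 < e / 2 / (`|c| + 1) by rewrite divr_gt0 // ltr_wpDl.
have [eta eta0 H] := pf u _ u0 dc.
exists (Num.min eta (e / 2 / (`|b| + 1))); first by rewrite lt_min eta0.
move=> v v0; rewrite lt_min => /andP[v1 v2]; have := H v v0 v1.
have -> : a + b * v + c * f v - (a + b * u + c * f u) = b * (v - u) + c * (f v - f u) by ring.
move: v2; rewrite !ltr_pdivlMr ?ltr_wpDl // => v2 v3.
apply: (le_lt_trans (ler_normD _ _)); rewrite !normrM.
have n1 := normr_ge0 (v - u); have n2 := normr_ge0 (f v - f u).
by move: v2 v3; rewrite !mulrDr !mulr1 (mulrC `|b|) (mulrC `|c|); lra.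
Qed.

Lemma pcont_bounded f t : 0 <= t -> pcont f -> exists B, forall v, 0 <= v <= t -> `|f v| <= B.
Proof.
move=> t0 pf; have [u _ Hu] := pcont_argmin f t t0 pf.
have pN : pcont (fun s => 0 + 0 * s + (-1) * f s) by exact: pcont_lin.
have [u' _ Hu'] := pcont_argmin _ t t0 pN.
exists (`|f u| + `|f u'|) => v vt; have h1 := Hu v vt; have h2 := Hu' v vt.
have n1 := ler_norm (f u'); have n2 := lerNnormlW (lexx `|f u|).
have n3 := normr_ge0 (f u); have n4 := normr_ge0 (f u').
by rewrite ler_norml; apply/andP; split; lra.
Qed.

Lemma pcont_unif f t e : pcont f -> 0 < e -> exists2 eta, 0 < eta &
  forall u v, 0 <= u <= t -> 0 <= v <= t -> `|u - v| < eta -> `|f u - f v| < e.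
Proof.
move=> pf e0.
have /compact_near_coveringP cK := @segment_compact R 0 t.
pose Pr (eta u : R) := forall v, 0 <= v <= t -> 0 <= u -> `|u - v| < eta -> `|f u - f v| < e.
have : \forall eta \near (0:R)^'+, `[0, t]%classic `<=` Pr eta.
  apply: cK => x /=; rewrite in_itv /= => /andP[x0' xt].
  have e2 : 0 < e / 2 by rewrite divr_gt0.
  have [eta0 eta00 H] := pf x (e / 2) x0' e2.
  near=> u eta => v /andP[v0 vt] u0 uv.
  have hu : `|u - x| < eta0 / 2.
    rewrite distrC; near: u.
    have e02 : 0 < eta0 / 2 by rewrite divr_gt0.
    by have /cvgrPdist_lt/(_ _ e02) := @cvg_id _ (nbhs x).
  have he : eta < eta0 / 2 by near: eta; apply: nbhs_right_lt; rewrite divr_gt0.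
  have h1 : `|f u - f x| < e / 2 by apply: H => //; lra.
  have h2 : `|f v - f x| < e / 2.
    apply: H => //; have -> : v - x = (u - x) - (u - v) by ring.
    by apply: (le_lt_trans (ler_normB _ _)); rewrite [ltRHS]splitr; apply: ltrD => //; exact: lt_trans uv he.
  have -> : f u - f v = (f u - f x) - (f v - f x) by ring.
  by apply: (le_lt_trans (ler_normB _ _)); rewrite [ltRHS]splitr; apply: ltrD.
move=> Hn; near ((0 : R)^'+) => eta.
have e1 : `[0, t]%classic `<=` Pr eta by near: eta.
have e2 : 0 < eta by near: eta; exact: nbhs_right_gt.
exists eta => // u v /andP[u0 ut] vt uv; apply: (e1 u) => //.
by rewrite /= in_itv /= u0.
Unshelve. all: by end_near. Qed.

End PathContinuity.

Section RunningMax.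
Context {R : realType}.
Implicit Types s : nat -> R.

Fixpoint rmax s n : R := if n is m.+1 then Num.max (rmax s m) (s m.+1) else 0.

Lemma rmax_ge0 s n : 0 <= rmax s n.
Proof. by elim: n => //= n IH; rewrite le_max IH. Qed.

Lemma rmax_ub s n i : (0 < i <= n)%N -> s i <= rmax s n.
Proof.
elim: n => [|n IH]; first by case: i.
case/andP=> i0; rewrite leq_eqVlt => /orP[/eqP ->|iN] /=.
  by rewrite le_max lexx orbT.
by rewrite le_max IH // i0.
Qed.

Lemma rmax_sqr_le s n : rmax s n ^+ 2 <= \sum_(i < n) s i.+1 ^+ 2.
Proof.
elim: n => [|n IH]; first by rewrite big_ord0 expr0n.
rewrite big_ord_recr /= maxEle; case: ifP => _.
  by rewrite lerDr sumr_ge0 // => i _; exact: sqr_ge0.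
by apply: (le_trans IH); rewrite lerDl sqr_ge0.
Qed.

(* Pathwise form of Doob's L2 maximal inequality: the sum is a martingale
   transform. *)
Lemma doob_pathwise s n : s 0%N = 0 ->
  rmax s n ^+ 2 <= 4 * s n ^+ 2 - 4 * \sum_(i < n) rmax s i * (s i.+1 - s i).
Proof.
move=> s0.
(* When the maximum rises at step n + 1 it becomes s (n + 1), and the gap is half the square of the
   rise; otherwise both sides grow equally. The conclusion then follows by completing the square of
   m - 2 s. *)
have A : \sum_(i < n) rmax s i * (s i.+1 - s i) <= rmax s n * s n - rmax s n ^+ 2 / 2.
  elim: n => [|n IH]; first by rewrite big_ord0 /= mul0r expr0n /= mul0r subr0.
  rewrite big_ord_recr /=; apply: (le_trans (lerD IH (lexx _))).
  rewrite maxEle; case: ifP => h; last by lra.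
  have := sqr_ge0 (s n.+1 - rmax s n); nra.
have := sqr_ge0 (rmax s n / 2 - s n); nra.
Qed.

End RunningMax.

Section Doob.
Context {R : realType} {d : measure_display} {T : measurableType d}.
Variables (P : probability T R) (W : R -> T -> R) (x0 mu sigma : R).
Hypotheses (BM : is_BM P W) (mu0 : 0 < mu) (sigma0 : 0 < sigma).
Local Notation adapted := (adapted P W x0 mu sigma).

Lemma W_pcont w : pcont (fun t => W t w).
Proof. by apply/pcontP; case: BM. Qed.

Lemma X0_pcont w : pcont (fun t => X0 x0 mu sigma W t w).
Proof.
have := pcont_lin _ x0 (- mu) sigma (W_pcont w).
by rewrite /X0; under eq_fun do rewrite mulNr.
Qed.

Lemma W_sqr t : 0 <= t -> Intg P (fun w => W t w ^+ 2) /\ Ex P (fun w => W t w ^+ 2) = t.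
Proof.
move=> t0; have W0 : forall w, W 0 w = 0 by case: BM.
move: t0; rewrite le_eqVlt => /orP[/eqP <-|t0].
  have -> : (fun w => W 0 w ^+ 2) = fun=> 0 by apply/funext => w; rewrite W0 expr0n.
  by rewrite Ex_cst; split=> //; exact: Intg_cst.
have r0 : 0 < Num.sqrt t by rewrite sqrtr_gt0.
have [] := @incr_moments _ _ _ P W BM 0 t (Num.sqrt t) (lexx _) r0.
  by rewrite subr0 sqr_sqrtr // ltW.
under eq_fun do rewrite W0 subr0; move=> _ _.
have -> : (fun w => (W t w - W 0 w) ^+ 2) = (fun w => W t w ^+ 2).
  by apply/funext => w; rewrite W0 subr0.
by move=> I2 E2 _; rewrite E2 sqr_sqrtr // ltW.
Qed.

Definition gridp (t : R) (n i : nat) : R := t * i%:R / n.+1%:R.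

Lemma gridp_ge0 t n i : 0 <= t -> 0 <= gridp t n i.
Proof. by move=> t0; rewrite /gridp divr_ge0 // mulr_ge0. Qed.

Lemma gridpS t n i : gridp t n i.+1 - gridp t n i = t / n.+1%:R.
Proof.
have nn : n.+1%:R != 0 :> R by rewrite pnatr_eq0.
by rewrite /gridp -[i.+1%:R]natr1 -mulrBl mulrDr mulr1 addrC addKr.
Qed.

Lemma gridp_le t n i j : 0 <= t -> (i <= j)%N -> gridp t n i <= gridp t n j.
Proof.
by move=> t0 ij; rewrite /gridp ler_pM2r ?invr_gt0 ?ltr0n // ler_wpM2l // ler_nat.
Qed.

Lemma gridp0 t n : gridp t n 0 = 0.
Proof. by rewrite /gridp mulr0 mul0r. Qed.

Lemma gridp_last t n : gridp t n n.+1 = t.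
Proof. by rewrite /gridp mulfK // pnatr_eq0. Qed.

Definition sgnW (b t : R) n w i := b * W (gridp t n i) w.

(** The running maximum at a grid time is independent of the next increment, so the martingale
    transform has mean zero and 4 E W_t^2 remains. Integrability comes first, from the crude bound
    by a sum of squares. The sign b serves both W and - W. *)
Lemma doob_grid b t n : b ^+ 2 = 1 -> 0 <= t ->
  [/\ measurable_fun setT (fun w => rmax (sgnW b t n w) n.+1),
      Intg P (fun w => rmax (sgnW b t n w) n.+1 ^+ 2) &
      Ex P (fun w => rmax (sgnW b t n w) n.+1 ^+ 2) <= 4 * t].
Proof.
move=> b1 t0; have W0 : forall w, W 0 w = 0 by case: BM.
have g0 i := gridp_ge0 t n i t0.
have aM i : adapted (gridp t n i) (fun w => rmax (sgnW b t n w) i).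
  elim: i => [|i IH] /=; first exact: measurable_cst.
  apply: measurable_maxr.
    by apply: adapted_le IH => //; exact: gridp_le.
  by apply: measurable_funM => //; apply: adapted_W.
have mM i : measurable_fun setT (fun w => rmax (sgnW b t n w) i).
  by apply: adapted_measurable (aM i).
have ISs i : Intg P (fun w => sgnW b t n w i ^+ 2).
  have -> : (fun w => sgnW b t n w i ^+ 2) = (fun w => W (gridp t n i) w ^+ 2).
    by apply/funext => w; rewrite /sgnW exprMn b1 mul1r.
  by case: (W_sqr _ (g0 i)).
have IM2 i : Intg P (fun w => rmax (sgnW b t n w) i ^+ 2).
  apply: (Intg_le _ _ (fun w => \sum_(j < i) sgnW b t n w j.+1 ^+ 2)).
  - exact: measurable_funX.
  - exact: (Intg_sum P i (fun j w => sgnW b t n w j.+1 ^+ 2)).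
  - by move=> w; rewrite ger0_norm ?sqr_ge0 // rmax_sqr_le.
have IM i : Intg P (fun w => rmax (sgnW b t n w) i).
  apply: (Intg_le _ _ (fun w => 1 + rmax (sgnW b t n w) i ^+ 2)) => //.
    by apply: IntgD => //; exact: Intg_cst.
  move=> w; rewrite ger0_norm ?rmax_ge0 //; have := rmax_ge0 (sgnW b t n w) i.
  set y := rmax _ _; have := sqr_ge0 (y - 1); nra.
have term i : Intg P (fun w => rmax (sgnW b t n w) i * (sgnW b t n w i.+1 - sgnW b t n w i)) /\
    Ex P (fun w => rmax (sgnW b t n w) i * (sgnW b t n w i.+1 - sgnW b t n w i)) = 0.
  have [t00|tp] := eqVneq t 0.
    have -> : (fun w => rmax (sgnW b t n w) i * (sgnW b t n w i.+1 - sgnW b t n w i)) = fun=> 0.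
      by apply/funext => w; rewrite /sgnW /gridp t00 !mul0r subrr mulr0.
    by rewrite Ex_cst; split=> //; exact: Intg_cst.
  have tpos : 0 < t by rewrite lt_neqAle eq_sym tp.
  have dp : 0 < t / n.+1%:R by rewrite divr_gt0 ?ltr0n.
  have r0 : 0 < Num.sqrt (t / n.+1%:R) by rewrite sqrtr_gt0.
  have [] := @incr_moments _ _ _ P W BM (gridp t n i) (gridp t n i.+1) _ (g0 i) r0.
    by rewrite gridpS sqr_sqrtr // ltW.
  move=> I1 E1 _ _ _.
  have [I E] := @adapted_indep_Ex _ _ _ P W x0 mu sigma BM _ (gridp t n i.+1) _ id (g0 i)
     (gridp_le t n i i.+1 t0 (leqnSn i)) (aM i) (IM i) (@measurable_id _ _ _) I1.
  have -> : (fun w => rmax (sgnW b t n w) i * (sgnW b t n w i.+1 - sgnW b t n w i)) =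
     (fun w => b * (rmax (sgnW b t n w) i * id (W (gridp t n i.+1) w - W (gridp t n i) w))).
    by apply/funext => w; rewrite /sgnW /=; ring.
  split; first exact: IntgZ.
  rewrite ExZ // E; have -> : Ex P (fun w => id (W (gridp t n i.+1) w - W (gridp t n i) w)) = 0 := E1.
  by rewrite !mulr0.
split=> //.
have I4 : Intg P (fun w => 4 * sgnW b t n w n.+1 ^+ 2) by exact: IntgZ.
have Isum : Intg P (fun w => \sum_(i < n.+1) rmax (sgnW b t n w) i * (sgnW b t n w i.+1 - sgnW b t n w i)).
  apply: (Intg_sum P n.+1 (fun i w => rmax (sgnW b t n w) i * (sgnW b t n w i.+1 - sgnW b t n w i))).
  by move=> i _; case: (term i).
have I4s := IntgZ P 4 _ Isum.
have IR := IntgB P _ _ I4 I4s.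
apply: (le_trans (Ex_le P _ _ (IM2 n.+1) IR _)).
  by move=> w; apply: doob_pathwise; rewrite /sgnW gridp0 W0 mulr0.
rewrite ExB // !ExZ //.
rewrite (Ex_sum P n.+1 (fun i w => rmax (sgnW b t n w) i * (sgnW b t n w i.+1 - sgnW b t n w i))); last first.
  by move=> i _; case: (term i).
rewrite big1; last by move=> i _; case: (term i).
have -> : (fun w => sgnW b t n w n.+1 ^+ 2) = (fun w => W t w ^+ 2).
  by apply/funext => w; rewrite /sgnW exprMn b1 mul1r gridp_last.
by have [_ ->] := W_sqr t t0; rewrite mulr0 subr0.
Qed.

Lemma gridp_approx t n u : 0 < t -> 0 <= u -> u <= t ->
  exists2 i, (i <= n.+1)%N & `|gridp t n i - u| <= t / n.+1%:R.
Proof.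
move=> t0 u0 ut; have np : 0 < n.+1%:R :> R by rewrite ltr0n.
pose x := u * n.+1%:R / t.
have x0' : 0 <= x by rewrite divr_ge0 ?mulr_ge0 // ltW.
have xn : x <= n.+1%:R by rewrite ler_pdivrMr // mulrC ler_pM2l.
pose i := Num.truncn x.
have [i1 i2] := andP (truncn_itv x0').
exists i.
  by rewrite -(ler_nat R) (le_trans i1).
have -> : gridp t n i - u = (i%:R - x) * (t / n.+1%:R).
  rewrite /gridp /x; move: (n.+1%:R) np => N np.
  by field; rewrite !gt_eqF.
rewrite normrM (@gtr0_norm _ (t / _)) ?divr_gt0 // ler_piMl ?divr_ge0 ?(ltW t0) //.
by rewrite ler_norml; apply/andP; split; move: i1 i2; rewrite -/i -?natr1; lra.
Qed.

(** The grids are not nested, so the maxima need not be monotone in n. Their lower limit is used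
    instead: Fatou keeps the bound 8 t on the mean, and continuity makes it dominate every W_u^2. *)
Lemma sup_bound t : 0 < t -> exists S : T -> R,
  [/\ Intg P S, forall w, 0 <= S w & forall w u, 0 <= u <= t -> W u w ^+ 2 <= S w].
Proof.
move=> t0; have W0 : forall w, W 0 w = 0 by case: BM.
have t0' := ltW t0.
pose f n w := rmax (sgnW 1 t n w) n.+1 ^+ 2 + rmax (sgnW (-1) t n w) n.+1 ^+ 2.
have b1 : (1 : R) ^+ 2 = 1 by rewrite expr1n.
have b2 : (-1 : R) ^+ 2 = 1 by rewrite sqrrN expr1n.
have f0 n w : 0 <= f n w by rewrite addr_ge0 ?sqr_ge0.
have If n : Intg P (f n).
  by have [_ ? _] := doob_grid 1 t n b1 t0'; have [_ ? _] := doob_grid (-1) t n b2 t0'; exact: IntgD.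
have Ef n : Ex P (f n) <= 8 * t.
  have [_ I1 E1] := doob_grid 1 t n b1 t0'; have [_ I2 E2] := doob_grid (-1) t n b2 t0'.
  by rewrite /f ExD //; lra.
have fW n w i : (i <= n.+1)%N -> W (gridp t n i) w ^+ 2 <= f n w.
  case: i => [_|i iN]; first by rewrite gridp0 W0 expr0n.
  have m1 : W (gridp t n i.+1) w <= rmax (sgnW 1 t n w) n.+1.
    by have := @rmax_ub _ (sgnW 1 t n w) n.+1 i.+1 iN; rewrite /sgnW mul1r.
  have m2 : - W (gridp t n i.+1) w <= rmax (sgnW (-1) t n w) n.+1.
    by have := @rmax_ub _ (sgnW (-1) t n w) n.+1 i.+1 iN; rewrite /sgnW mulN1r.
  rewrite /f; have p1 := rmax_ge0 (sgnW 1 t n w) n.+1; have p2 := rmax_ge0 (sgnW (-1) t n w) n.+1.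
  have q1 := sqr_ge0 (rmax (sgnW 1 t n w) n.+1); have q2 := sqr_ge0 (rmax (sgnW (-1) t n w) n.+1).
  have [wp|wn] := leP 0 (W (gridp t n i.+1) w).
    by apply: ler_wpDr => //; rewrite lerXn2r // nnegrE.
  by apply: ler_wpDl => //; rewrite -sqrrN lerXn2r // nnegrE oppr_ge0 ltW.
have fB w : exists B, forall n, f n w <= B.
  have [B HB] := pcont_bounded _ t t0' (W_pcont w).
  have rB b n : b ^+ 2 = 1 -> rmax (sgnW b t n w) n.+1 <= B.
    move=> bb; have B0 : 0 <= B by have := HB 0; rewrite lexx t0' => /(_ isT); apply: le_trans.
    have nb : `|b| = 1.
      by apply/eqP; rewrite -(@eqrXn2 _ 2) // ?normr_ge0 // expr1n -normrX bb normr1.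
    suff H j : (j <= n.+1)%N -> rmax (sgnW b t n w) j <= B by exact: H.
    elim: j => [//|j IH jn] /=; rewrite ge_max IH ?(ltnW jn) //=.
    apply: (le_trans (ler_norm _)); rewrite /sgnW normrM nb mul1r; apply: HB.
    by rewrite gridp_ge0 //= -[leRHS](gridp_last t n) gridp_le.
  exists (B ^+ 2 + B ^+ 2) => n; rewrite /f.
  have B0 : 0 <= B by have := HB 0; rewrite lexx t0' => /(_ isT); apply: le_trans.
  by apply: lerD; rewrite lerXn2r ?nnegrE ?rmax_ge0 // rB.
(* Defined in the extended reals; it is finite on every path because each path is bounded on
   [0, t]. *)
pose Se w : \bar R := limn_einf (fun n => (f n w)%:E).
have mf n : measurable_fun setT (fun w => (f n w)%:E).
  by apply/measurable_EFinP; exact: Intg_measurable (If n).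
have f0e n w : setT w -> (0 <= (f n w)%:E)%E by move=> _; rewrite lee_fin.
have einfs_le w n : (einfs (fun n => (f n w)%:E) n <= Se w)%E.
  rewrite /Se limn_einf_lim (cvg_lim _ (@cvg_einfs_sup _ _)) //.
  by apply: ereal_sup_ubound; exists n.
have Se0 w : (0 <= Se w)%E.
  apply: le_trans (einfs_le w 0%N); apply: le_ereal_inf_tmp => _ [n _ <-].
  by rewrite lee_fin.
have Sefin w : Se w \is a fin_num.
  rewrite ge0_fin_numE //; have [B HB] := fB w.
  apply: (@le_lt_trans _ _ B%:E); last exact: ltry.
  rewrite /Se limn_einf_lim; apply: lime_le; first exact: is_cvg_einfs.
  apply: nearW => n; apply: ereal_inf_le; exists (f n w)%:E; last by rewrite lee_fin.
  by exists n => /=.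
have SeW w u : 0 <= u <= t -> ((W u w ^+ 2)%:E <= Se w)%E.
  move=> /andP[u0 ut]; apply/lee_addgt0Pr => e e0.
  have [B HB] := pcont_bounded _ t t0' (W_pcont w).
  have B0 : 0 <= B by have := HB 0; rewrite lexx t0' => /(_ isT); apply: le_trans.
  have eB : 0 < e / (2 * B + 1) by rewrite divr_gt0 // ltr_wpDl // mulr_ge0.
  have [eta eta0 H] := W_pcont w u _ u0 eB.
  have [N HN] : exists N, forall n, (N <= n)%N -> t / n.+1%:R < eta.
    exists (Num.truncn (t / eta)) => n Nn.
    rewrite ltr_pdivrMr ?ltr0n // mulrC -ltr_pdivrMr //.
    have [_ i2] := andP (truncn_itv (ltW (divr_gt0 t0 eta0))).
    by apply: (lt_le_trans i2); rewrite ler_nat.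
  apply: (@le_trans _ _ (einfs (fun n => (f n w)%:E) N + e%:E)%E); last by rewrite leeD2r.
  rewrite -leeBlDr //; apply: le_ereal_inf_tmp => _ [n /= Nn <-].
  rewrite -EFinB lee_fin.
  have [i iN ig] := gridp_approx t n u t0 u0 ut.
  have gi0 := gridp_ge0 t n i t0'.
  have git : gridp t n i <= t by rewrite -[leRHS](gridp_last t n) gridp_le.
  have := H _ gi0 (le_lt_trans ig (HN n Nn)).
  rewrite ltr_pdivlMr ?ltr_wpDl ?mulr_ge0 // => h.
  rewrite (le_trans _ (fW n w i iN)) // lerBlDr -lerBlDl.
  have b1' := HB u; rewrite u0 ut in b1'; have {}b1' := b1' isT.
  have b2' := HB (gridp t n i); rewrite gi0 git in b2'; have {}b2' := b2' isT.
  set x := W u w in h b1' *; set y := W (gridp t n i) w in h b2' *.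
  have -> : x ^+ 2 - y ^+ 2 = (x - y) * (x + y) by ring.
  apply: (le_trans (ler_norm _)); rewrite normrM distrC.
  apply: le_trans (ltW h); apply: ler_wpM2l => //.
  by apply: (le_trans (ler_normD _ _)); lra.
have mSe : measurable_fun setT Se.
  apply: (emeasurable_fun_cvg (fun n w => einfs (fun n => (f n w)%:E) n)) => [n|w _].
    by apply: (@measurable_fun_einfs _ _ _ setT (fun n w => (f n w)%:E)).
  by rewrite /Se limn_einf_lim; exact: is_cvg_einfs.
have ISe : (\int[P]_w Se w < +oo)%E.
  apply: (@le_lt_trans _ _ (8 * t)%:E); last exact: ltry.
  apply: (le_trans (@fatou _ _ _ P setT measurableT (fun n w => (f n w)%:E) mf f0e)).
  rewrite limn_einf_lim; apply: lime_le; first exact: is_cvg_einfs.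
  apply: nearW => n; apply: ereal_inf_le; exists (\int[P]_w (f n w)%:E)%E.
    by exists n => /=.
  by rewrite ExEFin // lee_fin.
exists (fun w => fine (Se w)); split.
- apply: Intg_ge0_lty.
  + by apply: measurableT_comp mSe; exact: fine_measurable.
  + by move=> w; rewrite fine_ge0.
  + by under eq_integral do rewrite fineK //.
- by move=> w; rewrite fine_ge0.
- by move=> w u ut; rewrite -lee_fin fineK // SeW.
Qed.

End Doob.

(** * From time steps to long horizons *)

Section RiemannSums.
Context {R : realType}.
Local Notation leb := (@lebesgue_measure R).

Lemma Rintegral_near_cst (g : R -> R) (u v k B : R) : u <= v ->
  leb.-integrable `]u, v]%classic (EFin \o g) ->
  (forall s, u < s -> s <= v -> `|g s - k| <= B) ->
  `|\int[leb]_(s in `]u, v]%classic) g s - k * (v - u)| <= B * (v - u).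
Proof.
move=> uv ig gB.
have mI : measurable (`]u, v]%classic : set R) by exact: measurable_itv.
have cstE c : \int[leb]_(s in `]u, v]%classic) c = c * (v - u).
  have ms : leb (`]u, v]%classic : set R) = (v - u)%:E.
    rewrite lebesgue_measure_itv /= lte_fin; case: ltgtP uv => //= -> _.
    by rewrite subrr.
  by rewrite Rintegral_cst //; congr (_ * _); rewrite -[RHS]/(fine (v - u)%:E) -ms.
have cI c : leb.-integrable `]u, v]%classic (EFin \o (fun=> c)).
  apply: measurable_bounded_integrable => //.
    by rewrite /= lebesgue_measure_itv /=; case: ifP => _; rewrite ?ltry.
  by exists `|c|; split; [exact: num_real|move=> x xc y _ /=; exact: ltW].
have lo : (k - B) * (v - u) <= \int[leb]_(s in `]u, v]%classic) g s.
  rewrite -cstE; apply: le_Rintegral => // s /=; rewrite in_itv /= => /andP[us sv].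
  by have := gB s us sv; rewrite ler_norml => /andP[]; lra.
have hi : \int[leb]_(s in `]u, v]%classic) g s <= (k + B) * (v - u).
  rewrite -cstE; apply: le_Rintegral => // s /=; rewrite in_itv /= => /andP[us sv].
  by have := gB s us sv; rewrite ler_norml => /andP[]; lra.
move: lo hi; move: (\int[leb]_(s in _) g s) => I; clear; rewrite mulrBl mulrDl => lo hi.
by rewrite ler_norml; apply/andP; split; lra.
Qed.

Variables (c f a : R -> R) (L t : R).
Hypotheses (cL : forall x y, `|c y - c x| <= L * `|y - x|) (t0 : 0 < t)
  (pf : pcont f) (amono : forall s s', 0 <= s -> s <= s' -> s' <= t -> a s <= a s')
  (ma : measurable_fun (`[0, t]%classic : set R) a).

Let x s := f s + a s.

Let L0 : 0 <= L.
Proof. by have := cL 0 1; rewrite subr0 normr1 mulr1; apply: le_trans. Qed.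

Lemma path_integrable : leb.-integrable `[0, t]%classic (EFin \o (fun s => c (x s))).
Proof.
have [B HB] := pcont_bounded f t (ltW t0) pf.
apply: measurable_bounded_integrable => //.
- by rewrite /= lebesgue_measure_itv /=; case: ifP => _; rewrite ?ltry.
- apply: measurableT_comp; first by apply: continuous_measurable_fun; exact: lip_continuous cL.
  apply: measurable_funD => //; apply: subspace_continuous_measurable_fun => //.
  exact: pcont_itv.
exists (`|c 0| + L * (B + (`|a 0| + `|a t|))); split; first exact: num_real.
move=> M MB s /=; rewrite in_itv /= => /andP[s0 st]; apply: le_trans (ltW MB).
have := cL 0 (x s); rewrite subr0 => h.
have := ler_normD (c (x s) - c 0) (c 0); rewrite subrK => /le_trans; apply.
rewrite addrC lerD2l; apply: (le_trans h); apply: ler_wpM2l => //.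
apply: (le_trans (ler_normD _ _)); apply: lerD; first by apply: HB; rewrite s0.
have m1 := amono 0 s (lexx _) s0 st; have m2 := amono s t s0 st (lexx _).
have n1 := ler_norm (a t); have n2 := lerNnormlW (lexx `|a 0|).
have n3 := normr_ge0 (a t); have n4 := normr_ge0 (a 0).
by rewrite ler_norml; apply/andP; split; lra.
Qed.

Definition rsum n := (t / n.+1%:R) * \sum_(i < n.+1) c (x (gridp t n i)).

(** On a cell the integrand differs from its left value by at most L times the oscillation of f plus
    the rise of a. The rises telescope, so all jumps of a together cost a single mesh width. *)
Lemma rsum_error n e : 0 <= e ->
  (forall u v, 0 <= u <= t -> 0 <= v <= t -> `|u - v| <= t / n.+1%:R -> `|f u - f v| <= e) ->
  `|rsum n - \int[leb]_(s in `[0, t]%classic) c (x s)| <=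
  L * (e * t + t / n.+1%:R * (a t - a 0)).
Proof.
move=> e0 He; set dl := t / n.+1%:R.
have dl0 : 0 < dl by rewrite divr_gt0 ?ltr0n.
have ic := path_integrable.
have gt i : (i <= n.+1)%N -> gridp t n i <= t.
  by move=> ii; rewrite -[leRHS](gridp_last t n) gridp_le // ltW.
have g0 i := gridp_ge0 t n i (ltW t0).
have H m : (m <= n.+1)%N ->
  `|dl * (\sum_(i < m) c (x (gridp t n i))) - \int[leb]_(s in `[0, gridp t n m]%classic) c (x s)| <=
  L * (e * gridp t n m + dl * (a (gridp t n m) - a 0)).
  elim: m => [_|m IH mn].
    rewrite big_ord0 mulr0 gridp0 set_itv1 Rintegral_set1 !subrr normr0.
    by rewrite !mulr0 addr0 mulr0.
  have {}IH := IH (ltnW mn).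
  set u := gridp t n m in IH *; set v := gridp t n m.+1.
  have vu : v - u = dl by rewrite gridpS.
  have uv : u <= v by lra.
  have vt : v <= t := gt _ mn; have u0 : 0 <= u := g0 m.
  have icv : leb.-integrable `[0, v]%classic (EFin \o (fun s => c (x s))).
    apply: integrableS ic => //; move=> s /=; rewrite !in_itv /= => /andP[-> sv] /=.
    exact: le_trans vt.
  have icu : leb.-integrable `]u, v]%classic (EFin \o (fun s => c (x s))).
    apply: integrableS ic => //; move=> s /=; rewrite !in_itv /= => /andP[us sv] /=.
    by rewrite (le_trans sv vt) andbT (le_trans u0) // ltW.
  have split : \int[leb]_(s in `[0, v]%classic) c (x s) =
     \int[leb]_(s in `[0, u]%classic) c (x s) + \int[leb]_(s in `]u, v]%classic) c (x s).
    by rewrite -(@Rintegral_itvB R (fun s => c (x s)) (BLeft 0) (BRight v) u icv)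
      ?bnd_simp // addrC subrK.
  have step : `|\int[leb]_(s in `]u, v]%classic) c (x s) - c (x u) * (v - u)| <=
     (L * (e + (a v - a u))) * (v - u).
    apply: Rintegral_near_cst => // s us sv.
    apply: (le_trans (cL _ _)); apply: ler_wpM2l => //.
    have st := le_trans sv vt; have s0 := le_trans u0 (ltW us).
    have m1 := amono u s u0 (ltW us) st; have m2 := amono s v s0 sv vt.
    have -> : x s - x u = (f s - f u) + (a s - a u) by rewrite /x; ring.
    apply: (le_trans (ler_normD _ _)); apply: lerD.
      apply: He; rewrite ?s0 ?u0 //= ?(le_trans uv vt) //.
      by rewrite -/dl -vu (@ger0_norm _ (s - u)) ?subr_ge0 ?(ltW us) // lerD2r.
    by rewrite ger0_norm ?subr_ge0 //; lra.
  rewrite split big_ord_recr /= -/u mulrDr.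
  have -> : dl * (\sum_(i < m) c (x (gridp t n i))) + dl * c (x u) -
     (\int[leb]_(s in `[0, u]%classic) c (x s) + \int[leb]_(s in `]u, v]%classic) c (x s)) =
     (dl * (\sum_(i < m) c (x (gridp t n i))) - \int[leb]_(s in `[0, u]%classic) c (x s)) -
     (\int[leb]_(s in `]u, v]%classic) c (x s) - c (x u) * (v - u)).
    by rewrite vu; ring.
  apply: (le_trans (ler_normB _ _)); apply: (le_trans (lerD IH step)); rewrite vu.
  have -> : v = u + dl by lra.
  by rewrite le_eqVlt; apply/orP; left; apply/eqP; ring.
by have := H n.+1 (leqnn _); rewrite gridp_last.
Qed.

Lemma small_step eta : 0 < eta -> exists N, forall n, (N <= n)%N -> t / n.+1%:R < eta.
Proof.
move=> eta0; exists (Num.truncn (t / eta)) => n Nn.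
rewrite ltr_pdivrMr ?ltr0n // mulrC -ltr_pdivrMr //.
have [_ i2] := andP (truncn_itv (ltW (divr_gt0 t0 eta0))).
by apply: (lt_le_trans i2); rewrite ler_nat.
Qed.

Lemma rsum_cvg : rsum n @[n --> \oo] --> \int[leb]_(s in `[0, t]%classic) c (x s).
Proof.
apply/cvgrPdist_le => e e0.
have at0 : 0 <= a t - a 0 by rewrite subr_ge0 amono // ltW.
pose e1 := e / (2 * (L * t + 1)).
have Lt : 0 <= L * t by rewrite mulr_ge0 // ltW.
have e10 : 0 < e1 by rewrite divr_gt0 // mulr_gt0 // ltr_wpDl.
have [eta eta0 H] := pcont_unif f t e1 pf e10.
pose e2 := e / (2 * (L * (a t - a 0) + 1)).
have La : 0 <= L * (a t - a 0) by rewrite mulr_ge0.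
have e20 : 0 < e2 by rewrite divr_gt0 // mulr_gt0 // ltr_wpDl.
have [N1 HN1] := small_step eta eta0; have [N2 HN2] := small_step e2 e20.
exists (maxn N1 N2) => // n /=; rewrite geq_max => /andP[n1 n2].
rewrite distrC; apply: (le_trans (rsum_error n e1 (ltW e10) _)).
  move=> u v ut vt uv; apply/ltW/H => //; apply: (le_lt_trans uv); exact: HN1.
have h2 := HN2 n n2.
have A : L * (e1 * t) <= e / 2.
  have -> : L * (e1 * t) = (e / 2) * (L * t / (L * t + 1)).
    by rewrite /e1; field; rewrite gt_eqF // ltr_wpDl.
  by rewrite ler_piMr ?divr_ge0 ?(ltW e0) // ler_pdivrMr ?ltr_wpDl // mul1r lerDl.
have B : L * (t / n.+1%:R * (a t - a 0)) <= e / 2.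
  apply: (@le_trans _ _ (e2 * (L * (a t - a 0)))).
    by rewrite mulrCA ler_wpM2r // ltW.
  have -> : e2 * (L * (a t - a 0)) = (e / 2) * (L * (a t - a 0) / (L * (a t - a 0) + 1)).
    by rewrite /e2; field; rewrite gt_eqF // ltr_wpDl.
  by rewrite ler_piMr ?divr_ge0 ?(ltW e0) // ler_pdivrMr ?ltr_wpDl // mul1r lerDl.
by rewrite mulrDr [leRHS]splitr; apply: lerD.
Qed.

End RiemannSums.

Section Convergence.
Context {R : realType} {d : measure_display} {T : measurableType d}.
Variable P : probability T R.

Lemma Ex_dominated (f : nat -> T -> R) (g G : T -> R) : (forall n, measurable_fun setT (f n)) ->
  (forall w, f n w @[n --> \oo] --> g w) -> Intg P G -> (forall n w, `|f n w| <= G w) ->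
  Intg P g /\ Ex P (f n) @[n --> \oo] --> Ex P g.
Proof.
move=> mf fg IG fG.
have mg : measurable_fun setT g by apply: (@measurable_fun_cvg _ _ _ setT f) => // w _; exact: fg.
have If n : Intg P (f n) by exact: (Intg_le P _ _ (mf n) IG (fG n)).
have mfn n : measurable_fun setT (EFin \o f n) by apply/measurable_EFinP.
have mge : measurable_fun setT (EFin \o g) by exact/measurable_EFinP.
have cv : {ae P, forall w, setT w -> (EFin \o f n) w @[n --> \oo] --> (EFin \o g) w}.
  by apply: aeW => w _; apply: cvg_EFin; [exact: nearW|exact: fg].
have dm : {ae P, forall w, forall n, setT w -> (`|(EFin \o f n) w| <= (EFin \o G) w)%E}.
  by apply: aeW => w n _ /=; rewrite lee_fin.
have [Ig _ c] := dominated_convergence measurableT mfn mge cv IG dm.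
split; first exact: Ig.
have ExE h : Intg P h -> (\int[P]_w (EFin \o h) w)%E = (Ex P h)%:E by move=> Ih; rewrite -ExEFin.
move: c; rewrite ExE //; under eq_fun do rewrite ExE //.
by move=> /fine_cvg.
Qed.

End Convergence.

Section ControlledProcess.
Context {R : realType} {d : measure_display} {T : measurableType d}.
Variables (P : probability T R) (W : R -> T -> R) (x0 mu sigma : R).
Hypotheses (BM : is_BM P W) (mu0 : 0 < mu) (sigma0 : 0 < sigma).
Local Notation X0 := (X0 x0 mu sigma W).
Local Notation adapted := (adapted P W x0 mu sigma).
Local Notation leb := (@lebesgue_measure R).

Lemma X0_sup_bound t : 0 < t -> exists S : T -> R,
  [/\ Intg P S, forall w, 0 <= S w, forall w u, 0 <= u <= t -> `|X0 u w| <= S w &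
      forall w u, 0 <= u <= t -> X0 u w ^+ 2 <= S w].
Proof.
move=> t0; have [S [IS S0 HS]] := sup_bound P W x0 mu sigma BM sigma0 t t0.
have mup := mu0.
pose B := `|x0| + mu * t; have B0 : 0 <= B by rewrite addr_ge0 // mulr_ge0 // ltW.
(* The extra 1 lets the bound on the square serve for the absolute value too, since |x| <= x^2 +
   1. *)
pose S1 w := (1 + 2 * B ^+ 2) + 2 * sigma ^+ 2 * S w.
have sq w u : 0 <= u <= t -> X0 u w ^+ 2 <= S1 w - 1.
  move=> ut; have := HS w u ut; case/andP: ut => u0 ut; rewrite /S1 /Defs.X0.
  set b := x0 - mu * u; set W' := W u w => h.
  have bB : b ^+ 2 <= B ^+ 2.
    rewrite -[b ^+ 2]real_normK ?num_real // lerXn2r // ?nnegrE ?normr_ge0 //.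
    apply: (le_trans (ler_normB _ _)); rewrite lerD2l ger0_norm; first by rewrite ler_wpM2l // ltW.
    by apply: mulr_ge0 => //; exact: ltW.
  have s2 := sqr_ge0 sigma; have := ler_wpM2l s2 h; have := sqr_ge0 (b - sigma * W'); nra.
exists S1; split.
- by apply: IntgD; [exact: Intg_cst|exact: IntgZ].
- move=> w; rewrite /S1 addr_ge0 //; first by rewrite addr_ge0 // mulr_ge0 ?sqr_ge0.
  by apply: mulr_ge0 => //; apply: mulr_ge0 => //; exact: sqr_ge0.
- move=> w u ut; have := sq w u ut; rewrite -[X0 u w ^+ 2]real_normK ?num_real //.
  by have := sqr_ge0 (`|X0 u w| - 1); set y := `|_|; nra.
- by move=> w u ut; have := sq w u ut; lra.
Qed.

Variables (A : R -> T -> R) (t : R).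
Hypotheses (t0 : 0 < t) (aA : forall s, 0 <= s -> s <= t -> adapted s (A s))
  (Amono : forall w s s', 0 <= s -> s <= s' -> s' <= t -> A s w <= A s' w)
  (A0 : forall w, 0 <= A 0 w) (IA : Intg P (A t)).

Definition ctrl s w := X0 s w + A s w.

Let A_ge0 s w : 0 <= s -> s <= t -> 0 <= A s w.
Proof. by move=> s0 st; apply: (le_trans (A0 w)); exact: Amono. Qed.

Lemma adapted_ctrl s : 0 <= s -> s <= t -> adapted s (ctrl s).
Proof.
by move=> s0 st; apply: measurable_funD; [exact: adapted_X0|exact: aA].
Qed.

Lemma ctrl_measurable s : 0 <= s -> s <= t -> measurable_fun setT (ctrl s).
Proof. by move=> s0 st; apply: adapted_measurable (adapted_ctrl s s0 st). Qed.

(** Clamping the time to [0, t] extends the path to a monotone function on the line. *)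
Lemma A_path_measurable w : measurable_fun (`[0, t]%classic : set R) (A ^~ w).
Proof.
pose cl (s : R) := Num.min (Num.max s 0) t.
have cl_mono : nondecreasing_fun (fun s => A (cl s) w).
  move=> s s' ss'; apply: Amono.
  - by rewrite /cl le_min le_max lexx orbT ltW.
  - by rewrite /cl le_min2 // le_max2.
  - by rewrite /cl ge_min lexx orbT.
apply: (@eq_measurable_fun _ _ _ _ _ (fun s => A (cl s) w)).
  move=> s; rewrite inE /= in_itv /= => /andP[s0 st].
  by rewrite /cl max_l // min_l.
exact: nondecreasing_measurable.
Qed.

Section RunningCost.
Variables (c : R -> R) (L : R).
Hypothesis (cL : forall x y, `|c y - c x| <= L * `|y - x|).

Definition runcost w := \int[leb]_(s in `[0, t]%classic) c (ctrl s w).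

(** Dominated convergence of Riemann sums under the running bound of X0 plus the total ordered.
    Measurability of [runcost] in w is obtained from the same limit. *)
Lemma runcost_mean : [/\ Intg P runcost,
   forall n, Intg P (fun w => rsum c (X0 ^~ w) (A ^~ w) t n) &
   Ex P (fun w => rsum c (X0 ^~ w) (A ^~ w) t n) @[n --> \oo] --> Ex P runcost].
Proof.
have [S [IS S0 HS _]] := X0_sup_bound t t0.
have L0 : 0 <= L by have := cL 0 1; rewrite subr0 normr1 mulr1; apply: le_trans.
pose G w := t * (`|c 0| + L * (S w + A t w)).
have IG : Intg P G.
  apply: IntgZ; apply: IntgD; first exact: Intg_cst.
  by apply: IntgZ; exact: IntgD.
have mc : measurable_fun setT c by apply: continuous_measurable_fun; exact: lip_continuous cL.
have gt n i : (i <= n.+1)%N -> gridp t n i <= t.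
  by move=> ii; rewrite -[leRHS](gridp_last t n) gridp_le // ltW.
have g0 n i : 0 <= gridp t n i := gridp_ge0 t n i (ltW t0).
have mr n : measurable_fun setT (fun w => rsum c (X0 ^~ w) (A ^~ w) t n).
  rewrite /rsum; apply: measurable_funM => //.
  apply: measurable_sum.
  move=> i; apply: measurableT_comp => //.
  by apply: (ctrl_measurable _ (g0 n i)); apply: gt; exact: ltnW.
have dom n w : `|rsum c (X0 ^~ w) (A ^~ w) t n| <= G w.
  rewrite /rsum normrM ger0_norm ?divr_ge0 ?(ltW t0) //.
  have -> : G w = (t / n.+1%:R) * \sum_(i < n.+1) (`|c 0| + L * (S w + A t w)).
    rewrite sumr_const card_ord /G -[X in _ = _ * X]mulr_natr.
    by have nn : n.+1%:R != 0 :> R by []; move: (n.+1%:R : R) nn => m nn; field.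
  rewrite ler_wpM2l ?divr_ge0 ?(ltW t0) //.
  apply: (le_trans (ler_norm_sum _ _ _)); apply: ler_sum => i _.
  have it := gt n i (ltnW (ltn_ord i)).
  set x := X0 _ _ + A _ _.
  have := cL 0 x; rewrite subr0 => h.
  have := ler_normD (c x - c 0) (c 0); rewrite subrK => /le_trans; apply.
  rewrite addrC lerD2l; apply: (le_trans h); apply: ler_wpM2l => //.
  apply: (le_trans (ler_normD _ _)); apply: lerD; first by apply: HS; rewrite g0.
  by rewrite ger0_norm ?A_ge0 //; exact: Amono.
have cv w : rsum c (X0 ^~ w) (A ^~ w) t n @[n --> \oo] --> runcost w.
  apply: (rsum_cvg c (X0 ^~ w) (A ^~ w) L) => //.
  - exact: X0_pcont BM w.
  - by move=> s s' *; exact: Amono.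
  - exact: A_path_measurable.
have [I E] := Ex_dominated P _ runcost G mr cv IG dom.
by split=> // n; exact: Intg_le IG (dom n).
Qed.

End RunningCost.

Section Drift.
Variables (V v q : R -> R) (L Q : R).
Hypotheses (dV : forall x : R, is_derive x (1 : R) V (v x)) (vq : qapprox L v q)
  (qQ : forall x, `|q x| <= Q)
  (IV : forall s, 0 <= s -> s <= t -> Intg P (fun w => V (ctrl s w)))
  (Iv : forall s, 0 <= s -> s <= t -> Intg P (fun w => v (ctrl s w))).

(** Change of V over a cell before the orders of the cell are added; these are accounted for
    apart. *)
Definition dstep n i w :=
  V (ctrl (gridp t n i) w + (X0 (gridp t n i.+1) w - X0 (gridp t n i) w)) - V (ctrl (gridp t n i) w).

Definition dsum n w := \sum_(i < n.+1) dstep n i w.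

Definition gsum n w :=
  (t / n.+1%:R) * \sum_(i < n.+1) (sigma ^+ 2 / 2 * q (ctrl (gridp t n i) w) - mu * v (ctrl (gridp t n i) w)).

(** n + 1 errors of size (t / (n + 1))^(3/2) add up to t times the square root of the mesh. The
    condition on n says that the mesh is at most 1. *)
Lemma drift_sum : exists2 K, 0 <= K & forall n, t <= n.+1%:R ->
  [/\ Intg P (dsum n), Intg P (gsum n) &
      `|Ex P (dsum n) - Ex P (gsum n)| <= K * Num.sqrt (t / n.+1%:R)].
Proof.
have L0 := qapprox_ge0 _ _ _ vq.
have Q0 : 0 <= Q by apply: le_trans (qQ 0).
have sc0 : 0 <= step_const mu sigma L Q.
  have mup := mu0; have sp := sigma0.
  apply: addr_ge0; first by apply: divr_ge0 => //; apply: mulr_ge0 => //; exact: sqr_ge0.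
  by apply: mulr_ge0 => //; apply: addr_ge0; apply: mulr_ge0 => //; apply: exprn_ge0; exact: ltW.
have mq : measurable_fun setT q.
  apply: continuous_measurable_fun; exact: lip_continuous (qapprox_lip _ _ _ vq).
have gt n i : (i <= n.+1)%N -> gridp t n i <= t.
  by move=> ii; rewrite -[leRHS](gridp_last t n) gridp_le // ltW.
have g0 n i : 0 <= gridp t n i := gridp_ge0 t n i (ltW t0).
exists (step_const mu sigma L Q * t); first by apply: mulr_ge0 => //; exact: ltW.
move=> n tn; set r := Num.sqrt (t / n.+1%:R).
have dl0 : 0 < t / n.+1%:R by rewrite divr_gt0 ?ltr0n.
have r0 : 0 < r by rewrite sqrtr_gt0.
have dr : t / n.+1%:R = r ^+ 2 by rewrite sqr_sqrtr // ltW.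
have r1 : r <= 1.
  by rewrite -(@expr_le1 _ 2) ?(ltW r0) // -dr ler_pdivrMr ?ltr0n // mul1r.
pose gen i w := sigma ^+ 2 / 2 * q (ctrl (gridp t n i) w) - mu * v (ctrl (gridp t n i) w).
pose F i w := V (ctrl (gridp t n i) w + (X0 (gridp t n i.+1) w - X0 (gridp t n i) w)).
have step i : (i < n.+1)%N ->
   [/\ Intg P (F i), Intg P (gen i) &
   `|Ex P (F i) - Ex P (fun w => V (ctrl (gridp t n i) w)) - r ^+ 2 * Ex P (gen i)|
   <= step_const mu sigma L Q * r ^+ 3].
  move=> iN; have it := gt n i (ltnW iN).
  apply: (@one_step _ _ _ P W x0 mu sigma BM mu0 sigma0 L Q V v q (ctrl (gridp t n i))) => //.
  - by rewrite gridpS.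
  - exact: adapted_ctrl.
  - exact: IV.
  - exact: Iv.
have IVi i : (i < n.+1)%N -> Intg P (fun w => V (ctrl (gridp t n i) w)).
  by move=> iN; apply: IV => //; apply: gt; exact: ltnW.
have Id i : (i < n.+1)%N -> Intg P (dstep n i).
  by move=> iN; have [I1 _ _] := step i iN; apply: IntgB => //; exact: IVi.
have Ig i : (i < n.+1)%N -> Intg P (gen i) by move=> iN; case: (step i iN).
have Ids : Intg P (dsum n) by exact: (Intg_sum P n.+1 (dstep n)).
have Igs' : Intg P (fun w => \sum_(i < n.+1) gen i w) by exact: Intg_sum.
have Igs : Intg P (gsum n) by exact: (IntgZ P _ _ Igs').
split=> //.
have -> : Ex P (dsum n) = \sum_(i < n.+1) Ex P (dstep n i) by exact: Ex_sum.
have -> : Ex P (gsum n) = \sum_(i < n.+1) (r ^+ 2 * Ex P (gen i)).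
  by rewrite /gsum (ExZ P _ _ Igs') (Ex_sum P n.+1 gen Ig) dr mulr_sumr.
rewrite -sumrB; apply: (le_trans (ler_norm_sum _ _ _)).
apply: (@le_trans _ _ (\sum_(i < n.+1) step_const mu sigma L Q * r ^+ 3)).
  apply: ler_sum => i _; have [I1 I2] := step i (ltn_ord i).
  by rewrite /dstep (ExB P _ _ I1 (IVi i (ltn_ord i))).
rewrite sumr_const card_ord -mulr_natr.
have -> : t = r ^+ 2 * n.+1%:R by rewrite -dr divfK // pnatr_eq0.
by move: (n.+1%:R : R) => m; rewrite le_eqVlt; apply/orP; left; apply/eqP; ring.
Qed.

End Drift.
End ControlledProcess.

Section MeshLimit.
Context {R : realType}.

Lemma mesh_limit (t K a : R) (e : nat -> R) (l : R) : 0 < t -> 0 <= K -> e n @[n --> \oo] --> l ->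
  (forall n, t <= n.+1%:R -> a <= e n + K * Num.sqrt (t / n.+1%:R)) -> a <= l.
Proof.
move=> t0 K0 el H; apply/ler_addgt0Pr => x xp.
have x4 : 0 < x / 2 by rewrite divr_gt0.
move/cvgrPdist_le/(_ _ x4) : el => [N1 _ HN1].
pose h := x / 2 / (K + 1); have h0 : 0 < h by rewrite divr_gt0 // ltr_wpDl.
have h20 : 0 < h ^+ 2 by rewrite exprn_gt0.
have [N2 HN2] := small_step t t0 _ h20.
have [N3 HN3] := small_step t t0 1 ltr01.
pose n := maxn N1 (maxn N2 N3).
have n1 : (N1 <= n)%N by rewrite leq_maxl.
have n2 : (N2 <= n)%N by rewrite /n maxnCA leq_maxl.
have n3 : (N3 <= n)%N by rewrite /n maxnA leq_maxr.
have tn : t <= n.+1%:R.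
  by have := HN3 n n3; rewrite ltr_pdivrMr ?ltr0n // mul1r => /ltW.
have A := H n tn; have B := HN1 n n1.
have Bl : `|l - e n| <= x / 2 by [].
have sq : Num.sqrt (t / n.+1%:R) <= h.
  rewrite -[leRHS](@ger0_norm _ h) ?(ltW h0) // -sqrtr_sqr ler_wsqrtr //; apply/ltW; exact: HN2.
have Kh : K * Num.sqrt (t / n.+1%:R) <= x / 2.
  apply: (le_trans (ler_wpM2l K0 sq)).
  have -> : K * h = (x / 2) * (K / (K + 1)) by rewrite /h; field; rewrite gt_eqF // ltr_wpDl.
  by rewrite ler_piMr ?(ltW x4) // ler_pdivrMr ?ltr_wpDl // mul1r lerDl.
move: Bl A Kh; rewrite ler_norml; move: (K * _) (e n) => u v; clear => /andP[]; lra.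
Qed.

End MeshLimit.

Section DriftBound.
Context {R : realType} {d : measure_display} {T : measurableType d}.
Variables (P : probability T R) (W : R -> T -> R) (x0 mu sigma : R).
Hypotheses (BM : is_BM P W) (mu0 : 0 < mu) (sigma0 : 0 < sigma).
Local Notation X0 := (X0 x0 mu sigma W).
Local Notation adapted := (adapted P W x0 mu sigma).
Variables (A : R -> T -> R) (t : R).
Hypotheses (t0 : 0 < t) (aA : forall s, 0 <= s -> s <= t -> adapted s (A s))
  (Amono : forall w s s', 0 <= s -> s <= s' -> s' <= t -> A s w <= A s' w)
  (A0 : forall w, 0 <= A 0 w) (IA : Intg P (A t)).
Local Notation ctrl := (ctrl W x0 mu sigma A).
Variables (c : R -> R) (Lc : R).
Hypothesis (cL : forall x y, `|c y - c x| <= Lc * `|y - x|).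
Local Notation runcost := (runcost W x0 mu sigma A t c).
Variables (V v q : R -> R) (L Q m C : R).
Hypotheses (dV : forall x : R, is_derive x (1 : R) V (v x)) (vq : qapprox L v q)
  (qQ : forall x, `|q x| <= Q)
  (IV : forall s, 0 <= s -> s <= t -> Intg P (fun w => V (ctrl s w)))
  (Iv : forall s, 0 <= s -> s <= t -> Intg P (fun w => v (ctrl s w))).

(** Pathwise, discretized generator and running cost add up to at least m t, and the uncontrolled
    changes of V to at most C - V x0 + K t by telescoping, as K pays for the jumps. [drift_sum]
    compares the means of the two sums, then the mesh tends to 0. *)
Lemma drift_lower_bound (K : R -> T -> R) :
  (forall x, m <= sigma ^+ 2 / 2 * q x - mu * v x + c x) -> (forall x, V x <= C) ->
  Intg P (K t) ->
  (forall w x s s', 0 <= s -> s <= s' -> s' <= t -> V x - V (x + (A s' w - A s w)) <= K s' w - K s w) ->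
  (forall w x, V x - V (x + A 0 w) <= K 0 w) ->
  m * t <= Ex P runcost + Ex P (K t) + C - V x0.
Proof.
move=> gen VC IK HK HK0; have W0 : forall w, W 0 w = 0 by case: BM.
have [Irun Ir cr] := runcost_mean P W x0 mu sigma BM mu0 sigma0 A t t0 aA Amono A0 IA c Lc cL.
have [E E0 HE] := drift_sum P W x0 mu sigma BM mu0 sigma0 A t t0 aA V v q L Q dV vq qQ IV Iv.
have gt n i : (i <= n.+1)%N -> gridp t n i <= t.
  by move=> ii; rewrite -[leRHS](gridp_last t n) gridp_le // ltW.
have g0 n i : 0 <= gridp t n i := gridp_ge0 t n i (ltW t0).
pose er n := Ex P (fun w => rsum c (X0 ^~ w) (A ^~ w) t n).
have crD : er n + (Ex P (K t) + C - V x0) @[n --> \oo] --> Ex P runcost + (Ex P (K t) + C - V x0).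
  by apply: cvgD => //; exact: cvg_cst.
rewrite -2!addrA [leRHS](_ : _ = Ex P runcost + (Ex P (K t) + C - V x0)); last by rewrite !addrA.
apply: (mesh_limit t E (m * t) _ _ t0 E0 crD) => n tn.
have [Id Ig HD] := HE n tn.
have lo w : m * t <= gsum W x0 mu sigma A t v q n w + rsum c (X0 ^~ w) (A ^~ w) t n.
  rewrite /gsum /rsum -mulrDr -big_split /=.
  have nn : n.+1%:R != 0 :> R by rewrite pnatr_eq0.
  have -> : m * t = (t / n.+1%:R) * \sum_(i < n.+1) m.
    rewrite sumr_const card_ord -[X in _ = _ * X]mulr_natr.
    by move: (n.+1%:R : R) nn => k kk; field.
  rewrite ler_wpM2l ?divr_ge0 ?(ltW t0) //; apply: ler_sum => i _; exact: gen.
have hi w : dsum W x0 mu sigma A t V n w <= C - V x0 + K t w.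
  suff H j : (j <= n.+1)%N -> \sum_(i < j) dstep W x0 mu sigma A t V n i w <=
      V (ctrl (gridp t n j) w) - V x0 + K (gridp t n j) w.
    have := H n.+1 (leqnn _); rewrite gridp_last => /le_trans; apply.
    by rewrite lerD2r lerD2r.
  elim: j => [_|j IH jn].
    rewrite big_ord0 gridp0; have := HK0 w x0.
    have -> : ctrl 0 w = x0 + A 0 w by rewrite /ctrl /Defs.X0 W0 !mulr0 subr0 addr0.
    lra.
  rewrite big_ord_recr /=; have := IH (ltnW jn).
  have := HK w (ctrl (gridp t n j) w + (X0 (gridp t n j.+1) w - X0 (gridp t n j) w))
     _ _ (g0 n j) (gridp_le t n j j.+1 (ltW t0) (leqnSn j)) (gt n _ jn).
  have -> : ctrl (gridp t n j) w + (X0 (gridp t n j.+1) w - X0 (gridp t n j) w) +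
     (A (gridp t n j.+1) w - A (gridp t n j) w) = ctrl (gridp t n j.+1) w by rewrite /ctrl; ring.
  by rewrite /dstep; lra.
have h1 : m * t <= Ex P (gsum W x0 mu sigma A t v q n) + er n.
  rewrite -(Ex_cst P (m * t)) /er -ExD //; apply: Ex_le => //; first exact: Intg_cst.
  exact: IntgD.
have h2 : Ex P (dsum W x0 mu sigma A t V n) <= C - V x0 + Ex P (K t).
  rewrite -(Ex_cst P (C - V x0)) -ExD //; last exact: Intg_cst.
  by apply: Ex_le => //; apply: IntgD => //; exact: Intg_cst.
move: HD h1 h2; rewrite ler_norml.
by move: (Ex P (dsum _ _ _ _ _ _ _ _)) (Ex P (gsum _ _ _ _ _ _ _ _ _)) (er n) (Ex P (K t)) (E * _) => *; lra.
Qed.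

Definition jsum n w := \sum_(i < n.+1) (V (ctrl (gridp t n i.+1) w) -
  V (ctrl (gridp t n i) w + (X0 (gridp t n i.+1) w - X0 (gridp t n i) w))).

(** Mirror image of the lower bound, except that the jumps must be known exactly: their grid sum is
    kept and passed to its dominated limit J. *)
Lemma drift_upper_bound (J G : T -> R) (C0 : R) :
  (forall x, sigma ^+ 2 / 2 * q x - mu * v x + c x <= m) ->
  (forall w, - C <= V (ctrl t w)) -> (forall w, V (ctrl 0 w) <= C0) ->
  (forall w, jsum n w @[n --> \oo] --> J w) -> Intg P G -> (forall n w, `|jsum n w| <= G w) ->
  Intg P J /\ Ex P runcost <= m * t + C + C0 + Ex P J.
Proof.
move=> gen VC VC0 cJ IG JG.
have [Irun Ir cr] := runcost_mean P W x0 mu sigma BM mu0 sigma0 A t t0 aA Amono A0 IA c Lc cL.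
have [E E0 HE] := drift_sum P W x0 mu sigma BM mu0 sigma0 A t t0 aA V v q L Q dV vq qQ IV Iv.
have gt n i : (i <= n.+1)%N -> gridp t n i <= t.
  by move=> ii; rewrite -[leRHS](gridp_last t n) gridp_le // ltW.
have g0 n i : 0 <= gridp t n i := gridp_ge0 t n i (ltW t0).
have cV : continuous V by move=> x; apply/differentiable_continuous/derivable1_diffP; case: (dV x).
have mV : measurable_fun setT V by exact: continuous_measurable_fun.
have mJ n : measurable_fun setT (jsum n).
  apply: measurable_sum => i.
  have mc1 := ctrl_measurable P W x0 mu sigma BM A t aA _ (g0 n i.+1) (gt n i.+1 (ltn_ord i)).
  have mc0 := ctrl_measurable P W x0 mu sigma BM A t aA _ (g0 n i) (gt n i (ltnW (ltn_ord i))).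
  apply: measurable_funB; apply: measurableT_comp => //; apply: measurable_funD => //.
  by apply: measurable_funB; exact: X0_measurable BM _.
have [IJ cEJ] := Ex_dominated P jsum J G mJ cJ IG JG.
split=> //.
pose er n := Ex P (fun w => rsum c (X0 ^~ w) (A ^~ w) t n).
have crD : Ex P (jsum n) - er n @[n --> \oo] --> Ex P J - Ex P runcost by exact: cvgB.
suff : - (m * t + C + C0) <= Ex P J - Ex P runcost by lra.
apply: (mesh_limit t E _ _ _ t0 E0 crD) => n tn.
have [Id Ig HD] := HE n tn.
have IJn : Intg P (jsum n) by exact: Intg_le IG (JG n).
have lo w : gsum W x0 mu sigma A t v q n w + rsum c (X0 ^~ w) (A ^~ w) t n <= m * t.
  rewrite /gsum /rsum -mulrDr -big_split /=.
  have nn : n.+1%:R != 0 :> R by rewrite pnatr_eq0.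
  have -> : m * t = (t / n.+1%:R) * \sum_(i < n.+1) m.
    rewrite sumr_const card_ord -[X in _ = _ * X]mulr_natr.
    by move: (n.+1%:R : R) nn => k kk; field.
  rewrite ler_wpM2l ?divr_ge0 ?(ltW t0) //; apply: ler_sum => i _; exact: gen.
have hi w : - C - C0 <= dsum W x0 mu sigma A t V n w + jsum n w.
  rewrite /dsum /jsum -big_split /=.
  under eq_bigr do rewrite /dstep addrC addrA subrK.
  rewrite -(big_mkord xpredT (fun i => V (ctrl (gridp t n i.+1) w) - V (ctrl (gridp t n i) w))).
  rewrite telescope_sumr //.
  have := VC w; have := VC0 w; rewrite gridp_last gridp0; lra.
have h1 : Ex P (gsum W x0 mu sigma A t v q n) + er n <= m * t.
  rewrite -(Ex_cst P (m * t)) /er -ExD //; apply: Ex_le => //; last exact: Intg_cst.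
  exact: IntgD.
have h2 : - C - C0 <= Ex P (dsum W x0 mu sigma A t V n) + Ex P (jsum n).
  rewrite -(Ex_cst P (- C - C0)) -ExD //.
  by apply: Ex_le => //; [exact: Intg_cst|exact: IntgD].
move: HD h1 h2; rewrite ler_norml.
by move: (Ex P (dsum _ _ _ _ _ _ _ _)) (Ex P (gsum _ _ _ _ _ _ _ _ _)) (er n) (Ex P (jsum n)) (E * _) => *; lra.
Qed.

End DriftBound.

(** * Lower bound for admissible policies *)

Section Series.
Context {R : realType} {d : measure_display} {T : measurableType d}.

Lemma nneseries_finite (f : nat -> \bar R) K : (forall k, (0 <= f k)%E) ->
  (forall k, (K <= k)%N -> f k = 0%E) -> (\sum_(k <oo) f k = \sum_(k < K) f k)%E.
Proof.
move=> f0 fK; rewrite (@nneseries_split _ f 0 K) // add0n eseries0; last by move=> k *; exact: fK.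
by rewrite adde0 big_mkord.
Qed.

(** For nonnegative functions the integral is a supremum over simple functions below, so inclusion
    of these families is enough. This is how [pathcost] is compared with integrable functions
    without a measurability proof for it. *)
Lemma integral_monotone (P : probability T R) (f g : T -> \bar R) : (forall w, 0 <= f w)%E ->
  (forall w, f w <= g w)%E -> (\int[P]_w f w <= \int[P]_w g w)%E.
Proof.
move=> f0 fg; rewrite !ge0_integralTE //; last by move=> w; exact: le_trans (fg w).
apply: le_ereal_sup => _ [h hf <-]; exists h => // w; exact: le_trans (hf w) (fg w).
Qed.

End Series.

Section OrderCounts.
Context {R : realType} {d : measure_display} {T : measurableType d}.
Variables (tau : nat -> T -> \bar R) (t : R).
Hypothesis taumono : forall k w, (tau k w <= tau k.+1 w)%E.

Definition finorders : set T := [set w | exists k, (t%:E < tau k w)%E].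

(** Some index past t, not the exact number of orders; by monotonicity every later order is past t
    as well. *)
Definition norders w : nat := xget 0%N [set k | (t%:E < tau k w)%E].

Lemma tau_le k k' w : (k <= k')%N -> (tau k w <= tau k' w)%E.
Proof.
by elim: k' => [|k' IH]; [case: k|rewrite leq_eqVlt => /orP[/eqP ->//|/IH]; move=> /le_trans; apply].
Qed.

Lemma nordersP w s k : finorders w -> s <= t -> (norders w <= k)%N -> ((tau k w <= s%:E) = false)%E.
Proof.
move=> [k0 Hk0] st nk; apply/negbTE; rewrite -ltNge.
have H : (t%:E < tau (norders w) w)%E by rewrite /norders; case: xgetP => [j _|/(_ k0)].
by apply: (le_lt_trans _ (lt_le_trans H (tau_le _ _ w nk))); rewrite lee_fin.
Qed.

(** With u = Y the amount ordered up to s, with u = 1 the number of orders. It is set to 0 on paths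
    with infinitely many orders, hence real everywhere. *)
Definition osum (u : nat -> T -> R) (s : R) (w : T) : R :=
  \1_finorders w * \sum_(k < norders w) (if (tau k w <= s%:E)%E then u k w else 0).

Lemma osum_fin (u : nat -> T -> R) s w n : finorders w -> s <= t -> (norders w <= n)%N ->
  osum u s w = \sum_(k < n) (if (tau k w <= s%:E)%E then u k w else 0).
Proof.
move=> gw st Kn; rewrite /osum indicE mem_set // mul1r.
rewrite -(subnKC Kn) big_split_ord /= [X in _ = _ + X]big1 ?addr0 // => k _.
by rewrite nordersP // leq_addr.
Qed.

Lemma osum_bad u s w : ~ finorders w -> osum u s w = 0.
Proof. by move=> gw; rewrite /osum indicE memNset // mul0r. Qed.

Lemma osum_cvg (u : nat -> T -> R) s w : s <= t ->
  \1_finorders w * (\sum_(k < n) (if (tau k w <= s%:E)%E then u k w else 0)) @[n --> \oo] --> osum u s w.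
Proof.
move=> st; apply: cvg_near_cst; exists (norders w) => // n /= nK.
have [gw|gw] := pselect (finorders w).
  by rewrite (osum_fin u s w n) // indicE mem_set // mul1r.
by rewrite osum_bad // indicE memNset // mul0r.
Qed.

Lemma osum_incr (u : nat -> T -> R) s s' w : s <= s' -> s' <= t -> osum u s' w - osum u s w =
  \1_finorders w * \sum_(k < norders w)
    (if (s%:E < tau k w)%E && (tau k w <= s'%:E)%E then u k w else 0).
Proof.
move=> ss' st; rewrite /osum -mulrBr -sumrB; congr (_ * _); apply: eq_bigr => k _.
have [h|h] /= := leP (tau k w) s%:E; last by rewrite subr0.
by rewrite (le_trans h) ?lee_fin // subrr.
Qed.

Lemma osum_mono (u : nat -> T -> R) s s' w : (forall k w, 0 <= u k w) -> s <= s' -> s' <= t -> osum u s w <= osum u s' w.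
Proof.
move=> u0 ss' st; rewrite -subr_ge0 osum_incr //; apply: mulr_ge0; first by rewrite indicE.
by apply: sumr_ge0 => k _; case: ifP.
Qed.

Lemma osum_ge0 (u : nat -> T -> R) s w : (forall k w, 0 <= u k w) -> 0 <= osum u s w.
Proof.
move=> u0; apply: mulr_ge0; first by rewrite indicE.
by apply: sumr_ge0 => k _; case: ifP.
Qed.

(** Allows all orders in (s, s'] to be charged as one: either the amount is unchanged, or at least
    one fixed cost was paid. *)
Lemma osum_jump (u : nat -> T -> R) s s' w : (forall k w, 0 <= u k w) -> s <= s' -> s' <= t ->
  osum u s' w = osum u s w \/ 1 <= osum (fun _ _ => 1) s' w - osum (fun _ _ => 1) s w.
Proof.
move=> u0 ss' st.
have [gw|gw] := pselect (finorders w); last by left; rewrite !osum_bad.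
have [[k [kN kr]]|no] := pselect (exists k, (k < norders w)%N /\
    (s%:E < tau k w)%E && (tau k w <= s'%:E)%E).
  right; rewrite osum_incr // indicE mem_set // mul1r (bigD1 (Ordinal kN)) //= kr lerDl.
  by apply: sumr_ge0 => j _; case: ifP.
left; apply/eqP; rewrite -subr_eq0 osum_incr // big1 ?mulr0 // => k _.
by case: ifP => // kr; exfalso; apply: no; exists k.
Qed.

Lemma ordered_fin (Y : nat -> T -> R) s w : (forall k w, 0 <= Y k w) -> finorders w -> s <= t ->
  ordered tau Y s w = (osum Y s w)%:E.
Proof.
move=> Y0 gw st; rewrite /ordered (@nneseries_finite _ _ (norders w)).
- rewrite (osum_fin Y s w _ gw st (leqnn _)) -sumEFin; apply: eq_bigr => k _.
  by case: ifP.
- by move=> k; case: ifP; rewrite ?lee_fin.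
- by move=> k Kk; rewrite nordersP.
Qed.

End OrderCounts.

Section AdmissiblePolicy.
Context {R : realType} {d : measure_display} {T : measurableType d}.
Variables (P : probability T R) (W : R -> T -> R) (x0 mu sigma cb ch k1 k2 : R).
Hypotheses (BM : is_BM P W) (mu0 : 0 < mu) (sigma0 : 0 < sigma)
  (cb0 : 0 < cb) (ch0 : 0 < ch) (k10 : 0 < k1) (k20 : 0 < k2).
Local Notation X0 := (X0 x0 mu sigma W).
Local Notation filt := (filt P x0 mu sigma W).
Local Notation adapted := (adapted P W x0 mu sigma).
Local Notation leb := (@lebesgue_measure R).
Variables (tau : nat -> T -> \bar R) (Y : nat -> T -> R) (t : R).
Hypotheses (adm : admissible P x0 mu sigma W tau Y) (t0 : 0 < t).
Local Notation good := (finorders tau t).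
Local Notation A := (osum tau t Y).
Local Notation N := (osum tau t (fun _ _ => 1)).
Local Notation pathcost := (pathcost x0 mu sigma cb ch k1 k2 W tau Y t).

Let taumono k w : (tau k w <= tau k.+1 w)%E. Proof. by case: adm. Qed.
Let Y0 k w : 0 <= Y k w. Proof. by case: adm. Qed.

Lemma filt_setC s B : filt s B -> filt s (~` B).
Proof.
move=> FB; rewrite -setTD; have [_ H _] := filt_sigma_algebra P W x0 mu sigma BM s; exact: H.
Qed.

Lemma filt_setU s B C : filt s B -> filt s C -> filt s (B `|` C).
Proof.
move=> FB FC; rewrite -g_filtE // in FB FC *.
exact: (@measurableU _ (g_sigma_algebraType (filt s))).
Qed.

Lemma order_term_adapted s k : 0 <= s ->
  adapted s (fun w => if (tau k w <= s%:E)%E then Y k w else 0).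
Proof.
move=> s0; apply/adaptedP => // B mB.
have [_ st _ Fm] := adm; have [_ H] := Fm k B mB; have [_ St] := st k.
(* After s the term is 0, so the preimage contains the whole event tau_k > s exactly when 0 belongs
   to B. *)
have [B0|nB0] := pselect (B 0).
  rewrite (_ : _ @^-1` B = (Y k @^-1` B `&` [set w | (tau k w <= s%:E)%E]) `|`
      ~` [set w | (tau k w <= s%:E)%E]).
    by apply: filt_setU; [exact: H|apply: filt_setC; exact: St].
  by apply/seteqP; split=> w /=; case: ifP => kw; [left|right|case=> [[]|]|].
rewrite (_ : _ @^-1` B = Y k @^-1` B `&` [set w | (tau k w <= s%:E)%E]); first exact: H.
by apply/seteqP; split=> w /=; case: ifP => kw //; case.
Qed.

Lemma count_term_adapted s k : 0 <= s ->
  adapted s (fun w => if (tau k w <= s%:E)%E then 1 else 0).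
Proof.
move=> s0; have [_ st _ _] := adm; have [_ St] := st k.
rewrite (_ : (fun w => _) = \1_[set w | (tau k w <= s%:E)%E]).
  by apply: measurable_indic; rewrite /measurable /= g_filtE //; exact: St.
by apply/funext => w; rewrite indicE; case: ifP => h; [rewrite mem_set|rewrite memNset //= h].
Qed.

Lemma finorders_filt : filt t good.
Proof.
have [_ st _ _] := adm.
rewrite (_ : good = \bigcup_k ~` [set w | (tau k w <= t%:E)%E]); last first.
  apply/seteqP; split=> w /=.
    by move=> [k kw]; exists k => //=; apply/negP; rewrite -ltNge.
  by move=> [k _ /= /negP]; rewrite -ltNge => kw; exists k.
have [_ _ H] := filt_sigma_algebra P W x0 mu sigma BM t; apply: H => k.
by apply: filt_setC; case: (st k) => _; apply; exact: ltW.
Qed.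

(** Having finitely many orders up to t is a priori an event of time t. As its complement is null,
    the augmentation places it in the filtration at every earlier s. *)
Lemma osum_adapted u s : P (~` good) = 0%E -> 0 <= s -> s <= t ->
  (forall k, adapted s (fun w => if (tau k w <= s%:E)%E then u k w else 0)) ->
  adapted s (osum tau t u s).
Proof.
move=> bad0 s0 st au.
have mg : filt s good.
  rewrite -[good]setCK; apply: filt_setC; apply: filt_null bad0.
  by apply: (@filt_measurable _ _ _ P W x0 mu sigma t); apply: filt_setC; exact: finorders_filt.
apply: (@measurable_fun_cvg _ (g_sigma_algebraType (filt s)) _ setT (fun n w => \1_good w *
    (\sum_(k < n) (if (tau k w <= s%:E)%E then u k w else 0)))); last by move=> w _; exact: osum_cvg.
  move=> n; apply: measurable_funM.
    by apply: measurable_indic; rewrite /measurable /= g_filtE.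
  by apply: measurable_sum => k; exact: au.
Qed.

Lemma pathcost_ge0 w : (0 <= pathcost w)%E.
Proof.
apply: adde_ge0.
  apply: integral_ge0 => s _; case: (Xc _ _ _ _ _ _ _ _) => [r| |] //=.
  by rewrite lee_fin c0_ge0.
apply: nneseries_ge0 => k _ _; case: ifP => // _; apply: adde_ge0; first by rewrite lee_fin ltW.
apply: mule_ge0; first by rewrite lee_fin ltW.
by apply: nneseries_ge0 => j _ _; case: ifP => // _; rewrite lee_fin.
Qed.

Lemma le_jump k w : ((Y k w)%:E <= jump tau Y k w)%E.
Proof.
rewrite /jump; apply: le_trans (nneseries_lim_ge k.+1 _); last first.
  by move=> j _ _; case: ifP => // _; rewrite lee_fin.
rewrite big_mkord big_ord_recr /= eqxx; apply: leeDr => //.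
by apply: sume_ge0 => j _; case: ifP => // _; rewrite lee_fin.
Qed.

Lemma order_cost_ge n w : ((\sum_(k < n) (if (tau k w <= t%:E)%E then k1 + k2 * Y k w else 0))%:E <=
  \sum_(k <oo) (if (tau k w <= t%:E)%E then k1%:E + k2%:E * jump tau Y k w else 0))%E.
Proof.
apply: le_trans (nneseries_lim_ge n _); last first.
  move=> j _ _; case: ifP => // _; apply: adde_ge0; first by rewrite lee_fin ltW.
  apply: mule_ge0; first by rewrite lee_fin ltW.
  by apply: nneseries_ge0 => i _ _; case: ifP => // _; rewrite lee_fin.
rewrite big_mkord -sumEFin; apply: lee_sum => k _; case: ifP => // _.
by rewrite EFinD leeD2l // EFinM lee_pmul2l ?lte_fin // le_jump.
Qed.

Lemma running_cost_fin w : good w ->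
  (\int[leb]_(s in [set s : R | (0 <= s <= t)%R]) c0e cb ch (Xc x0 mu sigma W tau Y s w))%E =
  (runcost W x0 mu sigma A t (c0 cb ch) w)%:E.
Proof.
move=> gw.
have set_itv : [set s : R | (0 <= s <= t)%R] = `[0, t]%classic by apply/seteqP; split=> s /=; rewrite in_itv.
rewrite set_itv /runcost /Rintegral fineK.
  apply: eq_integral => s.
  by rewrite inE /= in_itv /= => /andP[_ st]; rewrite /Xc (ordered_fin tau t taumono Y s w Y0 gw st).
apply: integrable_fin_num => //.
apply: (path_integrable (c0 cb ch) (X0 ^~ w) (A ^~ w) (cb + ch) t) => //.
- by move=> x y; exact: c0_lip.
- exact: X0_pcont BM w.
- by move=> s s' _ ss st; exact: osum_mono.
- by apply: A_path_measurable => // w' s s' _ ss st; exact: osum_mono.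
Qed.

Lemma pathcost_good w : good w ->
  ((runcost W x0 mu sigma A t (c0 cb ch) w + (k1 * N t w + k2 * A t w))%:E <= pathcost w)%E.
Proof.
move=> gw; rewrite /pathcost running_cost_fin // EFinD leeD2l //.
apply: le_trans (order_cost_ge (norders tau t w) w).
rewrite lee_fin !(osum_fin _ _ taumono _ _ _ _ gw (lexx t) (leqnn _)) !mulr_sumr -big_split /=.
by apply: ler_sum => k _; case: ifP; rewrite ?mulr1 // !mulr0 addr0.
Qed.

Lemma pathcost_bad n w : ~ good w -> ((n%:R * k1)%:E <= pathcost w)%E.
Proof.
move=> bw; apply: (@le_trans _ _ (\sum_(k <oo) (if (tau k w <= t%:E)%E then k1%:E + k2%:E * jump tau Y k w else 0))%E).
  apply: le_trans (order_cost_ge n w); rewrite lee_fin mulrC mulr_natr -[n in leLHS]card_ord -sumr_const.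
  apply: ler_sum => k _; rewrite ifT; first by rewrite lerDl mulr_ge0 // ltW.
  by rewrite leNgt; apply/negP => kt; apply: bw; exists k.
apply: leeDr => //; apply: integral_ge0 => s _; case: (Xc _ _ _ _ _ _ _ _) => [r| |] //=.
by rewrite lee_fin c0_ge0.
Qed.

Lemma Intg_indic B : measurable B -> Intg P (\1_B : T -> R).
Proof.
move=> mB; apply: Intg_le (Intg_cst P 1) _; first exact: measurable_indic.
by move=> w; rewrite indicE ger0_norm //; case: (_ \in _).
Qed.

(** Each path with infinitely many orders costs at least n k1 for every n, so finite mean cost
    forces such paths to be null. *)
Lemma finorders_ae : (\int[P]_w pathcost w < +oo)%E -> P (~` good) = 0%E.
Proof.
move=> fin; have I0 : (0 <= \int[P]_w pathcost w)%E.
  by apply: integral_ge0 => w _; exact: pathcost_ge0.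
have mB : measurable (~` good).
  apply: (@filt_measurable _ _ _ P W x0 mu sigma t); apply: filt_setC; exact: finorders_filt.
set I := (\int[P]_w _)%E in fin I0.
have le n : n%:R * k1 * fine (P (~` good)) <= fine I.
  rewrite -lee_fin fineK ?ge0_fin_numE // EFinM fineK ?fin_num_measure //.
  have -> : ((n%:R * k1)%:E * P (~` good) = \int[P]_w (n%:R * k1 * \1_(~` good) w)%:E)%E.
    have Ii := Intg_indic _ mB.
    rewrite (ExEFin P _ (IntgZ P _ _ Ii)) (ExZ P _ _ Ii) [RHS]EFinM.
    congr (_ * _)%E; apply: (etrans _ (ExEFin P _ Ii)).
    by rewrite integral_indic // setIT.
  apply: integral_monotone => w.
    by rewrite lee_fin mulr_ge0 ?indicE // mulr_ge0 // ltW.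
  have [gw|bw] := pselect (good w); last by rewrite indicE mem_set // mulr1; exact: pathcost_bad.
  by rewrite indicE memNset ?mulr0; [exact: pathcost_ge0|move=> /(_ gw)].
have p0 : 0 <= fine (P (~` good)) by rewrite fine_ge0.
rewrite -[LHS]fineK ?fin_num_measure //; congr (_%:E); apply/eqP; rewrite eq_le p0 andbT leNgt.
apply/negP => p1; have kp : 0 < k1 * fine (P (~` good)) by rewrite mulr_gt0.
have [_ h] := andP (truncn_itv (divr_ge0 (fine_ge0 I0) (ltW kp))).
have := le (Num.truncn (fine I / (k1 * fine (P (~` good))))).+1.
by rewrite -mulrA -ler_pdivlMr // leNgt h.
Qed.

Section LowerBound.
Variables (V v q : R -> R) (L Q C m : R).
Hypotheses (dV : forall x : R, is_derive x (1 : R) V (v x)) (vq : qapprox L v q)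
  (qQ : forall x, `|q x| <= Q)
  (gen : forall x, m <= sigma ^+ 2 / 2 * q x - mu * v x + c0 cb ch x)
  (Vjump : forall y z, y <= z -> V y - V z <= k1 + k2 * (z - y))
  (VC : forall x, V x <= C) (vC : forall x, `|v x| <= C + Q * negpart x)
  (VQ : forall x, `|V x| <= C + C * `|x| + Q * negpart x ^+ 2).

Lemma admissible_lower : ((m * t + V x0 - C)%:E <= \int[P]_w pathcost w)%E.
Proof.
have [fin|] := ltP (\int[P]_w pathcost w)%E +oo%E; last by rewrite leye_eq => /eqP ->; rewrite leey.
have bad0 := finorders_ae fin.
have k1p := k10; have k2p := k20.
pose u1 (k : nat) (w : T) : R := 1.
have aA s : 0 <= s -> s <= t -> adapted s (A s).
  by move=> s0 st; apply: osum_adapted => // k; exact: order_term_adapted.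
have aN s : 0 <= s -> s <= t -> adapted s (N s).
  by move=> s0 st; apply: osum_adapted => // k; exact: count_term_adapted.
have Amono w s s' : s <= s' -> s' <= t -> A s w <= A s' w by move=> *; exact: osum_mono.
have A0 s w : 0 <= A s w by exact: osum_ge0.
have N0 s w : 0 <= N s w by exact: osum_ge0.
pose K s w := k1 * N s w + k2 * A s w.
have K0 s w : 0 <= K s w by rewrite addr_ge0 // mulr_ge0 // ltW.
have mA := adapted_measurable P W x0 mu sigma BM _ _ (aA t (ltW t0) (lexx t)).
have mK : measurable_fun setT (K t).
  by apply: measurable_funD; apply: measurable_funM => //;
    [exact: adapted_measurable P W x0 mu sigma BM _ _ (aN t (ltW t0) (lexx t))].
pose run := runcost W x0 mu sigma A t (c0 cb ch).
have run0 w : 0 <= run w by apply: Rintegral_ge0 => s _; exact: c0_ge0.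
(* Integrability of the ordering cost, and then of the ordered amount since k2 > 0, comes from the
   assumption that the mean cost is finite. *)
have IK : Intg P (K t).
  apply: Intg_ge0_lty => //; apply: le_lt_trans fin.
  apply: integral_monotone => w; first by rewrite lee_fin.
  have [gw|bw] := pselect (good w).
    by apply: le_trans (pathcost_good _ gw); rewrite lee_fin lerDr.
  by rewrite /K !osum_bad // !mulr0 addr0; exact: pathcost_ge0.
have IA : Intg P (A t).
  apply: (Intg_le _ _ (fun w => k2^-1 * K t w)) => //; first exact: IntgZ.
  move=> w; rewrite ger0_norm // -[leLHS](mulKf (lt0r_neq0 k20)) ler_wpM2l ?invr_ge0 ?(ltW k20) //.
  by rewrite /K lerDr mulr_ge0 // ltW.
have [S [IS S0 HS HS2]] := X0_sup_bound P W x0 mu sigma BM mu0 sigma0 t t0.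
have C0 : 0 <= C.
  have := vC 0; rewrite /negpart oppr0 maxxx mulr0 addr0; exact: le_trans.
have Q0 : 0 <= Q by apply: le_trans (qQ 0).
pose X s w := X0 s w + A s w.
have Xabs s w : 0 <= s -> s <= t -> `|X s w| <= S w + A t w.
  move=> s0 st; apply: (le_trans (ler_normD _ _)); apply: lerD; first by apply: HS; rewrite s0.
  by rewrite ger0_norm //; exact: Amono.
(* Orders only raise the inventory, so its negative part is controlled by X0 alone; the quadratic
   growth of V on the left is thereby integrable. *)
have Xneg s w : negpart (X s w) <= `|X0 s w|.
  rewrite /negpart ge_max normr_ge0 andbT /X opprD; have := A0 s w; have := ler_norm (- X0 s w).
  by rewrite normrN; lra.
have n0 x : 0 <= negpart x by rewrite /negpart le_max lexx orbT.
have mX s : 0 <= s -> s <= t -> measurable_fun setT (X s).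
  move=> s0 st; apply: measurable_funD; first exact: X0_measurable BM _.
  exact: adapted_measurable P W x0 mu sigma BM _ _ (aA s s0 st).
have cV : continuous V by move=> x; apply/differentiable_continuous/derivable1_diffP; case: (dV x).
have cv : continuous v.
  move=> x; apply/differentiable_continuous/derivable1_diffP.
  by case: (qapprox_is_derive _ _ _ x vq).
have IV s : 0 <= s -> s <= t -> Intg P (fun w => V (X s w)).
  move=> s0 st; apply: (Intg_le _ _ (fun w => C + (C * (S w + A t w) + Q * S w))).
  - by apply: measurableT_comp; [exact: continuous_measurable_fun|exact: mX].
  - apply: IntgD; first exact: Intg_cst.
    by apply: IntgD; apply: IntgZ => //; exact: IntgD.
  - move=> w; apply: (le_trans (VQ _)); rewrite -addrA lerD2l; apply: lerD.
      by rewrite ler_wpM2l // Xabs.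
    rewrite ler_wpM2l //; apply: le_trans (HS2 w s _); last by rewrite s0.
    by rewrite -[leRHS]real_normK ?num_real // lerXn2r ?nnegrE ?n0 ?normr_ge0 ?Xneg.
have Iv s : 0 <= s -> s <= t -> Intg P (fun w => v (X s w)).
  move=> s0 st; apply: (Intg_le _ _ (fun w => C + Q * S w)).
  - by apply: measurableT_comp; [exact: continuous_measurable_fun|exact: mX].
  - by apply: IntgD; [exact: Intg_cst|exact: IntgZ].
  - move=> w; apply: (le_trans (vC _)); rewrite lerD2l ler_wpM2l //.
    by apply: (le_trans (Xneg s w)); apply: HS; rewrite s0.
have Kjump w x s s' : s <= s' -> s' <= t -> V x - V (x + (A s' w - A s w)) <= K s' w - K s w.
  move=> ss st; have dA : 0 <= A s' w - A s w by rewrite subr_ge0 Amono.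
  have dN : 0 <= N s' w - N s w by rewrite subr_ge0; apply: osum_mono.
  have -> : K s' w - K s w = k1 * (N s' w - N s w) + k2 * (A s' w - A s w) by rewrite /K; ring.
  have [->|h] := osum_jump tau t Y s s' w Y0 ss st.
    by rewrite subrr addr0 subrr mulr0 addr0 mulr_ge0 // ltW.
  have := Vjump x (x + (A s' w - A s w)); rewrite lerDl => /(_ dA) /le_trans; apply.
  by rewrite [x + _]addrC addrK lerD2r ler_pMr.
(* Time -1 precedes every order, so the interval from -1 to 0 brings orders placed at time 0 under
   [Kjump]. *)
have neg1 u w : osum tau t u (-1) w = 0.
  rewrite /osum big1 ?mulr0 // => k _; rewrite ifF //; apply/negbTE; rewrite -ltNge.
  have [_ st _ _] := adm; case: (st k) => tk _; apply: lt_le_trans (tk w).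
  by rewrite lte_fin ltrN10.
have main := drift_lower_bound P W x0 mu sigma BM mu0 sigma0 A t t0 aA
  (fun w s s' _ ss st => Amono w s s' ss st) (A0 0) IA (c0 cb ch) (cb + ch)
  (c0_lip cb ch cb0 ch0) V v q L Q m C dV vq qQ IV Iv K gen VC IK
  (fun w x s s' _ ss st => Kjump w x s s' ss st).
have K00 w x : V x - V (x + A 0 w) <= K 0 w.
  have := Kjump w x (-1) 0; rewrite !neg1 /K !neg1 !mulr0 !addr0 !subr0; apply; last exact: ltW.
  by rewrite lerN10.
have {}main := main K00.
have [Irun _ _] := runcost_mean P W x0 mu sigma BM mu0 sigma0 A t t0 aA
  (fun w s s' _ ss st => Amono w s s' ss st) (A0 0) IA (c0 cb ch) (cb + ch) (c0_lip cb ch cb0 ch0).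
have IrK := IntgD P _ _ Irun IK.
have mg : measurable good.
  by apply: (@filt_measurable _ _ _ P W x0 mu sigma t); exact: finorders_filt.
(* The comparison with [pathcost] holds on the almost sure event only; the indicator makes it hold
   everywhere. *)
pose f w := \1_good w * (run w + K t w).
have f0 w : 0 <= f w by apply: mulr_ge0; [rewrite indicE|exact: addr_ge0].
have If : Intg P f.
  apply: (Intg_le _ _ _ _ IrK).
    by apply: measurable_funM; [exact: measurable_indic|exact: Intg_measurable IrK].
  move=> w; rewrite ger0_norm //; apply: ler_piMl; first exact: addr_ge0.
  by rewrite indicE; case: (_ \in _).
apply: (@le_trans _ _ (Ex P f)%:E); last first.
  rewrite -(ExEFin P _ If); apply: integral_monotone => w; first by rewrite lee_fin.
  rewrite /f indicE; have [gw|bw] := pselect (good w).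
    by rewrite mem_set // mul1r; exact: pathcost_good.
  by rewrite memNset // mul0r; exact: pathcost_ge0.
rewrite lee_fin; apply: (@le_trans _ _ (Ex P (fun w => run w + K t w))).
  rewrite (ExD P _ _ Irun IK); move: main; rewrite -/run.
  by move: (Ex P run) (Ex P (K t)) => a b h; lra.
apply: ae_Ex_le => //; exists (~` good); split => //; first exact: measurableC.
move=> w nle gw; apply: nle => /=; rewrite /f indicE mem_set // mul1r.
exact: lexx.
Qed.

End LowerBound.

End AdmissiblePolicy.

(** * Paths under the (y, z) policy *)

Section Hitting.
Context {R : realType}.
Implicit Types f : R -> R.

Definition hitting f (p : \bar R) (a : R) : \bar R :=
  ereal_inf [set t%:E | t in [set t : R | (p < t%:E)%E /\ f t <= a]].

Lemma hitting_pinfty f a : hitting f +oo%E a = +oo%E.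
Proof.
rewrite /hitting (_ : [set t : R | _] = set0) ?image_set0 ?ereal_inf0 //.
by apply/seteqP; split=> t //= [].
Qed.

Lemma hitting_lb f p a s : p < s -> f s <= a -> (hitting f p%:E a <= s%:E)%E.
Proof. by move=> ps fs; apply: ereal_inf_lbound; exists s => //=; rewrite lte_fin. Qed.

(** Times are taken strictly after p. If f p < a the infimum is p itself; if f p > a the path
    crosses a by continuity; if f p = a the infimum may lie beyond p, but the level is a all the
    same. *)
Lemma hitting_spec f p a : pcont f -> 0 <= p -> hitting f p%:E a = +oo%E \/
  exists r, [/\ hitting f p%:E a = r%:E, p <= r & f r = Num.min (f p) a].
Proof.
move=> pf p0; set S := [set t : R | (p%:E < t%:E)%E /\ f t <= a].
have [[s0 [/= ps0 fs0]]|no] := pselect (exists s, S s); last first.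
  left; rewrite /hitting -/S (_ : S = set0) ?image_set0 ?ereal_inf0 //.
  by apply/seteqP; split=> t //= St; apply: no; exists t.
right.
have lb : (p%:E <= hitting f p%:E a)%E.
  by apply: le_ereal_inf_tmp => _ [t [/= pt _] <-]; exact: ltW.
rewrite lte_fin in ps0.
have ub := hitting_lb f p a s0 ps0 fs0.
have [r rE] : exists r, hitting f p%:E a = r%:E.
  by move: lb ub; case: (hitting _ _ _) => // r _ _; exists r.
rewrite rE in lb ub; rewrite !lee_fin in lb ub.
have r0 := le_trans p0 lb.
have near e : 0 < e -> exists s, [/\ r <= s, s < r + e, p < s & f s <= a].
  move=> e0; have := @lb_ereal_inf_adherent _ [set t%:E | t in S] e e0.
  rewrite -/(hitting f p%:E a) rE => /(_ isT)[_ [s [/= ps fs] <-]].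
  rewrite -EFinD lte_fin => se; rewrite lte_fin in ps; exists s; split=> //.
  by have := hitting_lb f p a s ps fs; rewrite rE lee_fin.
have before s : p < s -> s < r -> a < f s.
  move=> ps sr; rewrite ltNge; apply/negP => fs.
  by have := hitting_lb f p a s ps fs; rewrite rE lee_fin leNgt sr.
have fra : f r <= a.
  rewrite leNgt; apply/negP => ar; have e0 : 0 < f r - a by rewrite subr_gt0.
  have [eta eta0 H] := pf r _ r0 e0; have [s [rs se ps fs]] := near eta eta0.
  have := H s (le_trans r0 rs); rewrite ger0_norm ?subr_ge0 // ltrBlDl => /(_ se).
  by rewrite ltr_norml => /andP[]; lra.
exists r; split => //; apply/esym.
move: lb; rewrite le_eqVlt => /orP[/eqP pr|pr].
  by rewrite pr; apply/min_idPl.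
have far : a <= f r.
  rewrite leNgt; apply/negP => ar; have e0 : 0 < a - f r by rewrite subr_gt0.
  have [eta eta0 H] := pf r _ r0 e0.
  pose s := Num.max ((p + r) / 2) (r - eta / 2).
  have sr : s < r by rewrite gt_max; apply/andP; split; lra.
  have ps : p < s by rewrite lt_max; apply/orP; left; lra.
  have se : r - eta / 2 <= s by rewrite le_max lexx orbT.
  have := H s (le_trans p0 (ltW ps)); rewrite distrC ger0_norm ?subr_ge0 ?(ltW sr) //.
  have h : r - s < eta by lra.
  by move=> /(_ h); have := before s ps sr; rewrite ltr_norml => ? /andP[]; lra.
(* Otherwise f stays below a just after p, and times before r would count. *)
have fpa : a <= f p.
  rewrite leNgt; apply/negP => ap; have e0 : 0 < a - f p by rewrite subr_gt0.
  have [eta eta0 H] := pf p _ p0 e0.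
  pose s := Num.min ((p + r) / 2) (p + eta / 2).
  have sr : s < r by rewrite gt_min; apply/orP; left; lra.
  have ps : p < s by rewrite lt_min; apply/andP; split; lra.
  have se : s <= p + eta / 2 by rewrite ge_min lexx orbT.
  have := H s (le_trans p0 (ltW ps)); rewrite ger0_norm ?subr_ge0 ?(ltW ps) //.
  have h : s - p < eta by lra.
  by move=> /(_ h); have := before s ps sr; rewrite ltr_norml => ? /andP[]; lra.
rewrite (min_idPr _) //; by apply/eqP; rewrite eq_le far.
Qed.

End Hitting.

Section YZPaths.
Context {R : realType} {d : measure_display} {T : measurableType d}.
Variables (P : probability T R) (W : R -> T -> R) (x0 mu sigma y z : R).
Hypotheses (BM : is_BM P W) (yz : y < z).
Local Notation X0 := (X0 x0 mu sigma W).
Local Notation tau := (yz_tau x0 mu sigma W y z).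
Local Notation Y := (yz_Y x0 mu sigma W y z).
Local Notation b := (Num.min x0 y).

(** Value of the uncontrolled process X0 when order k is placed. *)
Definition lvl (k : nat) : R := b - k%:R * (z - y).

Definition lot (k : nat) : R := if k is 0 then z - b else z - y.

(** Total amount ordered before order k: added to X0 it gives z just after an order and y just
    before the next one. Only the first lot can differ, when x0 < y. *)
Definition stock (k : nat) : R := if k is k'.+1 then z - b + k'%:R * (z - y) else 0.

Lemma stockS k : stock k.+1 = stock k + lot k.
Proof. by case: k => [|k]; rewrite /stock /lot ?mul0r ?addr0 ?add0r // -natr1; ring. Qed.

Lemma lvl_stock k : lvl k + stock k.+1 = z.
Proof. by rewrite /lvl /stock; ring. Qed.

Lemma lvl_stock_pre k : lvl k.+1 + stock k.+1 = y.
Proof. by rewrite /lvl /stock -natr1; ring. Qed.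

Lemma lvl_lt k : lvl k.+1 < lvl k.
Proof. by have := yz; rewrite /lvl -natr1; nra. Qed.

Lemma lvl_le_x0 k : lvl k <= x0.
Proof.
have h : b <= x0 by rewrite ge_min lexx.
apply: (le_trans _ h); rewrite /lvl lerBlDl lerDr; apply: mulr_ge0 => //; rewrite subr_ge0; exact: ltW.
Qed.

Lemma lot_gt0 k : 0 < lot k.
Proof.
have h : b <= y by rewrite ge_min lexx orbT.
by have := yz; case: k => [|k] /=; lra.
Qed.

Lemma X0_0 w : X0 0 w = x0.
Proof. by have [W0 _ _ _ _] := BM; rewrite /Defs.X0 W0 !mulr0 subr0 addr0. Qed.

Lemma yz_tau0 w : tau 0 w = hitting (X0 ^~ w) 0%E y.
Proof. by rewrite /yz_tau /= /hitting; under eq_fun do rewrite addr0. Qed.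

Lemma yz_tauS k w : tau k.+1 w =
  hitting (X0 ^~ w) (tau k w) (y - (yz_state x0 mu sigma W y z k w).2).
Proof.
rewrite /yz_tau /=; case: (yz_state _ _ _ _ _ _ k w) => [[t' Y'] c'] /=.
rewrite /hitting; congr (ereal_inf (image _ _)).
by apply/seteqP; split=> t /= [? ?]; split=> //; lra.
Qed.

Lemma yz_YE k w r : tau k w = r%:E -> Y k w =
  z - (X0 r w + (if k is k'.+1 then (yz_state x0 mu sigma W y z k' w).2 else 0)).
Proof.
rewrite /yz_tau /yz_Y; case: k => [|k] /=; first by move=> ->.
by case: (yz_state _ _ _ _ _ _ k w) => [[t' Y'] c'] /= ->.
Qed.

Lemma yz_stateE k w : (yz_state x0 mu sigma W y z k w).2 =
  (if k is k'.+1 then (yz_state x0 mu sigma W y z k' w).2 else 0) + Y k w.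
Proof.
by rewrite /yz_Y; case: k => [|k] //=; case: (yz_state _ _ _ _ _ _ k w) => [[t' Y'] c'].
Qed.

(** Induction with [hitting_spec]. Its minimum is taken by the starting level only for order 0; from
    then on X0 sits at [lvl k], above the next target [lvl k.+1]. *)
Lemma yz_spec k w : tau k w = +oo%E \/ exists r,
  [/\ tau k w = r%:E, 0 <= r, X0 r w = lvl k, Y k w = lot k &
      (yz_state x0 mu sigma W y z k w).2 = stock k.+1].
Proof.
elim: k => [|k IH].
  rewrite yz_tau0; have [->|[r [rE r0 Xr]]] := hitting_spec (X0 ^~ w) 0 y (X0_pcont P W x0 mu sigma BM w) (lexx _); first by left.
  right; exists r; have tE : tau 0 w = r%:E by rewrite yz_tau0.
  have Xl : X0 r w = lvl 0 by rewrite Xr X0_0 /lvl mul0r subr0.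
  have YE : Y 0 w = lot 0 by rewrite (yz_YE 0 w r tE) Xl addr0 /lvl mul0r subr0.
  split=> //; by rewrite yz_stateE YE add0r /stock mul0r addr0.
rewrite yz_tauS; case: IH => [->|[p [pE p0 Xp _ st]]]; first by left; rewrite hitting_pinfty.
rewrite pE st.
have [->|[r [rE pr Xr]]] := hitting_spec (X0 ^~ w) p (y - stock k.+1) (X0_pcont P W x0 mu sigma BM w) p0; first by left.
right; exists r; have tE : tau k.+1 w = r%:E by rewrite yz_tauS pE st.
have le : y - stock k.+1 = lvl k.+1 by rewrite -(lvl_stock_pre k) addrK.
have Xl : X0 r w = lvl k.+1 by rewrite Xr le Xp; apply/min_idPr/ltW/lvl_lt.
have YE : Y k.+1 w = lot k.+1.
  by rewrite (yz_YE k.+1 w r tE) st Xl lvl_stock_pre.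
split=> //; first exact: le_trans pr.
by rewrite yz_stateE st YE -stockS.
Qed.

Lemma yz_tau_ge0 k w : (0 <= tau k w)%E.
Proof. by have [->|[r [-> r0 _ _ _]]] := yz_spec k w; rewrite ?leey ?lee_fin. Qed.

Lemma yz_tau_lt k w r : tau k w = r%:E -> (r%:E < tau k.+1 w)%E.
Proof.
move=> rE; have [->|[r' [r'E r'0 Xr' _ _]]] := yz_spec k.+1 w; first exact: ltry.
have [|[p [pE p0 Xp _ st]]] := yz_spec k w; first by rewrite rE.
move: pE; rewrite rE => -[rp]; subst p.
rewrite r'E lte_fin lt_neqAle; apply/andP; split.
  by apply/eqP => rr; have := lvl_lt k; rewrite -Xp -Xr' rr ltxx.
rewrite -lee_fin -r'E yz_tauS rE; apply: le_ereal_inf_tmp => _ [t [/= pt _] <-]; exact: ltW.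
Qed.

Lemma yz_tau_mono k w : (tau k w <= tau k.+1 w)%E.
Proof.
have [E|[r [E r0 _ _ _]]] := yz_spec k w.
  by rewrite yz_tauS E hitting_pinfty.
by rewrite E; exact/ltW/yz_tau_lt.
Qed.

Lemma yz_tau_hit k w s : 0 < s -> X0 s w <= lvl k -> (tau k w <= s%:E)%E.
Proof.
move=> s0; elim: k => [|k IH] Xs.
  rewrite yz_tau0; apply: hitting_lb => //; apply: (le_trans Xs).
  by rewrite /lvl mul0r subr0 ge_min lexx orbT.
have tk := IH (le_trans Xs (ltW (lvl_lt k))).
have [E|[r [E r0 Xr _ st]]] := yz_spec k w; first by move: tk; rewrite E.
rewrite yz_tauS E st -(lvl_stock_pre k) addrK; apply: hitting_lb => //.
move: tk; rewrite E lee_fin le_eqVlt => /orP[/eqP rs|//].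
by have := lvl_lt k; rewrite -Xr rs ltNge Xs.
Qed.

(** First-passage description of the order times. The condition on the level excludes order 0 with
    x0 <= y, where s = 0 would satisfy the right-hand side at once. *)
Lemma yz_tau_leP k w t : 0 <= t -> lvl k < x0 ->
  (tau k w <= t%:E)%E <-> exists2 s, 0 <= s <= t & X0 s w <= lvl k.
Proof.
move=> t0 lx; split.
  have [->//|[r [-> r0 Xr _ _]]] := yz_spec k w; rewrite lee_fin => rt.
  by exists r; rewrite ?r0 // Xr.
move=> [s /andP[s0 st] Xs]; apply: (@le_trans _ _ s%:E); last by rewrite lee_fin.
apply: yz_tau_hit => //; move: s0; rewrite le_eqVlt => /orP[/eqP s0|//].
by move: Xs; rewrite -s0 X0_0 leNgt lx.
Qed.

Lemma yz_finite_orders t w : 0 <= t -> exists k, (t%:E < tau k w)%E.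
Proof.
move=> t0; have [B HB] := pcont_bounded _ t t0 (X0_pcont P W x0 mu sigma BM w).
have D0 : 0 < z - y by rewrite subr_gt0.
pose k := (Num.truncn ((`|b| + `|B|) / (z - y))).+1.
have kB : `|b| + `|B| < k%:R * (z - y).
  rewrite -ltr_pdivrMr //.
  by have [] := andP (truncn_itv (divr_ge0 (addr_ge0 (normr_ge0 b) (normr_ge0 B)) (ltW D0))).
exists k; have [->|[r [-> r0 Xr _ _]]] := yz_spec k w; first exact: ltry.
rewrite lte_fin ltNge; apply/negP => rt; have := HB r; rewrite r0 rt => /(_ isT).
rewrite Xr /lvl => h; have := ler_norm (- (b - k%:R * (z - y))); rewrite normrN.
have := ler_norm b; have := ler_norm B; move: h kB; lra.
Qed.

End YZPaths.

(** * Admissibility of the (y, z) policy *)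

Section GaussianTail.
Context {R : realType}.

Definition tail_mass : R := expR (- 4) * normal_peak 1.

Lemma tail_mass_gt0 : 0 < tail_mass.
Proof. by rewrite mulr_gt0 ?expR_gt0 // normal_peak_gt0 // oner_neq0. Qed.

(** On [-2r, -r) one has x^2 / (2 s^2) <= 4, so the density is at least its peak times e^(-4); the
    length r is at least s, and s times the peak does not depend on s. *)
Lemma gauss_tail (s r : R) : 0 < s -> s <= r -> r ^+ 2 <= 2 * s ^+ 2 ->
  (tail_mass%:E <= normal_prob 0 s `]-oo, (- r)%R[%classic)%E.
Proof.
move=> s0 sr rs; have r0 := lt_le_trans s0 sr; have sn0 : s != 0 by rewrite gt_eqF.
apply: (@le_trans _ _ (normal_prob 0 s `[(- (2 * r))%R, (- r)%R[%classic)); last first.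
  apply: le_measure; rewrite ?inE; [exact: measurable_itv|exact: measurable_itv|].
  by move=> x /=; rewrite !in_itv /= => /andP[].
pose c : R := normal_peak s * expR (- 4).
have c0 : 0 <= c by rewrite mulr_ge0 ?expR_ge0 ?normal_peak_ge0.
apply: (@le_trans _ _ (\int[lebesgue_measure]_(x in `[(- (2 * r))%R, (- r)%R[%classic) c%:E)%E).
  rewrite integral_cst; last exact: measurable_itv.
  have lt : - (2 * r) < - r by lra.
  rewrite /= lebesgue_measure_itv /= lte_fin lt -EFinB -EFinM lee_fin /c /tail_mass.
  have -> : - r - - (2 * r) = r by ring.
  rewrite mulrAC mulrC ler_wpM2r ?expR_ge0 //.
  have -> : normal_peak 1 = normal_peak s * s.
    rewrite /normal_peak.
    have -> : s ^+ 2 * pi *+ 2 = s ^+ 2 * (1 ^+ 2 * pi *+ 2) by move: (@pi R) => p; ring.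
    rewrite sqrtrM ?sqr_ge0 // sqrtr_sqr gtr0_norm // invfM.
    by rewrite [RHS]mulrC mulrA mulfV // mul1r.
  by rewrite ler_wpM2l // normal_peak_ge0.
rewrite /normal_prob; apply: ge0_le_integral.
- exact: measurable_itv.
- by move=> x _; rewrite lee_fin.
- by [].
- by apply/measurable_EFinP; apply: measurable_funTS; exact: measurable_normal_pdf.
move=> x /=; rewrite in_itv /= => /andP[x1 x2].
rewrite lee_fin normal_pdfE // /normal_fun subr0 ler_wpM2l ?normal_peak_ge0 //.
rewrite ler_expR mulNr lerN2 ler_pdivrMr; last by rewrite pmulrn_lgt0 // exprn_gt0.
have : x ^+ 2 <= (2 * r) ^+ 2.
  by rewrite -sqrrN lerXn2r ?nnegrE //; lra.
rewrite -mulr_natr; move: rs x1 x2 => *; nra.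
Qed.

End GaussianTail.

Section StartNegative.
Context {R : realType} {d : measure_display} {T : measurableType d}.
Variables (P : probability T R) (W : R -> T -> R).
Hypothesis BM : is_BM P W.

(** By scaling, the chance that the increment falls below - sqrt v is bounded below independently of
    v; rho <= 1/2 keeps the variance at least v / 2. *)
Lemma W_tail u v rho : 0 < v -> u = rho * v -> 0 < rho -> rho <= 2^-1 ->
  fine (P ((fun w => W v w - W u w) @^-1` [set x | - Num.sqrt v <= x])) <= 1 - tail_mass.
Proof.
move=> v0 uE rho0 rho1.
have u0 : 0 <= u by rewrite uE mulr_ge0 // ltW.
have uv : u < v by rewrite uE; nra.
pose r := Num.sqrt v; pose s := Num.sqrt (v - u).
have s0 : 0 < s by rewrite sqrtr_gt0 subr_gt0.
have s2 : s ^+ 2 = v - u by rewrite sqr_sqrtr // subr_ge0 ltW.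
have r2 : r ^+ 2 = v by rewrite sqr_sqrtr // ltW.
have sr : s <= r by rewrite ler_wsqrtr // gerBl.
have rs : r ^+ 2 <= 2 * s ^+ 2 by rewrite r2 s2 uE; nra.
have tail := gauss_tail s r s0 sr rs.
have [_ _ _ law _] := BM.
have mI : measurable (`]-oo, (- r)%R[%classic : set R) by exact: measurable_itv.
have mD := incr_measurable P W BM u v.
have mpre : measurable ((fun w => W v w - W u w) @^-1` `]-oo, (- r)%R[%classic).
  by rewrite -[X in measurable X]setTI; exact: mD.
have -> : (fun w => W v w - W u w) @^-1` [set x | - r <= x] =
    ~` ((fun w => W v w - W u w) @^-1` `]-oo, (- r)%R[%classic).
  by apply/seteqP; split=> w /=; rewrite in_itv /= => h; [apply/negP; rewrite -leNgt|rewrite leNgt; apply/negP].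
rewrite probability_setC // fineB ?fin_num_measure //= lerD2l lerN2.
rewrite -lee_fin fineK ?fin_num_measure // law //.
Qed.

Lemma tail_mass_le1 : tail_mass <= 1 :> R.
Proof.
have h : (2^-1 : R) = 2^-1 * 1 by rewrite mulr1.
have := W_tail 2^-1 1 2^-1 ltr01 h _ (lexx _); rewrite invr_gt0 => /(_ (ltr0Sn _ _)).
have : 0 <= fine (P ((fun w => W 1 w - W 2^-1 w) @^-1` [set x | - Num.sqrt 1 <= x])) by rewrite fine_ge0.
move=> a b; have := le_trans a b; lra.
Qed.

(** Look at n geometric times. On B, either every increment stays above minus the root of its end
    time, with probability at most (1 - [tail_mass])^n, or W at some earlier time exceeds that root,
    which Chebyshev makes unlikely for a small ratio rho. First n is chosen, then rho. *)
Lemma positive_start_null (B : set T) e : 0 < e -> measurable B ->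
  (forall w, B w -> forall s, 0 < s -> s <= e -> 0 < W s w) -> P B = 0%E.
Proof.
move=> e0 mB HB.
suff H eta : 0 < eta -> fine (P B) <= eta.
  have pB0 : 0 <= fine (P B) by rewrite fine_ge0.
  rewrite -[LHS]fineK ?fin_num_measure //; congr (_%:E); apply/eqP; rewrite eq_le pB0 andbT.
  by apply/ler_addgt0Pr => x x0; rewrite add0r; exact: H.
move=> eta0; have eta2 : 0 < eta / 2 by rewrite divr_gt0.
have p1 := tail_mass_le1; have p0 := @tail_mass_gt0 R.
have q1 : `|1 - tail_mass : R| < 1 by rewrite ger0_norm ?subr_ge0 //; lra.
have /cvgrPdist_lt/(_ _ eta2)[n _ /(_ n (leqnn n)) /=] := cvg_expr q1.
rewrite sub0r normrN ger0_norm ?exprn_ge0 ?subr_ge0 // => Hn.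
pose rho := Num.min (2^-1) (eta / 2 / n.+1%:R).
have rho0 : 0 < rho by rewrite lt_min invr_gt0 ltr0Sn /= divr_gt0 ?ltr0Sn.
have rho12 : rho <= 2^-1 by rewrite ge_min lexx.
have rho1 : rho <= 1 by apply: (le_trans rho12); rewrite invf_le1 ?ler1n.
have rhon : rho * n%:R <= eta / 2.
  apply: (@le_trans _ _ (rho * n.+1%:R)); first by rewrite ler_wpM2l ?(ltW rho0) // ler_nat.
  by rewrite -ler_pdivlMr ?ltr0Sn // ge_min lexx orbT.
(* Truncated subtraction makes the sequence constant equal to e from index n on, as
   [indep_increments] asks for monotonicity at all indices. *)
pose tt i := e * rho ^+ (n - i).
have tt0 i : 0 < tt i by rewrite mulr_gt0 // exprn_gt0.
have tte i : tt i <= e by rewrite ler_piMr ?(ltW e0) // exprn_ile1 // ltW.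
have ttS i : (i < n)%N -> tt i = rho * tt i.+1.
  by move=> iN; rewrite /tt -[(n - i)%N]prednK ?subn_gt0 // -subnS exprS; ring.
have ttmono i : tt i <= tt i.+1.
  have [iN|nI] := ltnP i n; first by rewrite ttS // ler_piMl // ltW.
  by rewrite /tt; have /eqP -> : (n - i == 0)%N by []; have /eqP -> : (n - i.+1 == 0)%N by rewrite subn_eq0 leqW.
pose D i w := W (tt i.+1) w - W (tt i) w.
pose Bi i := [set x : R | - Num.sqrt (tt i.+1) <= x].
have mBi i : measurable (Bi i).
  have -> : Bi i = `[(- Num.sqrt (tt i.+1))%R, +oo[%classic.
    by apply/seteqP; split=> x /=; rewrite in_itv /= andbT.
  exact: measurable_itv.
pose C := \bigcap_(i in [set i : nat | (i < n)%N]) (D i @^-1` Bi i).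
have mC : measurable C.
  apply: bigcap_measurableType => i _; rewrite -[X in measurable X]setTI.
  by apply: (incr_measurable P W BM) => //.
have PC : fine (P C) <= (1 - tail_mass) ^+ n.
  have [_ _ _ _ ind] := BM.
  rewrite /C /D (ind n tt Bi (ltW (tt0 0%N)) ttmono mBi) -[n in leRHS]card_ord -prodr_const.
  apply: ler_prod => i _; rewrite fine_ge0 //=.
  exact: (W_tail (tt i) (tt i.+1) rho (tt0 _) (ttS i (ltn_ord i)) rho0 rho12).
have ind01 (A : set T) w : 0 <= \1_A w :> R by rewrite indicE.
have Iind (A : set T) : measurable A -> Intg P (\1_A : T -> R).
  move=> mA; apply: (Intg_le _ _ _ _ (Intg_cst P 1)); first exact: measurable_indic.
  by move=> w; rewrite ger0_norm // indicE; case: (_ \in _).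
have Eind (A : set T) : measurable A -> Ex P (\1_A : T -> R) = fine (P A).
  move=> mA; rewrite /Ex /Rintegral; congr fine.
  by rewrite integral_indic // setIT.
have sq i := W_sqr P W BM (tt i) (ltW (tt0 i)).
(* Chebyshev summed over the grid: each term has mean rho, and one of them exceeds 1 whenever W at
   the start of an interval exceeds the root of its end. *)
pose Z w := \sum_(i < n) (tt i.+1)^-1 * W (tt i) w ^+ 2.
have Zi i : (i < n)%N -> Intg P (fun w => (tt i.+1)^-1 * W (tt i) w ^+ 2).
  by move=> iN; apply: IntgZ; case: (sq i).
have IZ : Intg P Z by exact: (Intg_sum P n (fun i w => (tt i.+1)^-1 * W (tt i) w ^+ 2)).
have EZ : Ex P Z = rho * n%:R.
  rewrite /Z (Ex_sum P n (fun i w => (tt i.+1)^-1 * W (tt i) w ^+ 2)) //.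
  rewrite mulr_natr -[n in RHS]card_ord -sumr_const; apply: eq_bigr => i _.
  have [I2 E2] := sq i; by rewrite (ExZ P _ _ I2) E2 [X in _ * X](ttS i (ltn_ord i)) mulrC mulfK // gt_eqF.
rewrite -(Eind B mB) [leRHS]splitr.
apply: (@le_trans _ _ (Ex P (fun w => Z w + \1_C w))).
  apply: Ex_le => [||w]; [exact: Iind|by apply: IntgD => //; exact: Iind|].
  have Zt (i : 'I_n) : 0 <= (tt i.+1)^-1 * W (tt i) w ^+ 2.
    by apply: mulr_ge0; [rewrite invr_ge0 ltW|exact: sqr_ge0].
  have Z0 : 0 <= Z w by apply: sumr_ge0 => i _.
  have [Bw|nB] := pselect (B w); last by rewrite [leLHS]indicE memNset // addr_ge0.
  rewrite [leLHS]indicE mem_set //.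
  have [Cw|nC] := pselect (C w); first by rewrite indicE mem_set // lerDr.
  rewrite indicE memNset // addr0.
  have [i iN Wi] : exists2 i, (i < n)%N & Num.sqrt (tt i.+1) < W (tt i) w.
    apply: contrapT => H; apply: nC => i /= iN; rewrite /D /Bi /=.
    have h1 : W (tt i) w <= Num.sqrt (tt i.+1) by rewrite leNgt; apply/negP => h; apply: H; exists i.
    have := HB w Bw (tt i.+1) (tt0 _) (tte _); lra.
  rewrite /Z (bigD1 (Ordinal iN)) //=; apply: ler_wpDr; first by apply: sumr_ge0 => j _.
  rewrite -ler_pdivrMl ?invr_gt0 // invrK mulr1 -[leLHS]sqr_sqrtr ?(ltW (tt0 _)) //.
  rewrite lerXn2r ?nnegrE ?sqrtr_ge0 ?(ltW Wi) //.
  by apply/ltW/(le_lt_trans _ Wi)/sqrtr_ge0.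
rewrite ExD //; last exact: Iind.
rewrite EZ Eind //; apply: lerD => //; apply: (le_trans PC); exact: ltW.
Qed.

End StartNegative.

Section HittingEvents.
Context {R : realType} {d : measure_display} {T : measurableType d}.
Variables (P : probability T R) (W : R -> T -> R) (x0 mu sigma : R).
Hypotheses (BM : is_BM P W).
Local Notation X0 := (X0 x0 mu sigma W).
Local Notation natgen := (natgen x0 mu sigma W).

Lemma grid_dense (a b s eta : R) : a <= s -> s <= b -> 0 < eta ->
  exists n i, (i <= n.+1)%N /\ `|a + gridp (b - a) n i - s| < eta.
Proof.
move=> sa sb eta0; have := le_trans sa sb; rewrite le_eqVlt => /orP[/eqP ab|ab].
  exists 0%N, 0%N; split=> //; rewrite gridp0 addr0; have -> : a - s = 0 by lra.
  by rewrite normr0.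
have ba : 0 < b - a by rewrite subr_gt0.
have [N HN] := small_step (b - a) ba eta eta0.
have s1 : 0 <= s - a by rewrite subr_ge0.
have s2 : s - a <= b - a by rewrite lerD2r.
have [i iN gi] := gridp_approx (b - a) N (s - a) ba s1 s2.
exists N, i; split=> //; have -> : a + gridp (b - a) N i - s = gridp (b - a) N i - (s - a) by ring.
by apply: (le_lt_trans gi); exact: HN.
Qed.

(** By continuity the level is reached if and only if, for every m, some grid point comes within 1 /
    (m + 1) of it: the minimum over [a, b] is attained. This writes the event with countably many
    times. *)
Lemma hit_event (a b L : R) : 0 <= a -> a <= b ->
  <<s natgen b >> [set w | exists2 s, a <= s <= b & X0 s w <= L].
Proof.
move=> a0 ab.
rewrite (_ : [set w | _] = \bigcap_m \bigcup_n \bigcup_(i in [set i | (i <= n.+1)%N])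
    (X0 (a + gridp (b - a) n i) @^-1` [set x | x <= L + m.+1%:R^-1])).
  apply: (@bigcapT_measurable _ (g_sigma_algebraType (natgen b))) => m.
  apply: (@bigcupT_measurable _ (g_sigma_algebraType (natgen b))) => n.
  apply: (@bigcup_measurable _ (g_sigma_algebraType (natgen b))) => i /= iN.
  apply: sub_sigma_algebra; exists (a + gridp (b - a) n i), [set x | x <= L + m.+1%:R^-1].
  have ba : 0 <= b - a by rewrite subr_ge0.
  split=> //.
    rewrite addr_ge0 ?gridp_ge0 //= -lerBrDl -[leRHS](gridp_last (b - a) n).
    exact: gridp_le.
  rewrite (_ : [set x | _] = `]-oo, (L + m.+1%:R^-1)%R]%classic); first exact: measurable_itv.
  by apply/seteqP; split=> x /=; rewrite in_itv.
apply/seteqP; split=> w /=.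
  move=> [s /andP[sa sb] Xs] m _.
  have m0 : 0 < m.+1%:R^-1 :> R by rewrite invr_gt0 ltr0Sn.
  have [eta eta0 H] := X0_pcont P W x0 mu sigma BM w s _ (le_trans a0 sa) m0.
  have [n [i [iN gi]]] := grid_dense a b s eta sa sb eta0.
  exists n => //; exists i => //=.
  have := H (a + gridp (b - a) n i); rewrite addr_ge0 ?gridp_ge0 ?subr_ge0 // => /(_ isT gi).
  rewrite ltr_norml => /andP[_]; rewrite ltrBlDr => h; apply/ltW/(lt_le_trans h).
  by rewrite addrC lerD2r.
move=> H.
have pg : pcont (fun u => X0 (a + u) w).
  move=> u e u0 e0; have [eta eta0 He] := X0_pcont P W x0 mu sigma BM w _ _ (addr_ge0 a0 u0) e0.
  exists eta => // v v0 vu; apply: He; first exact: addr_ge0.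
  by have -> : a + v - (a + u) = v - u by ring.
have ba : 0 <= b - a by rewrite subr_ge0.
have [u /andP[u0 ub] Hu] := pcont_argmin _ (b - a) ba pg.
exists (a + u); first by rewrite lerDl u0 /=; lra.
rewrite leNgt; apply/negP => LX.
have [k hk] := ltr_add_invr LX.
have [n _ [i /= iN gi]] := H k I.
have gb : 0 <= gridp (b - a) n i <= b - a.
  by rewrite gridp_ge0 //= -[leRHS](gridp_last (b - a) n) gridp_le.
by have := le_lt_trans (le_trans (Hu _ gb) gi) hk; rewrite ltxx.
Qed.

End HittingEvents.

Section YZAdmissible.
Context {R : realType} {d : measure_display} {T : measurableType d}.
Variables (P : probability T R) (W : R -> T -> R) (x0 mu sigma y z : R).
Hypotheses (BM : is_BM P W) (mu0 : 0 < mu) (sigma0 : 0 < sigma) (yz : y < z).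
Local Notation X0 := (X0 x0 mu sigma W).
Local Notation filt := (filt P x0 mu sigma W).
Local Notation natgen := (natgen x0 mu sigma W).
Local Notation tau := (yz_tau x0 mu sigma W y z).
Local Notation Y := (yz_Y x0 mu sigma W y z).

Lemma yz_stopping_hit k t : 0 <= t -> lvl x0 y z k < x0 ->
  filt t [set w | (tau k w <= t%:E)%E].
Proof.
move=> t0 lk; apply: (natgen_filt P W x0 mu sigma BM).
have -> : [set w | (tau k w <= t%:E)%E] = [set w | exists2 s, 0 <= s <= t & X0 s w <= lvl x0 y z k].
  by apply/seteqP; split=> w /=; have [H1 H2] := yz_tau_leP P W x0 mu sigma y z BM yz k w t t0 lk.
exact: (hit_event P W x0 mu sigma BM).
Qed.

Lemma yz_tau0_lt w : x0 < y -> (tau 0 w = 0)%E.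
Proof.
move=> xy; have pX := X0_pcont P W x0 mu sigma BM w.
have xy0 : 0 < y - x0 by rewrite subr_gt0.
have [eta eta0 H] := pX 0 _ (lexx _) xy0.
apply/eqP; rewrite eq_le (yz_tau_ge0 P W x0 mu sigma y z BM yz) andbT.
apply/lee_addgt0Pr => e e0; rewrite add0e.
pose s := Num.min e (eta / 2); have s0 : 0 < s by rewrite lt_min e0 divr_gt0.
have se : s < eta by rewrite gt_min; apply/orP; right; lra.
apply: (@le_trans _ _ s%:E); last by rewrite lee_fin ge_min lexx.
rewrite (yz_tau0 W x0 mu sigma y z); apply: hitting_lb => //.
have := H s (ltW s0); rewrite subr0 gtr0_norm // => /(_ se).
by rewrite (X0_0 P W x0 mu sigma BM) ltr_norml => /andP[]; lra.
Qed.

(** The complement says that the path stays above its starting level on some interval (0, t + 1 / (m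
    + 1)]. It is null, hence in the augmented filtration although it looks beyond t. *)
Lemma yz_stopping0 t : 0 <= t -> x0 = y -> filt t [set w | (tau 0 w <= t%:E)%E].
Proof.
move=> t0 xy; set E := [set w | _].
rewrite -[E]setCK; apply: filt_setC => //.
pose b (m : nat) := t + m.+1%:R^-1; pose a (m j : nat) := Num.min (j.+1%:R^-1) (b m).
have inv0 (m : nat) : 0 < m.+1%:R^-1 :> R by rewrite invr_gt0 ltr0Sn.
have b0 m : 0 < b m by rewrite ltr_wpDl.
have a0 m j : 0 < a m j by rewrite lt_min inv0 b0.
have ab m j : a m j <= b m by rewrite ge_min lexx orbT.
pose C m := \bigcap_j ~` [set w | exists2 s, a m j <= s <= b m & X0 s w <= y].
have mC m : measurable (C m).
  apply: bigcapT_measurable => j; apply: measurableC.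
  apply: (sigma_algebra_sub _ (@natgen_measurable _ _ _ P W x0 mu sigma BM (b m))).
  by apply: (hit_event P W x0 mu sigma BM) => //; exact: ltW.
have CE m w s : C m w -> 0 < s -> s <= b m -> y < X0 s w.
  move=> Cw s0 sb; rewrite ltNge; apply/negP => Xs.
  have [j hj] := @ltr_add_invr R 0 s s0; rewrite add0r in hj.
  by apply: (Cw j I); exists s => //; rewrite sb andbT /a ge_min (ltW hj).
have CEq : ~` E = \bigcup_m C m.
  apply/seteqP; split=> w /=.
    move=> /negP; rewrite -ltNge => tt0.
    have [m hm] : exists m, ((b m)%:E < tau 0 w)%E.
      move: tt0; have [->|[r [-> r0 _ _ _]]] := yz_spec P W x0 mu sigma y z BM yz 0 w.
        by move=> _; exists 0%N; exact: ltry.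
      by rewrite lte_fin => /ltr_add_invr[k hk]; exists k; rewrite lte_fin.
    exists m => // j _ [s /andP[sa sb] Xs].
    have : (tau 0 w <= (b m)%:E)%E.
      apply: (@le_trans _ _ s%:E); last by rewrite lee_fin.
      by rewrite (yz_tau0 W x0 mu sigma y z); apply: hitting_lb => //; exact: lt_le_trans sa.
    by move=> /le_lt_trans/(_ hm); rewrite ltxx.
  move=> [m _ Cw]; apply/negP; rewrite -ltNge; apply: (@lt_le_trans _ _ (b m)%:E).
    by rewrite lte_fin ltrDl.
  rewrite (yz_tau0 W x0 mu sigma y z); apply: le_ereal_inf_tmp => _ [s [/= s0 Xs] <-].
  rewrite lee_fin leNgt; apply/negP => sb; rewrite lte_fin in s0.
  by have := CE m w s Cw s0 (ltW sb); rewrite ltNge Xs.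
have mU : measurable (\bigcup_m C m) by exact: bigcupT_measurable.
rewrite CEq; apply: filt_null => //.
apply/negligibleP => //; apply: negligible_bigcup => m; apply/negligibleP => //.
apply: (positive_start_null P W BM (C m) (b m)) => // w Cw s s0 sb.
(* X0 s > x0 means sigma W_s > mu s > 0: the drift only helps. *)
have := CE m w s Cw s0 sb; rewrite -xy /Defs.X0 => h.
have ms : 0 < mu * s by rewrite mulr_gt0.
by rewrite -(pmulr_rgt0 _ sigma0); lra.
Qed.

Lemma yz_stopping k : stopping_time P x0 mu sigma W (tau k).
Proof.
split=> [w|t t0]; first exact: (yz_tau_ge0 P W x0 mu sigma y z BM yz).
have [lk|] := ltP (lvl x0 y z k) x0; first exact: yz_stopping_hit.
case: k => [|k]; last first.
  rewrite leNgt => /negP[]; apply: (lt_le_trans (lvl_lt x0 y z yz k)); exact: lvl_le_x0.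
rewrite /lvl mul0r subr0 le_min lexx /= le_eqVlt => /orP[/eqP xy|xy].
  exact: yz_stopping0.
have -> : [set w | (tau 0 w <= t%:E)%E] = setT.
  by apply/seteqP; split=> w //= _; rewrite yz_tau0_lt // lee_fin.
rewrite -[setT]setCK setCT; apply: filt_setC => //; exact: filt_null.
Qed.

Lemma yz_YE_fin k w : Y k w = if tau k w == +oo%E then 0 else lot x0 y z k.
Proof.
have [E|[r [-> _ _ -> _]]] := yz_spec P W x0 mu sigma y z BM yz k w; last by [].
rewrite E eqxx; move: E; rewrite /yz_tau /yz_Y; case: k => [|k] /=; first by move=> ->.
by case: (yz_state _ _ _ _ _ _ k w) => [[t' Y'] c'] /= ->.
Qed.

Lemma yz_admissible : admissible P x0 mu sigma W tau Y.
Proof.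
have D0 k := lot_gt0 x0 y z yz k.
split.
- by move=> k w; exact: (yz_tau_mono P W x0 mu sigma y z BM yz).
- exact: yz_stopping.
- by move=> k w; rewrite yz_YE_fin; case: ifP => // _; exact: ltW.
move=> k B mB; have [_ st] := yz_stopping k.
(* Y k is a constant on F and 0 off F, so its measurability reduces to that of F, a countable union
   of events of finite times. *)
pose F := [set w | tau k w != +oo%E].
have FI : filt_inf P x0 mu sigma W F.
  have -> : F = \bigcup_n [set w | (tau k w <= n%:R%:E)%E].
    apply/seteqP; split=> w /=.
      have [E|[r [E r0 _ _ _]]] := yz_spec P W x0 mu sigma y z BM yz k w; first by rewrite /F /= E eqxx.
      move=> _; exists (Num.truncn r).+1 => //=; rewrite E lee_fin.
      by have [_ h] := andP (truncn_itv r0); exact: ltW.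
    by move=> [n _ /=]; rewrite /F /=; case: (tau k w).
  apply: (@bigcupT_measurable _ (g_sigma_algebraType (\bigcup_(t in [set t : R | 0 <= t]) filt t))) => n.
  by apply: sub_sigma_algebra; exists n%:R => //=; exact: st.
split.
  have YB : Y k @^-1` B = (F `&` [set w | B (lot x0 y z k)]) `|` (~` F `&` [set w | B 0]).
    apply/seteqP; split=> w /=; rewrite yz_YE_fin /F /=; case: eqP => //= h.
    - by move=> ?; right.
    - by move=> ?; left.
    - by case=> [[]|[]].
    - by case=> [[]|[]].
  pose TI := g_sigma_algebraType (\bigcup_(t in [set t : R | 0 <= t]) filt t).
  have cst (Q : Prop) : @measurable _ TI [set w | Q].
    have [h|h] := pselect Q.
      by rewrite (_ : [set w : TI | Q] = setT); [exact: measurableT|apply/seteqP; split=> w].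
    by rewrite (_ : [set w : TI | Q] = set0); [exact: measurable0|apply/seteqP; split=> w].
  rewrite YB; apply: (@measurableU _ TI); apply: (@measurableI _ TI) => //.
  exact: (@measurableC _ TI).
move=> t t0; have [h|h] := pselect (B (lot x0 y z k)).
  rewrite (_ : _ `&` _ = [set w | (tau k w <= t%:E)%E]); first exact: st.
  apply/seteqP; split=> w /=; first by case.
  by move=> kt; split=> //; rewrite yz_YE_fin ifF //; apply/negbTE; move: kt; case: (tau k w).
rewrite (_ : _ `&` _ = set0); first by apply: filt_null => //; exact: measure0.
apply/seteqP; split=> w //= [+ kt]; rewrite yz_YE_fin ifF //.
by apply/negbTE; move: kt; case: (tau k w).
Qed.

End YZAdmissible.

(** * Upper bound for the (y, z) policy *)

Section GridPick.
Context {R : realType}.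

(* The indicators of the mesh cells sum to 1, so this is a weighted mean of values of g near r. *)
Lemma grid_pick (g : R -> R) (t r : R) : 0 < t -> 0 < r -> r <= t -> pcont g ->
  \sum_(i < n.+1) (if (gridp t n i < r) && (r <= gridp t n i.+1) then g (gridp t n i.+1) else 0)
    @[n --> \oo] --> g r.
Proof.
move=> t0 r0 rt pg; apply/cvgrPdist_le => e e0.
have [eta eta0 H] := pg r e (ltW r0) e0.
have [N HN] := small_step t t0 eta eta0.
exists N => // n /= Nn; rewrite distrC.
pose ind i : R := if (gridp t n i < r) && (r <= gridp t n i.+1) then 1 else 0.
have indE i : ind i = (r <= gridp t n i.+1)%R%:R - (r <= gridp t n i)%R%:R.
  have gS := gridpS t n i; have d0 : 0 < t / n.+1%:R by rewrite divr_gt0 ?ltr0Sn.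
  rewrite /ind; case: (ltP (gridp t n i) r) => h1; case: (leP r (gridp t n i.+1)) => h2 //=;
    rewrite ?subr0 ?subrr //.
  by have : gridp t n i < gridp t n i.+1 by [rewrite -subr_gt0 gS]; lra.
have ind1 : \sum_(i < n.+1) ind i = 1.
  under eq_bigr do rewrite indE.
  rewrite -(big_mkord xpredT (fun i => (r <= gridp t n i.+1)%R%:R - (r <= gridp t n i)%R%:R)).
  by rewrite telescope_sumr // gridp_last gridp0 rt leNgt r0 subr0.
have ind0 i : 0 <= ind i by rewrite /ind; case: ifP.
rewrite (_ : \sum_(i < n.+1) _ - g r = \sum_(i < n.+1) ind i * (g (gridp t n i.+1) - g r)); last first.
  under [RHS]eq_bigr do rewrite mulrBr.
  rewrite sumrB -mulr_suml ind1 mul1r; congr (_ - _); apply: eq_bigr => i _.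
  by rewrite /ind; case: ifP; rewrite ?mul1r ?mul0r.
apply: (le_trans (ler_norm_sum _ _ _)).
apply: (@le_trans _ _ (\sum_(i < n.+1) ind i * e)); last by rewrite -mulr_suml ind1 mul1r.
apply: ler_sum => i _; rewrite normrM ger0_norm //; rewrite /ind.
case: ifP => [/andP[h1 h2]|_]; last by rewrite !mul0r.
rewrite !mul1r; apply/ltW/H; first by rewrite gridp_ge0 // ltW.
rewrite ger0_norm ?subr_ge0 //; apply: le_lt_trans (HN n Nn).
by rewrite -(gridpS t n i); lra.
Qed.

End GridPick.

Section YZCounts.
Context {R : realType} {d : measure_display} {T : measurableType d}.
Variables (P : probability T R) (W : R -> T -> R) (x0 mu sigma y z t : R).
Hypotheses (BM : is_BM P W) (mu0 : 0 < mu) (sigma0 : 0 < sigma) (yz : y < z) (t0 : 0 < t).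
Local Notation X0 := (X0 x0 mu sigma W).
Local Notation tau := (yz_tau x0 mu sigma W y z).
Local Notation Y := (yz_Y x0 mu sigma W y z).
Local Notation A := (osum tau t Y).
Local Notation stock := (stock x0 y z).
Local Notation lot := (lot x0 y z).
Local Notation lvl := (lvl x0 y z).
Local Notation K := (norders tau t).

Let taumono k w : (tau k w <= tau k.+1 w)%E.
Proof. exact: (yz_tau_mono P W x0 mu sigma y z BM yz). Qed.

Lemma yz_good w : finorders tau t w.
Proof. exact: (yz_finite_orders P W x0 mu sigma y z BM yz t w (ltW t0)). Qed.

(** The k obtained is the true number of orders up to s, whereas [norders] is only some index past
    t. *)
Lemma yz_count s w : s <= t -> exists k, [/\ forall j, (j < k)%N -> (tau j w <= s%:E)%E,
   (s%:E < tau k w)%E & forall u : nat -> R,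
     \sum_(j < K w) (if (tau j w <= s%:E)%E then u j else 0) = \sum_(j < k) u j].
Proof.
move=> st; have KP := nordersP tau t taumono w s _ (yz_good w) st.
have ex : exists k, (s%:E < tau k w)%E by exists (K w); rewrite ltNge KP.
case: (ex_minnP ex) => k kP kmin; exists k.
have lt j : (j < k)%N -> (tau j w <= s%:E)%E.
  by move=> jk; rewrite leNgt; apply/negP => /kmin; rewrite leqNgt jk.
split=> // u; have kK : (k <= K w)%N by apply: kmin; rewrite ltNge KP.
rewrite -(subnKC kK) big_split_ord /= [X in _ + X]big1 ?addr0.
  by apply: eq_bigr => j _; rewrite lt.
move=> j _; rewrite ifF //; apply/negbTE; rewrite -ltNge; apply: (lt_le_trans kP).
by apply: (tau_le tau taumono); rewrite leq_addr.
Qed.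

Lemma yz_Y_lot k s w : (tau k w <= s%:E)%E -> Y k w = lot k.
Proof.
by move=> ks; rewrite (yz_YE_fin P W x0 mu sigma y z BM yz) ifF //; apply/negbTE; move: ks; case: (tau k w).
Qed.

Lemma sum_lot k : \sum_(j < k) lot j = stock k.
Proof. by elim: k => [|k IH]; [rewrite big_ord0|rewrite big_ord_recr stockS -IH]. Qed.

Lemma yz_A_sum s w : s <= t -> A s w = \sum_(j < K w) (if (tau j w <= s%:E)%E then lot j else 0).
Proof.
move=> st; rewrite (osum_fin tau t taumono Y s w _ (yz_good w) st (leqnn _)).
by apply: eq_bigr => j _; case: ifP => // js; exact: yz_Y_lot js.
Qed.

Lemma yz_A_stock s w : s <= t -> exists k, [/\ forall j, (j < k)%N -> (tau j w <= s%:E)%E,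
  (s%:E < tau k w)%E & A s w = stock k].
Proof.
move=> st; have [k [H1 H2 H3]] := yz_count s w st; exists k; split=> //.
by rewrite yz_A_sum // H3 sum_lot.
Qed.

(** Telescoping over the orders turns any function of the ordered amount into a sum with one term
    per order, each of which can be followed on the grid. *)
Lemma yz_tele (g : R -> R) s w : s <= t -> g (A s w) = g 0 +
  \sum_(j < K w) (if (tau j w <= s%:E)%E then g (stock j.+1) - g (stock j) else 0).
Proof.
move=> st; have [k [_ _ H]] := yz_count s w st; rewrite yz_A_sum // !H sum_lot.
rewrite (H (fun j => g (stock j.+1) - g (stock j))).
rewrite -(big_mkord xpredT (fun j => g (stock j.+1) - g (stock j))) telescope_sumr //.
by rewrite addrC subrK.
Qed.

Lemma yz_tau0_pos w : (0 < tau 0 w)%E -> y <= x0.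
Proof.
by rewrite leNgt => h; apply/negP => xy; move: h; rewrite (yz_tau0_lt P W x0 mu sigma y z BM yz) // ltxx.
Qed.

Lemma yz_inventory_ge s w : 0 < s -> s <= t -> y <= X0 s w + A s w.
Proof.
move=> s0 st; have [k [_ H ->]] := yz_A_stock s w st.
have Xl : lvl k < X0 s w.
  rewrite ltNge; apply/negP => h.
  by have := yz_tau_hit P W x0 mu sigma y z BM yz k w s s0 h; rewrite leNgt H.
apply: (@le_trans _ _ (lvl k + stock k)); last by rewrite lerD2r ltW.
case: k H Xl => [|k] H Xl; last by rewrite lvl_stock_pre.
rewrite /lvl /= mul0r subr0 addr0 min_r //.
by apply: (yz_tau0_pos w); apply: lt_trans H; rewrite lte_fin.
Qed.

(** Just after the last order the inventory is z, so the total ordered is z minus X0 at that time: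
    the running maximum of X0 controls it. *)
Lemma yz_A_bound s w : s <= t -> A s w = 0 \/ exists2 r, 0 <= r <= t & A s w <= `|z| + `|X0 r w|.
Proof.
move=> st; have [[|k] [H _ ->]] := yz_A_stock s w st; first by left.
right; have := H k (ltnSn k); have [->//|[r [-> r0 Xr _ _]]] := yz_spec P W x0 mu sigma y z BM yz k w.
rewrite lee_fin => rs; exists r; first by rewrite r0 (le_trans rs).
have := lvl_stock x0 y z k; rewrite -Xr.
have := ler_norm z; have := ler_norm (- X0 r w); rewrite normrN; lra.
Qed.

Lemma yz_A0 w : A 0 w = 0 \/ A 0 w = z - Num.min x0 y.
Proof.
have [[|[|k]] [H _ ->]] := yz_A_stock 0 w (ltW t0); [by left|by right; rewrite /stock mul0r addr0|].
have := H 1%N isT; have t00 := yz_tau_ge0 P W x0 mu sigma y z BM yz 0 w.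
have := H 0%N isT; have [->//|[r [E r0 _ _ _]]] := yz_spec P W x0 mu sigma y z BM yz 0 w.
rewrite E lee_fin => r0'; rewrite leNgt => /negP[]; apply: le_lt_trans (yz_tau_lt P W x0 mu sigma y z BM yz _ _ _ E).
by rewrite lee_fin.
Qed.

End YZCounts.

Section Auxiliary.
Context {R : realType}.

Lemma pcont_comp (g f : R -> R) : continuous g -> pcont f -> pcont (g \o f).
Proof.
move=> cg pf u e u0 e0; have /cvgrPdist_lt/(_ e e0)/nbhs_ballP[del /= del0 Hd] := cg (f u).
have [eta eta0 H] := pf u del u0 del0; exists eta => // v v0 vu /=.
by rewrite distrC; apply: Hd; rewrite /ball /= distrC; exact: H.
Qed.

Lemma cvg_finite_sum m (F : nat -> nat -> R) (l : nat -> R) :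
  (forall k, F k n @[n --> \oo] --> l k) ->
  \sum_(k < m) F k n @[n --> \oo] --> \sum_(k < m) l k.
Proof.
move=> H; elim: m => [|m IH].
  by under eq_fun do rewrite big_ord0; rewrite big_ord0; exact: cvg_cst.
by under eq_fun do rewrite big_ord_recr; rewrite big_ord_recr; exact: cvgD.
Qed.

Lemma affine_derive_bound (V v : R -> R) (a b M x y : R) :
  (forall x : R, is_derive x (1 : R) V (v x)) -> (forall x, `|v x| <= a + b * `|x|) -> 0 <= b ->
  `|x| <= M -> `|y| <= M -> `|V y - V x| <= (a + b * M) * `|y - x|.
Proof.
move=> dV vb b0; wlog xy : x y / x <= y.
  move=> H xM yM; have [xy|/ltW yx] := leP x y; first exact: H.
  by rewrite distrC (distrC y); exact: H.
move=> xM yM.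
have [c + ->] := @MVT_segment R V v x y xy (fun z _ => dV z) (continuous_subspaceT (is_derive_continuous _ _ dV)).
rewrite in_itv /= => /andP[xc cy]; rewrite normrM ler_wpM2r //.
apply: (le_trans (vb c)); rewrite lerD2l ler_wpM2l //.
by move: xM yM; rewrite !ler_norml => /andP[? ?] /andP[? ?]; apply/andP; split; lra.
Qed.

End Auxiliary.

Section YZUpper.
Context {R : realType} {d : measure_display} {T : measurableType d}.
Variables (P : probability T R) (W : R -> T -> R) (x0 mu sigma cb ch k1 k2 y z l : R).
Hypotheses (BM : is_BM P W) (mu0 : 0 < mu) (sigma0 : 0 < sigma)
  (cb0 : 0 < cb) (ch0 : 0 < ch) (k10 : 0 < k1) (k20 : 0 < k2) (yz : y < z).
Local Notation X0 := (X0 x0 mu sigma W).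
Local Notation adapted := (adapted P W x0 mu sigma).
Local Notation tau := (yz_tau x0 mu sigma W y z).
Local Notation Y := (yz_Y x0 mu sigma W y z).
Local Notation V := (Vupper mu sigma cb ch k2 l).
Local Notation v := (vupper mu sigma cb ch k2 l).
Local Notation stock := (stock x0 y z).
Local Notation lot := (lot x0 y z).
Local Notation lvl := (lvl x0 y z).
Local Notation kap := (k1 + k2 * (z - y)).
Local Notation kap0 := (k1 + k2 * (z - Num.min x0 y)).
Hypothesis Vyz : V y - V z = kap.

Let kap_gt0 : 0 < kap. Proof. by have := k10; have := k20; have := yz; nra. Qed.

Let kap0_gt0 : 0 < kap0.
Proof.
have h : Num.min x0 y <= y by rewrite ge_min lexx orbT.
by have := k10; have := k20; have := yz; nra.
Qed.

Let taumono k w : (tau k w <= tau k.+1 w)%E.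
Proof. exact: (yz_tau_mono P W x0 mu sigma y z BM yz). Qed.

Let adm : admissible P x0 mu sigma W tau Y.
Proof. exact: yz_admissible. Qed.

Let Y0 k w : 0 <= Y k w. Proof. by have [_ _ + _] := adm; apply. Qed.

(** The order times increase strictly while finite, so no two orders share an instant. *)
Lemma yz_jump k w s : (tau k w <= s%:E)%E -> jump tau Y k w = (lot k)%:E.
Proof.
move=> ks; have [E|[r [E r0 _ _ _]]] := yz_spec P W x0 mu sigma y z BM yz k w; first by move: ks; rewrite E.
rewrite /jump (@nneseries_finite _ _ k.+1).
- rewrite big_ord_recr big1 /= ?eqxx ?add0e ?(yz_Y_lot P W x0 mu sigma y z BM yz k s w ks) // => j _.
  rewrite ifF //; apply/negbTE; rewrite lt_eqF //.
  have [Ej|[rj [Ej _ _ _ _]]] := yz_spec P W x0 mu sigma y z BM yz j w.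
    have := @tau_le _ _ _ tau taumono j k w (ltnW (ltn_ord j)); rewrite Ej E leye_eq.
    by [].
  rewrite Ej; apply: (lt_le_trans (yz_tau_lt P W x0 mu sigma y z BM yz _ _ _ Ej)).
  exact: (@tau_le _ _ _ tau taumono j.+1 k w (ltn_ord j)).
- by move=> j; case: ifP => // _; rewrite lee_fin.
move=> j kj; rewrite ifF //; apply/negbTE; rewrite gt_eqF // E.
apply: (lt_le_trans (yz_tau_lt P W x0 mu sigma y z BM yz _ _ _ E)).
exact: (@tau_le _ _ _ tau taumono k.+1 j w kj).
Qed.

Lemma yz_tauS_pos k w : (0 < tau k.+1 w)%E.
Proof.
have [E|[r [E r0 _ _ _]]] := yz_spec P W x0 mu sigma y z BM yz k w.
  by apply: (lt_le_trans _ (taumono k w)); rewrite E; exact: ltry.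
by apply: le_lt_trans (yz_tau_lt P W x0 mu sigma y z BM yz _ _ _ E); rewrite lee_fin.
Qed.

Section Horizon.
Variable t : R.
Hypothesis t0 : 0 < t.
Local Notation A := (osum tau t Y).
Local Notation K := (norders tau t).
Local Notation good := (yz_good P W x0 mu sigma y z t BM yz t0).

(** Each order at a positive time changes V by V z - V y = - kap. An order at time 0 lies in no
    cell, these being open on the left. *)
Definition jlim w : R :=
  \sum_(k < K w) (if (0 < tau k w)%E && (tau k w <= t%:E)%E then - kap else 0).

Lemma yz_lot_pos k w : (0 < tau k w)%E -> lvl k + stock k = y /\ lot k = z - y.
Proof.
case: k => [|k] h; last by rewrite lvl_stock_pre.
have yx := yz_tau0_pos P W x0 mu sigma y z BM yz w h.
by rewrite /lvl /= mul0r subr0 addr0 min_r.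
Qed.

(** After exchanging the sums, order k contributes its change of V with X0 read at the right end of
    the cell containing tau_k; continuity and [grid_pick] give the limit. *)
Lemma jsum_cvg w : jsum W x0 mu sigma A t V n w @[n --> \oo] --> jlim w.
Proof.
have cV : continuous V := is_derive_continuous _ _ (Vupper_is_derive mu sigma cb ch k2 l mu0 sigma0).
pose phi k x := V (x + stock k.+1) - V (x + stock k).
have tele := yz_tele P W x0 mu sigma y z t BM yz t0.
have gt n i : (i <= n.+1)%N -> gridp t n i <= t.
  by move=> ii; rewrite -[leRHS](gridp_last t n) gridp_le // ltW.
pose F k n := \sum_(i < n.+1) (if ((gridp t n i)%:E < tau k w)%E && (tau k w <= (gridp t n i.+1)%:E)%E
    then phi k (X0 (gridp t n i.+1) w) else 0).
have JE n : jsum W x0 mu sigma A t V n w = \sum_(k < K w) F k n.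
  rewrite /jsum /F exchange_big /=; apply: eq_bigr => i _.
  set x := X0 (gridp t n i.+1) w.
  have -> : ctrl W x0 mu sigma A (gridp t n i) w + (x - X0 (gridp t n i) w) = x + A (gridp t n i) w.
    by rewrite /ctrl; ring.
  rewrite /ctrl -/x (tele (fun a => V (x + a)) _ w (gt n i.+1 (ltn_ord i))).
  rewrite (tele (fun a => V (x + a)) (gridp t n i) w (gt n i (ltnW (ltn_ord i)))).
  rewrite opprD addrACA subrr add0r -sumrB; apply: eq_bigr => k _; rewrite -/(phi k x).
  have [h|h] /= := leP (tau k w) (gridp t n i)%:E; last by rewrite subr0.
  by rewrite (le_trans h) ?subrr // lee_fin gridp_le // ltW.
under eq_fun do rewrite JE.
apply: (cvg_finite_sum (K w) F (fun k => if (0 < tau k w)%E && (tau k w <= t%:E)%E then - kap else 0)) => k.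
have [E|[r [E r0 Xr _ _]]] := yz_spec P W x0 mu sigma y z BM yz k w.
  rewrite E andbF; rewrite (_ : F k = fun=> 0); first exact: cvg_cst.
  by apply/funext => n; rewrite /F big1 // => i _; rewrite E andbF.
have [/andP[r1 rt]|] := boolP ((0 < tau k w)%E && (tau k w <= t%:E)%E); last first.
  rewrite E lte_fin lee_fin => bad; rewrite (_ : F k = fun=> 0); first exact: cvg_cst.
  apply/funext => n; rewrite /F big1 // => i _; rewrite E ifF //; apply/negbTE; apply: contra bad.
  rewrite lte_fin lee_fin => /andP[h1 h2]; apply/andP; split.
    by apply: le_lt_trans h1; rewrite gridp_ge0 // ltW.
  by apply: (le_trans h2); exact: gt.
have [ls lt] := yz_lot_pos k w r1.
have -> : - kap = phi k (X0 r w).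
  rewrite /phi Xr ls stockS lt addrA ls; have -> : y + (z - y) = z by ring.
  by rewrite -Vyz; ring.
move: r1 rt; rewrite E lte_fin lee_fin => r1 rt.
rewrite (_ : F k = fun n => \sum_(i < n.+1) (if (gridp t n i < r) && (r <= gridp t n i.+1)
    then (phi k \o X0 ^~ w) (gridp t n i.+1) else 0)); last first.
  by apply/funext => n; rewrite /F; apply: eq_bigr => i _; rewrite E lte_fin lee_fin.
apply: (grid_pick (phi k \o X0 ^~ w) t r t0 r1 rt).
apply: pcont_comp; last exact: X0_pcont BM w.
have cVs a : continuous (fun x => V (x + a)).
  move=> x; apply: (@continuous_comp _ _ _ (fun x => x + a) V) ; last exact: cV.
  by apply: cvgD; [exact: cvg_id|exact: cvg_cst].
by move=> u; apply: cvgB; exact: cVs.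
Qed.

(** - [jlim] pays for every order at a positive time. The constant [kap0] covers the first one,
    which may occur at time 0 with a larger lot. *)
Lemma yz_pathcost w : (pathcost x0 mu sigma cb ch k1 k2 W tau Y t w <=
  (runcost W x0 mu sigma A t (c0 cb ch) w - jlim w + kap0)%:E)%E.
Proof.
rewrite /pathcost (running_cost_fin P W x0 mu sigma cb ch BM cb0 ch0 tau Y t adm t0 w (good w)).
rewrite -addrA EFinD leeD2l // (@nneseries_finite _ _ (K w)).
- rewrite (eq_bigr (fun k : 'I_(K w) => (if (tau k w <= t%:E)%E then k1 + k2 * lot k else 0)%:E)); last first.
    by move=> k _; case: ifP => // kt; rewrite (yz_jump k w t kt).
  rewrite sumEFin lee_fin addrC /jlim -sumrN.
  have b0 : 0 <= kap := ltW kap_gt0.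
  have b00 : 0 <= kap0 := ltW kap0_gt0.
  case: (K w) => [|m]; first by rewrite !big_ord0 addr0.
  rewrite !big_ord_recl addrA; apply: lerD.
    have e b : 0 <= - (if b then - kap else 0) by case: b; rewrite ?opprK ?oppr0.
    by rewrite /=; case: ifP => _; [rewrite lerDl|rewrite addr_ge0].
  apply: ler_sum => k _; rewrite yz_tauS_pos /=.
  by case: ifP => _; rewrite ?opprK ?oppr0.
- move=> k; case: ifP => // kt; rewrite (yz_jump k w t kt) -EFinM -EFinD lee_fin.
  by have := lot_gt0 x0 y z yz k; have := k10; have := k20; nra.
move=> k kK; by rewrite (nordersP tau t taumono w t k (good w) (lexx t) kK).
Qed.

Lemma yz_upper_horizon Cb : (forall x, y <= x -> Cb <= V x) ->
  (\int[P]_w pathcost x0 mu sigma cb ch k1 k2 W tau Y t w <=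
   (mu * (l + k2) * t + (`|V x0| + `|V (x0 + (z - Num.min x0 y))| - Cb + kap0))%:E)%E.
Proof.
move=> VCb.
have dV := Vupper_is_derive mu sigma cb ch k2 l mu0 sigma0.
have vb := vupper_growth mu sigma cb ch k2 l mu0 sigma0 cb0 ch0.
have cV : continuous V := is_derive_continuous _ _ dV.
have vq := vupper_qapprox mu sigma cb ch k2 l mu0 sigma0 cb0 ch0.
have cv : continuous v.
  move=> x; apply/differentiable_continuous/derivable1_diffP.
  by case: (qapprox_is_derive _ _ _ x vq).
set v0 := `|v 0| in vb; set b := (cb + ch) / mu in vb.
have v00 : 0 <= v0 := normr_ge0 _.
have bb : 0 <= b by rewrite divr_ge0 ?addr_ge0 // ltW.
have [S [IS S0 HS HS2]] := X0_sup_bound P W x0 mu sigma BM mu0 sigma0 t t0.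
pose p := `|z|; have p0 : 0 <= p := normr_ge0 _.
(* The root of S bounds the running maximum of |X0|, and its square is integrable; all dominating
   functions below are at most quadratic in M. *)
pose M w := Num.sqrt (S w).
have M0 w : 0 <= M w := sqrtr_ge0 _.
have MS w : M w ^+ 2 = S w by rewrite sqr_sqrtr.
have XM w u : 0 <= u <= t -> `|X0 u w| <= M w.
  by move=> ut; rewrite -sqrtr_sqr; apply: ler_wsqrtr; exact: HS2.
have A0 s w : 0 <= A s w by exact: osum_ge0.
have Amono w s s' : s <= s' -> s' <= t -> A s w <= A s' w by move=> *; exact: osum_mono.
have AM s w : s <= t -> A s w <= p + M w.
  move=> st; have [->|[r rt h]] := yz_A_bound P W x0 mu sigma y z t BM yz t0 s w st; first exact: addr_ge0.
  by apply: (le_trans h); rewrite lerD2l XM.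
have M1 w : M w <= 1 + S w.
  by rewrite -MS; have := sqr_ge0 (M w - 1); have := M0 w; nra.
have bad0 : P (~` finorders tau t) = 0%E.
  rewrite (_ : ~` _ = set0) ?measure0 //; apply/seteqP; split=> w //; apply; exact: good.
have aA s : 0 <= s -> s <= t -> adapted s (A s).
  move=> s0 st; apply: (osum_adapted P W x0 mu sigma BM tau Y t adm t0) => // k.
  exact: (order_term_adapted P W x0 mu sigma BM tau Y adm).
have mA s : 0 <= s -> s <= t -> measurable_fun setT (A s).
  by move=> s0 st; exact: adapted_measurable P W x0 mu sigma BM _ _ (aA s s0 st).
have IA : Intg P (A t).
  apply: (Intg_le _ _ (fun w => p + (1 + S w))); first exact: mA (ltW t0) (lexx _).
    by apply: IntgD; [exact: Intg_cst|apply: IntgD => //; exact: Intg_cst].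
  by move=> w; rewrite ger0_norm //; apply: (le_trans (AM t w (lexx _))); rewrite lerD2l.
pose X s w := X0 s w + A s w.
have XB s w : 0 <= s -> s <= t -> `|X s w| <= p + 2 * M w.
  move=> s0 st; apply: (le_trans (ler_normD _ _)); rewrite (ger0_norm (A0 s w)).
  have h1 : `|X0 s w| <= M w by apply: XM; rewrite s0.
  by have := AM s w st; lra.
pose Q w := 2 * p ^+ 2 + 8 * S w.
have QX w : (p + 2 * M w) ^+ 2 <= Q w.
  by rewrite /Q -MS; have := sqr_ge0 (p - 2 * M w); nra.
have Q1 w : p + 2 * M w <= 1 + Q w.
  by have := QX w; have := sqr_ge0 (p + 2 * M w - 1); nra.
have IQ : Intg P Q by apply: IntgD; [exact: Intg_cst|exact: IntgZ].
have IQ1 : Intg P (fun w => 1 + Q w) by apply: IntgD => //; exact: Intg_cst.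
have mX s : 0 <= s -> s <= t -> measurable_fun setT (X s).
  by move=> s0 st; apply: measurable_funD; [exact: X0_measurable BM _|exact: mA].
have Iv s : 0 <= s -> s <= t -> Intg P (fun w => v (X s w)).
  move=> s0 st; apply: (Intg_le _ _ (fun w => v0 + b * (1 + Q w))).
  - by apply: measurableT_comp; [exact: continuous_measurable_fun|exact: mX].
  - by apply: IntgD; [exact: Intg_cst|exact: IntgZ].
  - move=> w; apply: (le_trans (vb _)); rewrite lerD2l ler_wpM2l //.
    exact: le_trans (XB s w s0 st) (Q1 w).
have IV s : 0 <= s -> s <= t -> Intg P (fun w => V (X s w)).
  move=> s0 st; apply: (Intg_le _ _ (fun w => `|V 0| + (v0 * (1 + Q w) + b * Q w))).
  - by apply: measurableT_comp; [exact: continuous_measurable_fun|exact: mX].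
  - by apply: IntgD; [exact: Intg_cst|apply: IntgD; exact: IntgZ].
  - move=> w; have h := XB s w s0 st; have p2 : 0 <= p + 2 * M w by rewrite addr_ge0 // mulr_ge0.
    have := affine_derive_bound V v v0 b (p + 2 * M w) 0 (X s w) dV vb bb _ h.
    rewrite normr0 subr0 => /(_ p2) h2.
    have := ler_normD (V (X s w) - V 0) (V 0); rewrite subrK => /le_trans; apply.
    rewrite addrC lerD2l; apply: (le_trans h2).
    apply: (@le_trans _ _ ((v0 + b * (p + 2 * M w)) * (p + 2 * M w))).
      by rewrite ler_wpM2l // addr_ge0 // mulr_ge0.
    rewrite mulrDl -mulrA -expr2; apply: lerD; rewrite ler_wpM2l //.
pose G w := v0 * (p + (1 + S w)) + b * (4 * p ^+ 2 + 4 * S w).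
have IG : Intg P G.
  apply: IntgD; apply: IntgZ; apply: IntgD; try exact: Intg_cst; last exact: IntgZ.
  by apply: IntgD => //; exact: Intg_cst.
have gt n i : (i <= n.+1)%N -> gridp t n i <= t.
  by move=> ii; rewrite -[leRHS](gridp_last t n) gridp_le // ltW.
have g0 n i : 0 <= gridp t n i := gridp_ge0 t n i (ltW t0).
have JG n w : `|jsum W x0 mu sigma A t V n w| <= G w.
  (* Bound of V' along the path. The jumps of V sum to at most B times the total ordered, which is
     again quadratic in M. *)
  pose B := v0 + b * (p + 2 * M w).
  have B0 : 0 <= B by rewrite addr_ge0 // mulr_ge0 // addr_ge0 // mulr_ge0.
  apply: (@le_trans _ _ (B * (p + M w))); last first.
    have -> : B * (p + M w) = v0 * (p + M w) + b * ((p + 2 * M w) * (p + M w)) by rewrite /B; ring.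
    apply: lerD; first by rewrite ler_wpM2l // lerD2l.
    rewrite ler_wpM2l // -MS; have := sqr_ge0 (p - M w); have := mulr_ge0 p0 (M0 w); nra.
  apply: (le_trans (ler_norm_sum _ _ _)).
  apply: (@le_trans _ _ (\sum_(i < n.+1) B * (A (gridp t n i.+1) w - A (gridp t n i) w))).
    apply: ler_sum => i _; set x := X0 (gridp t n i.+1) w.
    have i1 := gt n i.+1 (ltn_ord i); have i0 := gt n i (ltnW (ltn_ord i)).
    have -> : ctrl W x0 mu sigma A (gridp t n i) w + (x - X0 (gridp t n i) w) = x + A (gridp t n i) w.
      by rewrite /ctrl; ring.
    have ii : A (gridp t n i) w <= A (gridp t n i.+1) w.
      by apply: Amono => //; rewrite gridp_le // ltW.
    have xM : `|x| <= M w by apply: XM; rewrite g0.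
    have bd s : s <= t -> `|x + A s w| <= p + 2 * M w.
      move=> st; apply: (le_trans (ler_normD _ _)); rewrite (ger0_norm (A0 s w)).
      by have := AM s w st; lra.
    apply: (le_trans (affine_derive_bound V v v0 b (p + 2 * M w) _ _ dV vb bb (bd _ i0) (bd _ i1))).
    rewrite ler_wpM2l //; have -> : x + A (gridp t n i.+1) w - (x + A (gridp t n i) w) =
      A (gridp t n i.+1) w - A (gridp t n i) w by ring.
    by rewrite ger0_norm ?subr_ge0.
  rewrite -mulr_sumr -(big_mkord xpredT (fun i => A (gridp t n i.+1) w - A (gridp t n i) w)).
  rewrite telescope_sumr // gridp_last gridp0 ler_wpM2l //.
  by have := AM t w (lexx _); have := A0 0 w; lra.
have W0 : forall w, W 0 w = 0 by case: BM.
have VC0 w : V (ctrl W x0 mu sigma A 0 w) <= `|V x0| + `|V (x0 + (z - Num.min x0 y))|.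
  rewrite /ctrl /Defs.X0 W0 !mulr0 subr0 addr0.
  have [->|->] := yz_A0 P W x0 mu sigma y z t BM yz t0 w.
    by rewrite addr0; apply: (le_trans (ler_norm _)); rewrite lerDl.
  by apply: (le_trans (ler_norm _)); rewrite lerDr.
have VC w : - - Cb <= V (ctrl W x0 mu sigma A t w).
  by rewrite opprK; apply: VCb; exact: (yz_inventory_ge P W x0 mu sigma y z t BM yz t0 t w t0 (lexx _)).
have gen x : sigma ^+ 2 / 2 * hpot1 mu sigma cb ch x - mu * v x + c0 cb ch x <= mu * (l + k2).
  by rewrite (Vupper_generator mu sigma cb ch k2 l mu0 sigma0).
have [IJ main] := drift_upper_bound P W x0 mu sigma BM mu0 sigma0 A t t0 aA
  (fun w s s' _ ss st => Amono w s s' ss st) (A0 0) IA (c0 cb ch) (cb + ch)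
  (c0_lip cb ch cb0 ch0) V v (hpot1 mu sigma cb ch) _ _ (mu * (l + k2)) (- Cb) dV vq
  (hpot1_bound mu sigma cb ch mu0 sigma0 cb0 ch0) IV Iv jlim G _ gen VC VC0 jsum_cvg IG JG.
have [Irun _ _] := runcost_mean P W x0 mu sigma BM mu0 sigma0 A t t0 aA
  (fun w s s' _ ss st => Amono w s s' ss st) (A0 0) IA (c0 cb ch) (cb + ch) (c0_lip cb ch cb0 ch0).
have IB := IntgB P _ _ Irun IJ.
have IBk := IntgD P _ _ IB (Intg_cst P kap0).
apply: (@le_trans _ _ (\int[P]_w (runcost W x0 mu sigma A t (c0 cb ch) w - jlim w + kap0)%:E)%E).
  apply: integral_monotone => w; last exact: yz_pathcost.
  exact: (pathcost_ge0 P W x0 mu sigma cb ch k1 k2 cb0 ch0 k10 k20 tau Y t adm).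
rewrite (ExEFin P _ IBk) (ExD P _ _ IB (Intg_cst P kap0)) (ExB P _ _ Irun IJ) Ex_cst lee_fin.
by move: main; move: (Ex P _) (Ex P jlim) => e1 e2 h; lra.
Qed.

End Horizon.

Lemma yz_upper : exists C, forall t, 0 < t ->
  (\int[P]_w pathcost x0 mu sigma cb ch k1 k2 W tau Y t w <= (mu * (l + k2) * t + C)%:E)%E.
Proof.
have [Cb VCb] := Vupper_bounded_below mu sigma cb ch k2 l mu0 sigma0 ch0 y.
by eexists => t t0; exact: yz_upper_horizon VCb.
Qed.

End YZUpper.

(** * Optimality *)

Section LongRunAverage.
Context {R : realType} {d : measure_display} {T : measurableType d}.
Variables (P : probability T R) (W : R -> T -> R) (x0 mu sigma cb ch k1 k2 : R)
  (tau : nat -> T -> \bar R) (Y : nat -> T -> R).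
Local Notation cost t := (\int[P]_w pathcost x0 mu sigma cb ch k1 k2 W tau Y t w)%E.
Local Notation J0 := (J0 P x0 mu sigma cb ch k1 k2 W tau Y).

Lemma J0_le (F C : R) : (forall t, 0 < t -> (cost t <= (F * t + C)%:E)%E) -> (J0 <= F%:E)%E.
Proof.
move=> H; apply/lee_addgt0Pr => e e0; rewrite -EFinD.
pose M := `|C| / e.
apply: (@le_trans _ _ (ereal_sup [set (t^-1%:E * cost t)%E | t in [set t : R | M <= t /\ 0 < t]])).
  by apply: ereal_inf_lbound; exists M.
apply: ge_ereal_sup => _ [t [/= Mt t0] <-].
apply: (@le_trans _ _ (t^-1%:E * (F * t + C)%:E)%E).
  by rewrite lee_pmul2l ?lte_fin ?invr_gt0 //; exact: H.
rewrite -EFinM lee_fin mulrDr mulrCA mulVf ?gt_eqF // mulr1 lerD2l mulrC ler_pdivrMr //.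
apply: (le_trans (ler_norm _)); move: Mt; rewrite ler_pdivrMr //.
by rewrite mulrC.
Qed.

Lemma J0_ge (F : R) : (forall eps, 0 < eps -> exists C, forall t, 0 < t ->
  (((F - eps) * t - C)%:E <= cost t)%E) -> (F%:E <= J0)%E.
Proof.
move=> H; apply: le_ereal_inf_tmp => _ [M _ <-]; apply/lee_addgt0Pr => e e0.
have e2 : 0 < e / 2 by rewrite divr_gt0.
have [C HC] := H _ e2.
(* A time beyond M at which the constant costs at most e / 2 per unit of time; one such time in each
   tail bounds the limsup from below. *)
pose t := `|M| + `|C| / (e / 2) + 1.
have Ce : 0 <= `|C| / (e / 2) by rewrite divr_ge0 // ltW.
have t0 : 0 < t by rewrite ltr_wpDl // addr_ge0.
have Mt : M <= t by have := ler_norm M; rewrite /t; lra.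
apply: (@le_trans _ _ ((t^-1%:E * cost t) + e%:E)%E); last first.
  by rewrite leeD2r //; apply: ereal_sup_ubound; exists t.
rewrite -leeBlDr // -EFinB; apply: (@le_trans _ _ (t^-1%:E * ((F - e / 2) * t - C)%:E)%E); last first.
  by rewrite lee_pmul2l ?lte_fin ?invr_gt0 //; exact: HC.
rewrite -EFinM lee_fin mulrBr mulrCA mulVf ?gt_eqF // mulr1.
have : t^-1 * C <= e / 2.
  rewrite mulrC ler_pdivrMr //; apply: (le_trans (ler_norm _)).
  by rewrite mulrC -ler_pdivrMr // /t; have := normr_ge0 M; lra.
by lra.
Qed.

End LongRunAverage.

Theorem theorem6p2 (R : realType) (d : measure_display) (T : measurableType d)
  (P : probability T R) (W : R -> T -> R) (x0 mu sigma cb ch k1 k2 : R) :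
  is_BM P W -> 0 < mu -> 0 < sigma ->
  0 < cb -> 0 < ch -> 0 < k1 -> 0 < k2 ->
  exists y z : R,
    [/\ y < z,
        F0 x0 mu sigma cb ch k1 k2 y z = F0star x0 mu sigma cb ch k1 k2,
        admissible P x0 mu sigma W (yz_tau x0 mu sigma W y z) (yz_Y x0 mu sigma W y z),
        J0 P x0 mu sigma cb ch k1 k2 W (yz_tau x0 mu sigma W y z) (yz_Y x0 mu sigma W y z)
          = F0 x0 mu sigma cb ch k1 k2 y z
      & forall (tau : nat -> T -> \bar R) (Y : nat -> T -> R),
          admissible P x0 mu sigma W tau Y ->
          (J0 P x0 mu sigma cb ch k1 k2 W (yz_tau x0 mu sigma W y z) (yz_Y x0 mu sigma W y z)
           <= J0 P x0 mu sigma cb ch k1 k2 W tau Y)%E].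
Proof.
move=> BM mu0 sigma0 cb0 ch0 k10 k20.
have [y [z [yz min]]] := avgcost_minimizer mu sigma cb ch k1 mu0 sigma0 cb0 ch0 k10.
set l := avgcost mu sigma cb ch k1 y z in min.
have zy0 : 0 < z - y by rewrite subr_gt0.
have F0yz y' z' : y' < z' ->
    F0 x0 mu sigma cb ch k1 k2 y' z' = (mu * (avgcost mu sigma cb ch k1 y' z' + k2))%:E.
  by move=> yz'; rewrite F0E.
have opt : F0 x0 mu sigma cb ch k1 k2 y z = (mu * (l + k2))%:E by rewrite F0yz.
have star : F0 x0 mu sigma cb ch k1 k2 y z = F0star x0 mu sigma cb ch k1 k2.
  apply/eqP; rewrite eq_le; apply/andP; split; last first.
    by apply: ereal_inf_lbound; exists (y, z) => //=; exact: ltW.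
  apply: le_ereal_inf_tmp => _ [[y' z'] /= yz' <-].
  case: (ltgtP y' z') yz' => // [{}yz' _|<- _]; last by rewrite [leRHS]/F0 ltxx leey.
  by rewrite opt F0yz // lee_fin ler_pM2l // lerD2r min.
have lower (tau : nat -> T -> \bar R) (Y : nat -> T -> R) : admissible P x0 mu sigma W tau Y ->
    ((mu * (l + k2))%:E <= J0 P x0 mu sigma cb ch k1 k2 W tau Y)%E.
  move=> adm; apply: J0_ge => eps eps0.
  have bound y' z' : y' < z' -> - k1 <=
      Hpot mu sigma cb ch z' - Hpot mu sigma cb ch y' - l * (z' - y').
    move=> yz'; have := min y' z' yz'; rewrite [leRHS]/avgcost ler_pdivlMr ?subr_gt0 //.
    by move: (l * _) => ll; lra.
  have [V [v [q [L [Q [C [[dV vq] qQ gen Vjump [VC vC VQ]]]]]]]] :=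
    lower_function mu sigma cb ch k1 k2 l mu0 sigma0 cb0 ch0 k10 k20 bound eps eps0.
  exists (C - V x0) => t t0; rewrite opprB addrA.
  exact: (admissible_lower P W x0 mu sigma cb ch k1 k2 BM mu0 sigma0 cb0 ch0 k10 k20 tau Y t
    adm t0 V v q L Q C _ dV vq qQ gen Vjump VC vC VQ).
have adm := yz_admissible P W x0 mu sigma y z BM mu0 sigma0 yz.
(* At the minimizing pair the jump inequality is an equality, by the definition of l. *)
have Vyz : Vupper mu sigma cb ch k2 l y - Vupper mu sigma cb ch k2 l z = k1 + k2 * (z - y).
  have : l * (z - y) = k1 + Hpot mu sigma cb ch z - Hpot mu sigma cb ch y.
    by rewrite /l /avgcost divfK // gt_eqF.
  rewrite /Vupper; move: (Hpot _ _ _ _ z) (Hpot _ _ _ _ y) => a b E.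
  have -> : b - (l + k2) * y - (a - (l + k2) * z) = b - a + l * (z - y) + k2 * (z - y) by ring.
  by rewrite E; ring.
have [C upper] := yz_upper P W x0 mu sigma cb ch k1 k2 y z l BM mu0 sigma0 cb0 ch0 k10 k20 yz Vyz.
have J0F := J0_le P W x0 mu sigma cb ch k1 k2 _ _ _ _ upper.
exists y, z; split; [exact: yz|exact: star|exact: adm| |].
  by rewrite opt; apply: le_anti; rewrite J0F; apply: lower; exact: adm.
by move=> tau Y admY; apply: (le_trans J0F); exact: lower.
Qed.
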